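(* There is a universal constant $\alpha\in\mathbb{N}$ such that the following holds. Let $G$ be a graph with $m$ edges and let $L\le f$. One can deterministically compute an $(L,f)$-replacement path covering $\mathcal{G}_{L,f}$ of $G$ with covering value at most $(\alpha cLf)^{L+1}$ if $f\ge m^{1/c}$ for some constant $c\in\mathbb{N}$, at most $(\alpha Lf)^{L+2}\log m$ if $f\le\log m$, and at most $(\alpha Lf\log m)^{L+1}$ otherwise, in time $m\cdot(\log m)^{O(1)}\cdot|\mathcal{G}_{L,f}|$, which in addition satisfies the following. For every path $P$ in $G$ with $d\le L$ edges there exists a collection $\mathcal{G}_P\subseteq\mathcal{G}_{L,f}$ such that: (I1) $|\mathcal{G}_P|=fL\cdot\mathrm{polylog}(m)$; (I2) given $P$ and $\mathcal{G}_{L,f}$, the subgraphs of $\mathcal{G}_P$ can be identified in time $fdL\cdot\mathrm{polylog}(m)$; (I3) every subgraph in $\mathcal{G}_P$ contains all edges of $P$; (I4) for every set $F\subseteq E$ of at most $f$ edges disjoint from $P$, at least $|\mathcal{G}_P|/2$ subgraphs in $\mathcal{G}_P$ contain no edge of $F$; (I5) every subgraph in $\mathcal{G}_P$ has at most $m/f$ edges; (I6) the edge set of each $G_i\in\mathcal{G}_{L,f}$ can be computed in $\widetilde{O}(m/f)$ time. Additionally, for the analogous vertex-fault covering $\mathcal{G}^v_{L,f}$ of a graph on $n$ vertices with vertex fault parameter $f$: (I5v) every subgraph in $\mathcal{G}_P$ has at most $n/f$ vertices, and (I6v) the vertex set of each $G_i\in\mathcal{G}^v_{L,f}$ can be computed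 in $\widetilde{O}(n/f)$ time.
   Context: For a (possibly weighted) graph $G=(V,E)$, $s,t\in V$ and $F\subseteq E$, a replacement path $P(s,t,F)$ is a shortest $s$-$t$ path in $G\setminus F$. A subgraph $G'$ covers $P(s,t,F)$ if $P(s,t,F)\subseteq G'$ and $F\cap E(G')=\emptyset$. A collection of subgraphs is an $(L,f)$-replacement path covering if for every $s,t\in V$ and $F\subseteq E$ with $|F|\le f$, each replacement path $P(s,t,F)$ with at most $L$ edges is covered by some subgraph (if there are several such shortest paths, covering one suffices). The vertex-fault variant is defined identically with $F\subseteq V$, $|F|\le f$, $P(s,t,F)$ a shortest $s$-$t$ path in $G\setminus F$, and covering meaning $P\subseteq G'$ and $F\cap V(G')=\emptyset$. The covering value is the number of subgraphs.
   Formalization: Proved for L≥1; (I5) reads max(m/f, d), (I6) Õ(max(m/f, L)), (I5v) max(n/f, d+1), (I6v) Õ(max(n/f, L+1)); time bounds use m+1, n+1, d+1 for m, n, d; the vertex covering value has L+1 and n in place of L and m (exponents L+2, L+3, L+2). *)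

(* Defs.v *)
From HB Require Import structures.
From mathcomp Require Import all_boot all_order all_algebra.
Set Implicit Arguments.
Unset Strict Implicit.
Unset Printing Implicit Defensive.

Import Order.TTheory GRing.Theory Num.Theory.
Local Open Scope nat_scope.

(* -------------------------------------------------------------------------- *)
(*  Graphs, paths, replacement paths                                          *)
(* -------------------------------------------------------------------------- *)

(* A finite simple undirected graph on the vertex set 'I_n with edge set 'I_m,
   given as a list of edges.  Every edge {u, v} is listed once, smaller endpoint
   first; this rules out loops and parallel edges. *)
Record graph (n m : nat) := Graph {
  ends :> 'I_m -> 'I_n * 'I_n;
  ends_lt : forall e, (ends e).1 < (ends e).2;
  ends_inj : injective ends }.

Section Paths.
Variables (n m : nat) (G : graph n m).

Definition edge_of (u v : 'I_n) : option 'I_m :=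
  [pick e | (G e == (u, v)) || (G e == (v, u))].

Definition adj_minus (FE : {set 'I_m}) (u v : 'I_n) : bool :=
  if edge_of u v is Some e then e \notin FE else false.

(* The (simple) path s :: p runs from s to t in G minus the edges FE and the
   vertices FV.  It has size p edges. *)
Definition st_path (FE : {set 'I_m}) (FV : {set 'I_n}) (s t : 'I_n)
    (p : seq 'I_n) : bool :=
  [&& path (adj_minus FE) s p, uniq (s :: p), last s p == t
    & all (fun v => v \notin FV) (s :: p)].

Definition path_edges (s : 'I_n) (p : seq 'I_n) : seq 'I_m :=
  pmap (fun uv => edge_of uv.1 uv.2) (zip (s :: p) p).

Definition weight (R : realDomainType) (w : 'I_m -> R) (s : 'I_n)
    (p : seq 'I_n) : R :=
  (\sum_(e <- path_edges s p) w e)%R.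

Definition replacement_path (R : realDomainType) (w : 'I_m -> R)
    (FE : {set 'I_m}) (FV : {set 'I_n}) (s t : 'I_n) (p : seq 'I_n) : Prop :=
  st_path FE FV s t p /\
  forall p', st_path FE FV s t p' -> (weight w s p <= weight w s p')%R.

(* The i-th subgraph is the spanning subgraph of G with edge set cov i. *)
Definition edge_rpc (R : realDomainType) (w : 'I_m -> R) (L f N : nat)
    (cov : 'I_N -> {set 'I_m}) : Prop :=
  forall (s t : 'I_n) (F : {set 'I_m}), #|F| <= f ->
  (exists p, replacement_path w F set0 s t p /\ size p <= L) ->
  exists (p : seq 'I_n) (i : 'I_N),
    [/\ replacement_path w F set0 s t p, size p <= L,
        {subset path_edges s p <= cov i} & [disjoint F & cov i]].

(* The i-th subgraph is the subgraph of G induced by the vertex set cov i. *)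
Definition vertex_rpc (R : realDomainType) (w : 'I_m -> R) (L f N : nat)
    (cov : 'I_N -> {set 'I_n}) : Prop :=
  forall (s t : 'I_n) (F : {set 'I_n}), #|F| <= f ->
  (exists p, replacement_path w set0 F s t p /\ size p <= L) ->
  exists (p : seq 'I_n) (i : 'I_N),
    [/\ replacement_path w set0 F s t p, size p <= L,
        {subset s :: p <= cov i} & [disjoint F & cov i]].

End Paths.

(* -------------------------------------------------------------------------- *)
(*  Quantitative bounds                                                       *)
(* -------------------------------------------------------------------------- *)

(* The floor of the binary logarithm.  For natural f and x >= 1, f <= lg x holds
   iff f <= log_2 x; inside the bounds below, taking the floor or changing the
   base only affects the constants. *)
Definition lg (x : nat) : nat := trunc_log 2 x.

(* A generic polylogarithmic factor; the successor keeps it positive for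
   x <= 1. *)
Definition polylog (C k x : nat) : nat := C * (lg x).+1 ^ k.

(* x is the size of the ground set (edges or vertices) and K the maximal number
   of its elements on a path with at most L edges: K = L for edges, K = L + 1
   for vertices.  The condition f >= x^(1/c) is written x <= f^c. *)
Definition covering_value_bound (alpha K f x N : nat) : Prop :=
  forall c : nat, 0 < c ->
  [/\ x <= f ^ c -> N <= (alpha * c * K * f) ^ K.+1,
      f <= lg x -> N <= (alpha * K * f) ^ K.+2 * lg x
    & ~~ (x <= f ^ c) -> ~~ (f <= lg x) ->
      N <= (alpha * K * f * lg x) ^ K.+1].

(* -------------------------------------------------------------------------- *)
(*  Word RAM                                                                  *)
(* -------------------------------------------------------------------------- *)

(* A deterministic word RAM with structured control flow, a read-only input
   array, a random-access memory of words and a write-only output stream.  Words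
   are the naturals below B; an execution that would create a word >= B is
   stuck.  Every operation has unit cost. *)

Inductive binop := OAdd | OSub | OMul | ODiv | OMod | OLt | OEq.

Inductive expr :=
  | Const of nat
  | Fetch of expr
  | Input of expr
  | Bin of binop & expr & expr.

Inductive cmd :=
  | Skip
  | Store of expr & expr
  | Emit of expr
  | Seq of cmd & cmd
  | If of expr & cmd & cmd
  | While of expr & cmd.

Definition binop_sem (o : binop) (x y : nat) : nat :=
  match o with
  | OAdd => x + y | OSub => x - y | OMul => x * y
  | ODiv => x %/ y | OMod => x %% y
  | OLt => x < y | OEq => x == y
  end.

Fixpoint ecost (e : expr) : nat :=
  match e with
  | Const _ => 1
  | Fetch a | Input a => (ecost a).+1
  | Bin _ a b => (ecost a + ecost b).+1
  end.

Definition word (B v : nat) : option nat := if v < B then Some v else None.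

Fixpoint eval (B : nat) (inp : seq nat) (mem : nat -> nat) (e : expr) :
    option nat :=
  match e with
  | Const c => word B c
  | Fetch a => obind (fun x => word B (mem x)) (eval B inp mem a)
  | Input a => obind (fun x => word B (nth 0 inp x)) (eval B inp mem a)
  | Bin o a b =>
      obind (fun x => obind (fun y => word B (binop_sem o x y))
                            (eval B inp mem b))
            (eval B inp mem a)
  end.

Record state := State { memory : nat -> nat; output : seq nat }.

Definition store (mem : nat -> nat) (a v : nat) : nat -> nat :=
  fun x => if x == a then v else mem x.

(* exec B inp c st t st': started in st on the input inp, the program c halts in
   st' after t steps. *)
Inductive exec (B : nat) (inp : seq nat) :
    cmd -> state -> nat -> state -> Prop :=
  | ExecSkip st : exec B inp Skip st 1 st
  | ExecStore a e x v st :
      eval B inp (memory st) a = Some x -> eval B inp (memory st) e = Some v ->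
      exec B inp (Store a e) st (ecost a + ecost e).+1
           (State (store (memory st) x v) (output st))
  | ExecEmit e v st :
      eval B inp (memory st) e = Some v ->
      exec B inp (Emit e) st (ecost e).+1
           (State (memory st) (rcons (output st) v))
  | ExecSeq c1 c2 st1 st2 st3 t1 t2 :
      exec B inp c1 st1 t1 st2 -> exec B inp c2 st2 t2 st3 ->
      exec B inp (Seq c1 c2) st1 (t1 + t2).+1 st3
  | ExecIf e c1 c2 v st st' t :
      eval B inp (memory st) e = Some v ->
      exec B inp (if v != 0 then c1 else c2) st t st' ->
      exec B inp (If e c1 c2) st (ecost e + t).+1 st'
  | ExecWhileStop e c st :
      eval B inp (memory st) e = Some 0 ->
      exec B inp (While e c) st (ecost e).+1 st
  | ExecWhileStep e c v st1 st2 st3 t1 t2 :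
      eval B inp (memory st1) e = Some v -> v != 0 ->
      exec B inp c st1 t1 st2 -> exec B inp (While e c) st2 t2 st3 ->
      exec B inp (While e c) st1 (ecost e + t1 + t2).+1 st3.

Definition runs (B : nat) (c : cmd) (inp : seq nat) (mem : nat -> nat) (t : nat)
    (mem' : nat -> nat) (out : seq nat) : Prop :=
  exec B inp c (State mem [::]) t (State mem' out).

Definition mem0 : nat -> nat := fun _ => 0.

(* -------------------------------------------------------------------------- *)
(*  Encodings of inputs and outputs                                           *)
(* -------------------------------------------------------------------------- *)

Definition encode_instance (n m : nat) (G : graph n m) (L f : nat) : seq nat :=
  [:: n; m; L; f] ++
  flatten [seq [:: nat_of_ord (G e).1; nat_of_ord (G e).2] | e <- enum 'I_m].

Definition encode_seq (x : nat) (s : seq 'I_x) : seq nat :=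
  size s :: [seq nat_of_ord i | i <- s].

(* Without repetitions, in an arbitrary order. *)
Definition lists (x : nat) (s : seq nat) (A : {set 'I_x}) : Prop :=
  perm_eq s [seq nat_of_ord i | i <- enum A].

Definition lists_family (x N : nat) (s : seq nat) (cov : 'I_N -> {set 'I_x}) :
    Prop :=
  exists ss : seq (seq nat),
    [/\ size ss = N, s = N :: flatten [seq size l :: l | l <- ss]
      & forall i : 'I_N, lists (nth [::] ss i) (cov i)].

(* Main.v *)
(** Let the ground set be the edges (or the vertices), and x its size.  Take a
    family of hash functions on the ground set, and for every hash function and
    every tuple of at most K values the subgraph of the elements whose hash value
    occurs in the tuple.  For a path P let G_P consist of the subgraphs given by
    the hash functions and the tuples of the values of the elements of P.  All of
    them contain P, and such a subgraph meets a fault set F only if an element of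
    F collides with one of P.  Any two elements collide under at most a fraction
    1/(2Kf) of the hash functions, so at least half of G_P avoids F.

    The hash functions are the positions of a Reed-Solomon code of length
    4Kf * k over F_p, where p > 4Kf * k is prime and the messages are the elements,
    written in base p.  This suffices for the covering value unless f <= log x;
    then the values are hashed further by u |-> (a u mod p) mod q with q = 48Kf,
    where the multipliers a are chosen greedily: the weight of a pair of residues
    doubles with every multiplier under which it collides, and each new multiplier
    minimises the total weight, so that no pair collides too often.

    The hash values are balanced: the elements of value w are spread evenly over
    the blocks of p consecutive elements, and those in a given block are found by
    inverting a and solving for the last digit.  This bounds the size of the
    subgraphs and gives the output-sensitive enumeration. *)

Require Import Defs.
From HB Require Import structures.
From mathcomp Require Import all_boot all_order all_algebra.
From mathcomp Require Import zify ring.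
Set Implicit Arguments.
Unset Strict Implicit.
Unset Printing Implicit Defensive.

Local Open Scope nat_scope.

(** * A prime in every interval (X, 256 X] *)

(** The three cases of [covering_value_bound] overlap, so a single [N] has to meet every bound that
    applies. This shapes [use_inner]. Going from [p] down to [48Kf] values multiplies the number of
    hash functions by about [Kf log x] and saves about [k^(K+1)] in the number of tuples, so it is
    done only if the saving is larger. The condition [16 <= k] gives [p <= x], on which the balance
    rests. The condition [f <= lg x] makes [Kf] and [p] polylogarithmic in [x], so that an
    exhaustive greedy search over all multipliers and all pairs of residues is affordable; searching
    over pairs of elements would not be. The prime is chosen from [k], the number of digits in base
    [2Kf], whereas the code has length [4Kf * k1], with [k1] the number of digits in base [p]. Since
    [k1 <= k], this avoids a circular choice of [p] and the length. A prime within a constant factor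
    of [4Kf * k] is enough, as the factor goes into [alpha]. Edge and vertex faults are one case:
    [K] is [L] or [L + 1], and the assumption [K <= f + 1] covers both. *)

Lemma prod_partn (c m : nat) : 0 < c -> c <= m ->
  c = \prod_(0 <= p < m.+1) p ^ logn p c.
Proof.
move=> c0 cm; rewrite -{1}[c]partnT //.
by rewrite (@widen_partn m).
Qed.

Lemma leq_prod_nat (m n : nat) (E F : nat -> nat) :
  (forall i, m <= i < n -> E i <= F i) ->
  \prod_(m <= i < n) E i <= \prod_(m <= i < n) F i.
Proof.
move=> EF; rewrite big_nat [X in _ <= X]big_nat.
by apply: (big_ind2 leq) => // *; apply: leq_mul.
Qed.

(** Each such prime occurs in the factorization of [c] with positive exponent, and the remaining
    prime powers are at least 1. *)
Lemma prod_primes_le (h c : nat) : 0 < c ->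
  (forall p, prime p -> h < p <= h.*2 -> p %| c) ->
  \prod_(h.+1 <= p < h.*2.+1) (if prime p then p else 1) <= c.
Proof.
move=> c0 pc.
set m := maxn c h.*2.
have cm : c <= m by rewrite leq_maxl.
rewrite [X in _ <= X](prod_partn c0 cm).
have le1 : h.+1 <= h.*2.+1 by lia.
have le2 : h.*2.+1 <= m.+1 by rewrite ltnS leq_maxr.
rewrite (@big_cat_nat _ _ _ h.+1 0 m.+1) //=; last exact: leq_trans le1 le2.
rewrite (@big_cat_nat _ _ _ h.*2.+1 h.+1 m.+1) //=.
have pge a b : 0 < \prod_(a <= p < b) p ^ logn p c.
  by apply: prodn_gt0 => -[|p] //; rewrite ?expn_gt0 // ltn_neqAle eq_sym.
rewrite mulnA mulnAC; apply: leq_trans (leq_pmull _ _); last by rewrite muln_gt0 !pge.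
apply: leq_prod_nat => p hp; case: ifP => pp; last by case: p {hp pp} => [|p]; rewrite ?expn_gt0.
have pdvc : p %| c by apply: pc.
have : 0 < logn p c by rewrite logn_gt0 mem_primes pp c0 pdvc.
by case: (logn p c) => // e _; rewrite expnS leq_pmulr // expn_gt0 prime_gt0.
Qed.

Lemma bin_le_exp2 (n k : nat) : 'C(n, k) <= 2 ^ n.
Proof.
have := expnDn 1 1 n; rewrite (_ : 1 + 1 = 2) // => ->.
have [kn|kn] := leqP k n; last by rewrite bin_small.
rewrite (bigD1 (Ordinal (kn : k < n.+1))) //= !exp1n !muln1.
exact: leq_addr.
Qed.

(** A prime above [h] divides [(2h)!] but not [h!]. *)
Lemma prime_dvd_central_bin (p h : nat) : prime p -> h < p <= h.*2 ->
  p %| 'C(h.*2, h).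
Proof.
move=> pp /andP[hp ph].
have h2 : h <= h.*2 by lia.
have := bin_fact h2; rewrite (_ : h.*2 - h = h); last lia.
move=> E; have : p %| (h.*2)`! by rewrite dvdn_fact // prime_gt0.
rewrite -E !Euclid_dvdM // orbb => /orP[//|].
rewrite fact_prod Euclid_dvd_prod // big_has => /hasP[i].
rewrite mem_index_iota => /andP[i0 ih] /= /dvdn_leq; lia.
Qed.

(** Chebyshev's bound, by doubling: the primes in [(2^j, 2^(j+1)]] all divide one central binomial
    coefficient, which is at most [2^(2^(j+1))]. *)
Lemma primorial_pow2 (j : nat) :
  \prod_(1 <= p < (2 ^ j).+1) (if prime p then p else 1) <= 2 ^ (2 ^ j.+1).
Proof.
elim: j => [|j IH]; first by rewrite expn0 big_nat1.
rewrite (@big_cat_nat _ _ _ (2 ^ j).+1 1 (2 ^ j.+1).+1) //=; last by rewrite ltnS leq_exp2l.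
have -> : 2 ^ j.+1 = (2 ^ j).*2 by rewrite expnS mul2n.
apply: (@leq_trans (2 ^ 2 ^ j.+1 * 2 ^ (2 ^ j).*2)).
  apply: leq_mul IH (leq_trans _ (bin_le_exp2 _ (2 ^ j))).
  apply: prod_primes_le => [|p pp]; first by rewrite bin_gt0; lia.
  exact: prime_dvd_central_bin.
by rewrite -expnD leq_exp2l // !expnS; lia.
Qed.

Lemma central_bin_ge (n : nat) : 2 ^ n <= 'C(n.*2, n).
Proof.
elim: n => [//|n IH].
have := leq_bin2l n (leqnSn n.*2).
by rewrite doubleS !binS expnS; move: IH; lia.
Qed.

Lemma divn_double_le1 (n d : nat) : 0 < d -> n.*2 %/ d <= 2 * (n %/ d) + 1.
Proof.
move=> d0; have := divn_eq n d; have := ltn_pmod n d0.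
move: (n %% d) (n %/ d) => r t rd ->.
have -> : (t * d + r).*2 = (2 * t) * d + r.*2 by rewrite doubleD -mul2n mulnA.
rewrite divnMDl // leq_add2l.
by rewrite -ltnS ltn_divLR //; lia.
Qed.

(** By Legendre's formula the exponent is the sum of [floor(2n/p^k) - 2 floor(n/p^k)] over the
    powers [p^k <= 2n], and every term is 0 or 1. *)
Lemma logn_central_bin (p n : nat) : prime p -> 0 < n ->
  p ^ logn p 'C(n.*2, n) <= n.*2.
Proof.
move=> pp n0; have p1 := prime_gt1 pp.
set l := trunc_log p n.*2.
suff le : logn p 'C(n.*2, n) <= l.
  apply: leq_trans (trunc_logP p1 _); last by lia.
  by rewrite leq_exp2l.
have n2 : n <= n.*2 by lia.
have := bin_fact n2; rewrite (_ : n.*2 - n = n); last lia.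
move/(congr1 (logn p)); rewrite !lognM ?fact_gt0 ?muln_gt0 ?fact_gt0 ?bin_gt0 //.
rewrite !logn_fact //.
have small (k m : nat) : l < k -> m <= n.*2 -> m %/ p ^ k = 0.
  move=> lk mn; apply: divn_small; apply: leq_ltn_trans mn _.
  apply: leq_trans (trunc_log_ltn _ p1) _; by rewrite leq_exp2l.
have l2 : l <= n.*2.
  have : p ^ l <= n.*2 by apply: trunc_logP => //; lia.
  move=> H; apply: ltnW; exact: leq_trans (ltn_expl l p1) H.
have cut (m M : nat) : m <= M -> m <= n.*2 -> l <= M ->
   \sum_(1 <= k < M.+1) m %/ p ^ k = \sum_(1 <= k < l.+1) m %/ p ^ k.
  move=> mM mn lM; rewrite (@big_cat_nat _ _ _ l.+1 1 M.+1) //=.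
  rewrite [X in _ + X]big_nat [X in _ + X]big1 ?addn0 // => k /andP[lk _].
  exact: small.
have ext m : m <= n.*2 -> \sum_(1 <= k < m.+1) m %/ p ^ k = \sum_(1 <= k < l.+1) m %/ p ^ k.
  move=> mn; rewrite -(cut m n.*2) // (@big_cat_nat _ _ _ m.+1 1 n.*2.+1) //=.
  rewrite [X in _ = _ + X]big_nat [X in _ = _ + X]big1 ?addn0 // => k /andP[mk _].
  apply: divn_small; apply: ltn_trans mk _; exact: ltn_expl.
rewrite (ext n) // (ext n.*2) // => E.
have : \sum_(1 <= k < l.+1) n.*2 %/ p ^ k <= \sum_(1 <= k < l.+1) (2 * (n %/ p ^ k) + 1).
  by apply: leq_sum => k _; apply: divn_double_le1; rewrite expn_gt0 prime_gt0.
rewrite big_split /= -big_distrr /= sum_nat_const_nat.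
by move: E; move: (\sum_(_ <= _ < _) n %/ _) => S; lia.
Qed.

(** Erdos's proof of Bertrand's postulate with cruder estimates. Put [2n = 4^i] and suppose that the
    window contains no prime. In the central binomial coefficient the primes up to [2^i], the square
    root of [2n], contribute at most [2n] each; the others occur to the first power and are bounded
    together by the primorial of [4^(i-2)]. The product is below the lower bound [2^n]. *)
Lemma prime_in_pow4 (i : nat) : 5 <= i ->
  exists2 p, prime p & 4 ^ (i - 2) < p <= 4 ^ i.
Proof.
move=> i5; set X := 4 ^ (i - 2); set n := 2 ^ (i.*2.-1).
have M4 : 4 ^ i = n.*2.
  by rewrite /n -mul2n -expnS prednK ?double_gt0; [rewrite -[4]/(2 ^ 2) -expnM mul2n|lia].
have X2 : X = 2 ^ (i.*2 - 4).
  by rewrite /X -[4 in LHS]/(2 ^ 2) -expnM; congr (_ ^ _); lia.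
have n0 : 0 < n by rewrite expn_gt0.
have [//|none] : (exists2 p, prime p & 4 ^ (i - 2) < p <= 4 ^ i) \/
   (forall p, prime p -> X < p -> p <= 4 ^ i -> False).
  case: (boolP [exists p : 'I_(4 ^ i).+1, prime p && (X < p)]) => [/existsP[p /andP[pp Xp]]|].
    by left; exists p => //; rewrite Xp -ltnS ltn_ord.
  rewrite negb_exists => /forallP H; right=> p pp Xp p4.
  by have := H (Ordinal (p4 : p < (4 ^ i).+1)); rewrite /= pp Xp.
exfalso.
set c := 'C(n.*2, n).
have c0 : 0 < c by rewrite bin_gt0; lia.
set m := maxn c (maxn X (2 ^ i)).
have cm : c <= m by rewrite leq_maxl.
have Xm : X <= m by rewrite /m; lia.
have im : 2 ^ i <= m by rewrite /m; lia.
have bound : c <= (n.*2) ^ (2 ^ i) * 2 ^ (2 ^ (i.*2 - 4).+1).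
  rewrite {1}(prod_partn c0 cm).
  (* [E] pays for the full powers of the primes up to [2^i]; [F] pays for the larger primes, which
     are at most [X] and have exponent 1. *)
  pose E p := (if p <= 2 ^ i then n.*2 else 1).
  pose F p := (if p <= X then if prime p then p else 1 else 1).
  have F0 p : 0 < F p by rewrite /F; case: ifP => // _; case: ifP => // /prime_gt0.
  have E0 p : 0 < E p by rewrite /E; case: ifP => // _; lia.
  rewrite big_nat_recl // expn0 mul1n.
  rewrite (@leq_trans (\prod_(1 <= p < m.+1) (E p * F p))) //.
    rewrite [X in _ <= X]big_add1 /=; apply: leq_prod_nat => p' _.
    move: p'.+1 => p.
    case: (boolP (prime p)) => [pp|npp]; last first.
      by rewrite lognE (negbTE npp) /= muln_gt0 E0 F0.
    case: (posnP (logn p c)) => [->|l0]; first by rewrite muln_gt0 E0 F0.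
    have pn : p <= n.*2.
      apply: leq_trans (logn_central_bin pp n0).
      rewrite -/c; case: (logn p c) l0 => // e _.
      by rewrite expnS leq_pmulr // expn_gt0 prime_gt0.
    have pX : p <= X.
      rewrite leqNgt; apply/negP => Xp; apply: (none p pp Xp); by rewrite M4.
    case: (leqP p (2 ^ i)) => pi.
      rewrite {1}/E pi; apply: leq_trans (leq_pmulr _ (F0 p)).
      exact: logn_central_bin pp n0.
    rewrite /F pX pp; apply: leq_trans (leq_pmull _ (E0 p)).
    have := logn_central_bin pp n0; rewrite -/c.
    case: (logn p c) => [_|[_|e H]]; [by rewrite expn0 (prime_gt0 pp) | by rewrite expn1 | ].
    (* Exponent 2 would give [p^2 <= 2n = (2^i)^2] although [p > 2^i]. *)
    exfalso; have : p ^ 2 <= n.*2.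
      by apply: leq_trans H; rewrite leq_exp2l ?(prime_gt1 pp).
    rewrite -M4 leqNgt => /negP; apply.
    by rewrite (_ : 4 = 2 ^ 2) // -expnM mulnC expnM ltn_exp2r.
  rewrite big_split /=; apply: leq_mul.
    rewrite (@big_cat_nat _ _ _ (2 ^ i).+1 1 m.+1) //=.
    rewrite [X in _ * X]big_nat [X in _ * X]big1; last first.
      by move=> p /andP[ip _]; rewrite /E leqNgt ip.
    rewrite muln1 big_nat (eq_bigr (fun _ => n.*2)); last first.
      by move=> p /andP[_ ip]; rewrite /E -ltnS ip.
    by rewrite -big_nat prod_nat_const_nat subn1.
  rewrite (@big_cat_nat _ _ _ X.+1 1 m.+1) //=.
  rewrite [X in _ * X]big_nat [X in _ * X]big1; last first.
    by move=> p /andP[ip _]; rewrite /F leqNgt ip.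
  rewrite muln1; apply: leq_trans (primorial_pow2 _); rewrite -X2.
  apply: leq_prod_nat => p /andP[_ pX]; by move: pX; rewrite ltnS /F => ->.
have := leq_trans (central_bin_ge n) bound.
rewrite -M4 -[4]/(2 ^ 2) -!expnM -expnD leq_exp2l //.
rewrite leqNgt => /negP; apply.
rewrite /n.
have -> : i.*2.-1 = (i - 5) + (i + 4) by lia.
have -> : (i.*2 - 4).+1 = (i - 5) + (i + 2) by lia.
rewrite !expnD (_ : 2 ^ 4 = 16) // (_ : 2 ^ 2 = 4) //.
(* The comparison of exponents, divided by [2^i]. At [i = 5] it reads [10 < 12], whence the lower
   bound on [i]. *)
have key : 2 * i < 12 * 2 ^ (i - 5).
  have : i - 5 < 2 ^ (i - 5) by apply: ltn_expl.
  by move: (2 ^ _) => z; lia.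
have pi : 0 < 2 ^ i by rewrite expn_gt0.
rewrite -(ltn_pmul2r pi) in key.
by move: key; move: (2 ^ i) (2 ^ (i - 5)) => y z; nia.
Qed.

(** The constants come from small [X]: for [4 <= X <= 64] the window [(64, 1024]] serves, and
    [1024 = 4^4 * 4]. For larger [X] the window starts at the first power of 4 that is at least
    [X]. *)
Lemma weak_bertrand (X : nat) : 4 <= X ->
  exists2 p, prime p & X < p <= 4 ^ 4 * X.
Proof.
move=> X4.
have [X64|X64] := leqP X (4 ^ 3).
  have [p pp /andP[lo hi]] := prime_in_pow4 (leqnn 5).
  exists p => //; rewrite (leq_ltn_trans X64 lo) /= (leq_trans hi) //.
  by rewrite expnSr leq_mul2l X4 orbT.
set j := up_log 4 X.
have X1 : 1 < X by lia.
have lo : X <= 4 ^ j by apply: up_logP.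
have hi : 4 ^ j.-1 < X by apply: up_log_gtn.
have j3 : 3 < j by rewrite -(@ltn_exp2l 4) //; apply: leq_trans X64 lo.
have [p pp /andP[plo phi]] := @prime_in_pow4 (j + 2) ltac:(lia).
exists p => //; rewrite addnK in plo; rewrite (leq_ltn_trans lo plo) /=.
apply: leq_trans phi _; apply: leq_trans (leq_mul (leqnn _) (ltnW hi)).
by rewrite -expnD leq_exp2l //; lia.
Qed.

(** * Reed-Solomon hashing *)

Definition digit (b j e : nat) : nat := e %/ b ^ j %% b.

(** The value at [X] of the polynomial over the integers modulo [p] whose coefficients are the
    base-[p] digits of [e]. The summation limit [e] exceeds the number of digits because [e < p^e],
    so no message length has to be passed. *)
Definition rs (p X e : nat) : nat := (\sum_(j < e) digit p j e * X ^ j) %% p.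

Lemma digit_small (b j e : nat) : e < b ^ j -> digit b j e = 0.
Proof. by move=> lt; rewrite /digit divn_small // mod0n. Qed.

Lemma digitS (b j e : nat) : digit b j.+1 e = digit b j (e %/ b).
Proof. by rewrite /digit expnS divnMA. Qed.

Lemma digit_inj (b k e e' : nat) : e < b ^ k -> e' < b ^ k ->
  (forall j, j < k -> digit b j e = digit b j e') -> e = e'.
Proof.
elim: k e e' => [|k IH] e e'; first by rewrite expn0; case: e e' => [|?] [|?].
move=> he he' H.
have b0 : 0 < b by case: b he {H he' IH} => //; rewrite exp0n.
rewrite (divn_eq e b) (divn_eq e' b).
have := H 0 (ltn0Sn _); rewrite /digit expn0 !divn1 => ->.
rewrite (IH (e %/ b) (e' %/ b)) ?ltn_divLR -?expnSr // => j jk.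
by rewrite -!digitS H.
Qed.

Lemma rsE (p X e D : nat) : 1 < p -> e < p ^ D ->
  rs p X e = (\sum_(j < D) digit p j e * X ^ j) %% p.
Proof.
move=> p1 eD; rewrite /rs; congr (_ %% _).
have ee : e < p ^ e by apply: ltn_expl.
have wid A M : e < p ^ A -> A <= M ->
  \sum_(j < A) digit p j e * X ^ j = \sum_(j < M) digit p j e * X ^ j.
  move=> eA AM; rewrite (big_ord_widen M (fun j => digit p j e * X ^ j)) //.
  rewrite [RHS](bigID (fun j : 'I_M => j < A)) /= [X in _ = _ + X]big1 ?addn0 //.
  move=> j; rewrite -leqNgt => Aj; rewrite digit_small ?mul0n //.
  by apply: leq_trans eA _; rewrite leq_exp2l.
by rewrite (wid e (maxn e D)) ?leq_maxl // (wid D (maxn e D)) ?leq_maxr.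
Qed.

(** Horner's rule. The last digit enters as a plain summand, so within a block of [p] consecutive
    messages every residue is attained exactly once. *)
Lemma rs_block (p X z e0 : nat) : 1 < p -> e0 < p ->
  rs p X (z * p + e0) = (e0 + X * rs p X z) %% p.
Proof.
move=> p1 e0p.
have zz : z < p ^ z by apply: ltn_expl.
rewrite (@rsE _ _ _ z.+1) //; last first.
  by rewrite expnSr; move: zz; move: (p ^ z) => w; nia.
rewrite (@rsE _ _ _ z) // big_ord_recl /= expn0 muln1.
rewrite {1}/digit expn0 divn1 modnMDl (modn_small e0p).
rewrite -[RHS]modnDmr modnMmr modnDmr; congr ((_ + _) %% _).
rewrite big_distrr /=; apply: eq_bigr => j _.
rewrite /bump /= digitS divnMDl ?(ltnW p1) // (divn_small e0p) addn0 expnS.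
by rewrite mulnCA.
Qed.

Lemma rs_lt (p X e : nat) : 0 < p -> rs p X e < p.
Proof. exact: ltn_pmod. Qed.

(* Codewords of distinct messages agree on at most as many points as the
   difference of two polynomials of degree < k has roots. *)
Lemma rs_agree (p k l e e' : nat) : prime p -> l <= p ->
  e < p ^ k -> e' < p ^ k -> e != e' ->
  \sum_(X < l) (rs p X e == rs p X e') <= k.
Proof.
move=> pp lp ek ek' ne; have p1 := prime_gt1 pp.
pose P z : {poly 'F_p} := (\poly_(j < k) (digit p j z)%:R)%R.
have natF (a b : nat) : (a%:R == b%:R :> 'F_p)%R = (a == b %[mod p]).
  apply/eqP/eqP => [E|E].
    have := congr1 (@nat_of_ord _) E.
    by rewrite !val_Fp_nat.
  by apply: val_inj; rewrite /= !val_Fp_nat.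
have PE X z : z < p ^ k -> ((P z).[X%:R] = (rs p X z)%:R :> 'F_p)%R.
  move=> zk; rewrite horner_poly (rsE _ p1 zk).
  apply/eqP.
  rewrite (_ : (\sum_(i < k) _)%R = (\sum_(j < k) digit p j z * X ^ j)%:R)%R.
    by rewrite natF modn_mod.
  rewrite GRing.natr_sum; apply: eq_bigr => i _.
  by rewrite GRing.natrM GRing.natrX.
have PN : (P e - P e' != 0)%R.
  apply: contra ne; rewrite GRing.subr_eq0 => /eqP E; apply/eqP.
  apply: (digit_inj ek ek') => j jk.
  have := congr1 (fun q : {poly 'F_p} => (q`_j)%R) E.
  rewrite !coef_poly jk => /eqP; rewrite natF !modn_small ?ltn_pmod ?(ltnW p1) //.
  by move/eqP.
pose s := [seq (X%:R)%R : 'F_p | X <- iota 0 l & rs p X e == rs p X e'].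
(* The evaluation points stay distinct modulo [p] because [l <= p]. *)
have us : uniq s.
  rewrite map_inj_in_uniq ?filter_uniq ?iota_uniq // => a b.
  rewrite !mem_filter !mem_iota /= !add0n => /andP[_ al] /andP[_ bl] /eqP.
  by rewrite natF !modn_small ?(leq_trans _ lp) // => /eqP.
have rt : all (root (P e - P e')) s.
  apply/allP => z /mapP[X]; rewrite mem_filter => /andP[/eqP E _] ->.
  by rewrite rootE hornerD hornerN !PE // E GRing.subrr.
have := max_poly_roots PN rt us.
rewrite size_map size_filter -sum1_count => /leq_trans H.
have sz : size (P e - P e')%R <= k.
  apply: leq_trans (size_polyD _ _) _; rewrite size_polyN geq_max !size_poly.
  by [].
have := H _ sz; rewrite -(@big_mkord _ _ _ l xpredT (fun X => nat_of_bool (rs p X e == rs p X e'))).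
rewrite /index_iota subn0 big_mkcond /=.
exact: ltnW.
Qed.

(** * The balanced inner hash *)

Definition inner (p q a u : nat) : nat := (a * u) %% p %% q.

Lemma count_multiples (p q : nat) : 0 < q ->
  q * \sum_(d < p | (0 < d) && (q %| d)) 1 <= p.-1.
Proof.
move=> q0; rewrite mulnC -leq_divRL //.
case: p => [|p]; first by rewrite big_ord0.
set A := [pred d : 'I_p.+1 | (0 < d) && (q %| d)].
rewrite sum1_card -/A.
have bnd (d : 'I_p.+1) : d \in A -> (d %/ q).-1 < (p.+1.-1) %/ q.
  move=> /andP[d0 qd].
  have := dvdn_leq d0 qd; rewrite -(divn_gt0 _ q0) => dq.
  by rewrite prednK //; apply: leq_div2r; rewrite -ltnS.
rewrite -[X in _ <= X]card_ord.
have [->|/card_gt0P[d0 /bnd lt0]] := posnP #|A|; first by [].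
pose f (d : 'I_p.+1) := insubd (Ordinal lt0) (d %/ q).-1.
rewrite -(card_in_imset (f := f)); first exact: max_card.
move=> a b aA bA /(congr1 val); rewrite !val_insubd !bnd // => E.
have /andP[a0 qa] := aA; have /andP[b0 qb] := bA.
apply: val_inj => /=; rewrite -(divnK qa) -(divnK qb); congr (_ * _).
have := dvdn_leq a0 qa; have := dvdn_leq b0 qb; rewrite -!(divn_gt0 _ q0).
by move: E; move: (_ %/ _) (_ %/ _) => [|?] [|?] //= ->.
Qed.

(* A collision of u and u' under the multiplier a forces a (u - u') mod p or its
   negative to be a multiple of q. *)
Lemma inner_collide (p q u u' : nat) : prime p -> 0 < q -> u < p -> u' < p ->
  u != u' ->
  q * \sum_(a < p | 0 < a) (inner p q a u == inner p q a u') <= 2 * p.-1.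
Proof.
move=> pp q0 up up' ne; have p1 := prime_gt1 pp; have p0 := ltnW p1.
(* [D] represents [u - u'] modulo [p] without subtraction below zero. *)
pose D := u + (p - u').
have Dp : ~~ (p %| D).
  have [lt|lt|E] := ltngtP u u'; last by rewrite E eqxx in ne.
    by rewrite gtnNdvd // /D; lia.
  have -> : D = p + (u - u') by rewrite /D; lia.
  by rewrite dvdn_addr // gtnNdvd //; lia.
(* Multiplication by the nonzero residue [D] permutes the residues. The sum over multipliers thus
   becomes a count of the residues [d] for which [q] divides [d] or [p - d]. *)
pose dl (a : 'I_p) : 'I_p := Ordinal (ltn_pmod (a * D) p0).
have dl_inj : injective dl.
  move=> a b /(congr1 val) /= E; apply: val_inj => /=.
  wlog ab : a b E / a <= b.
    by move=> H; case/orP: (leq_total a b) => le; [apply: H|symmetry; apply: H].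
  have /eqP := E; rewrite eq_sym eqn_mod_dvd ?leq_mul2r ?ab ?orbT // -mulnBl Euclid_dvdM //.
  rewrite (negbTE Dp) orbF => dv.
  have [|ba0] := posnP (b - a); first by lia.
  by have := dvdn_leq ba0 dv; have := ltn_ord b; lia.
have dl0 (a : 'I_p) : 0 < a -> 0 < dl a.
  move=> a0 /=; rewrite lt0n; apply/negP => /eqP E.
  have : p %| a * D by apply/eqP.
  by rewrite Euclid_dvdM // (negbTE Dp) orbF gtnNdvd.
have dlE (a : 'I_p) : dl a = ((a * u) %% p + (p - (a * u') %% p)) %% p :> nat.
  rewrite /= /D mulnDr -[LHS]modnDm -[RHS]modnDmr; congr ((_ + _) %% _).
  apply/eqP; rewrite -(eqn_modDr ((a * u') %% p)).
  rewrite subnK ?modnn; last by apply: ltnW; rewrite ltn_pmod.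
  by rewrite modnDmr -mulnDr subnK ?(ltnW up') // modnMl.
have step (a : 'I_p) : 0 < a -> nat_of_bool (inner p q a u == inner p q a u') <=
   ((0 < dl a) && (q %| dl a)) + ((0 < p - dl a) && (p - dl a < p) && (q %| p - dl a)).
  move=> a0; case: eqP => // E.
  have d0 := dl0 a a0; have := dlE a.
  move: E; rewrite /inner.
  have := ltn_pmod (a * u) p0; have := ltn_pmod (a * u') p0.
  have := ltn_ord (dl a).
  move: (dl a : nat) d0 ((a * u) %% p) ((a * u') %% p) => d d0 r r' dp rp' rp E dE.
  have [le|lt] := leqP r' r.
    have dd : d = r - r'.
      rewrite dE; have -> : r + (p - r') = p + (r - r') by lia.
      by rewrite modnDl modn_small //; lia.
    suff -> : q %| d by rewrite d0.
    by rewrite dd -eqn_mod_dvd // E.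
  have dd : d = p - (r' - r).
    by rewrite dE modn_small; lia.
  suff -> : q %| p - d.
    by have -> : (0 < p - d) && (p - d < p); [lia | rewrite leq_addl].
  have -> : p - d = r' - r by lia.
  by rewrite -eqn_mod_dvd ?(ltnW lt) // E.
have cm := count_multiples p q0.
apply: (@leq_trans (q * (\sum_(d < p | (0 < d) && (q %| d)) 1 + \sum_(d < p | (0 < d) && (q %| d)) 1))); last first.
  by rewrite mulnDr mul2n -addnn leq_add.
rewrite leq_mul2l; apply/orP; right.
apply: leq_trans (leq_sum _ step) _.
rewrite big_split /=; apply: leq_add.
  rewrite big_mkcond [X in _ <= X]big_mkcond /=.
  rewrite [X in _ <= X](reindex_inj dl_inj) /=; apply: leq_sum => a _.
  by case: (0 < a) => //; case: ifP.
have neg_lt (d : 'I_p) : (if 0 < d then p - d else 0) < p by case: ifP => //; have := ltn_ord d; lia.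
pose ng (d : 'I_p) : 'I_p := Ordinal (neg_lt d).
have ng_inj : injective ng.
  move=> a b /(congr1 val) /=; have := ltn_ord a; have := ltn_ord b => ? ? E.
  by apply: val_inj => /=; move: E; case: ifP; case: ifP; lia.
rewrite big_mkcond [X in _ <= X]big_mkcond /=.
rewrite [X in _ <= X](reindex_inj (inj_comp ng_inj dl_inj)) /=; apply: leq_sum => a _.
case: (posnP a) => // a0; have := dl0 a a0; rewrite /= => d0.
by rewrite d0; case: (0 < _); case: (q %| _) => //; case: (_ < p).
Qed.

(** * Greedy choice of the inner multipliers *)

(* The number d stands for the pair (d / p, d mod p) of residues modulo p. *)
Definition coll (p q a d : nat) : bool :=
  (d %/ p != d %% p) && (inner p q a (d %/ p) == inner p q a (d %% p)).

Definition total_weight (p : nat) (W : nat -> nat) : nat :=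
  \sum_(0 <= d < p * p | d %/ p != d %% p) W d.

Definition coll_weight (p q : nat) (W : nat -> nat) (a : nat) : nat :=
  \sum_(0 <= d < p * p | coll p q a d) W d.

(** Averaging: by [inner_collide] each pair collides under at most [2(p-1)/q] of the [p-1]
    multipliers, so the mean of [coll_weight] is at most [2/q] of the total weight, and the minimum
    is at most the mean. *)
Lemma coll_weight_min (p q : nat) (W : nat -> nat) (a0 : nat) :
  prime p -> 0 < q ->
  (forall a, 0 < a < p -> coll_weight p q W a0 <= coll_weight p q W a) ->
  q * coll_weight p q W a0 <= 2 * total_weight p W.
Proof.
move=> pp q0 amin; have p1 := prime_gt1 pp.
rewrite -(@leq_pmul2l p.-1); last by lia.
rewrite mulnCA.
apply: (@leq_trans (q * \sum_(a < p | 0 < a) coll_weight p q W a)).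
  rewrite leq_mul2l; apply/orP; right.
  have -> : p.-1 = \sum_(a < p | 0 < a) 1.
    case: p p1 {pp amin} => // p _; rewrite big_mkcond big_ord_recl /= add0n.
    by rewrite sum1_card card_ord.
  rewrite big_distrl /=; apply: leq_sum => a a0'; rewrite mul1n.
  by apply: amin; rewrite a0' ltn_ord.
rewrite /coll_weight /total_weight.
rewrite (eq_bigr (fun a : 'I_p => \sum_(0 <= d < p * p | d %/ p != d %% p)
   (inner p q a (d %/ p) == inner p q a (d %% p)) * W d)); last first.
  move=> a _; rewrite [LHS]big_mkcond [RHS]big_mkcond; apply: eq_bigr => d _.
  by rewrite /coll; case: (_ != _) => //=; case: (_ == _); rewrite ?mul1n ?mul0n.
rewrite exchange_big /= mulnA big_distrr [X in _ <= X]big_distrr /=.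
rewrite big_nat_cond [X in _ <= X]big_nat_cond.
apply: leq_sum => d /andP[/andP[_ dp] ne].
rewrite -big_distrl /= mulnA leq_mul2r; apply/orP; right.
rewrite (mulnC p.-1); apply: (@inner_collide p q (d %/ p) (d %% p) pp q0 _ _ ne).
  by rewrite ltn_divLR ?(ltnW p1).
by rewrite ltn_pmod ?(ltnW p1).
Qed.

Definition double_coll (p q a : nat) (W : nat -> nat) : nat -> nat :=
  fun d => if coll p q a d then 2 * W d else W d.

Lemma total_double (p q a : nat) (W : nat -> nat) :
  total_weight p (double_coll p q a W) = total_weight p W + coll_weight p q W a.
Proof.
rewrite /total_weight /coll_weight [LHS]big_mkcond [X in _ = X + _]big_mkcond.
rewrite [X in _ = _ + X]big_mkcond -big_split; apply: eq_bigr => d _ /=.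
by rewrite /double_coll /coll; case: (_ != _) => //=; case: (_ == _); rewrite ?addn0 // mul2n addnn.
Qed.

(** Each greedy choice multiplies the total weight by at most [1 + 2/q]; the invariant is kept free
    of denominators. *)
Lemma total_step (p q a : nat) (W : nat -> nat) (t Z : nat) :
  prime p -> 0 < q ->
  (forall b, 0 < b < p -> coll_weight p q W a <= coll_weight p q W b) ->
  q ^ t * total_weight p W <= (q + 2) ^ t * Z ->
  q ^ t.+1 * total_weight p (double_coll p q a W) <= (q + 2) ^ t.+1 * Z.
Proof.
move=> pp q0 amin H; have := coll_weight_min pp q0 amin.
rewrite total_double !expnS; move: (coll_weight _ _ _ _) H => S.
move: (total_weight p W) (q ^ t) ((q + 2) ^ t) => T u v H1 H2.
have : q * (T + S) <= (q + 2) * T by lia.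
move=> H3; rewrite -mulnA mulnCA.
apply: (@leq_trans (u * ((q + 2) * T))); first by rewrite leq_mul2l H3 orbT.
by rewrite mulnCA -mulnA leq_mul2l H1 orbT.
Qed.

Lemma total_one (p : nat) : total_weight p (fun=> 1) <= p * p.
Proof. by rewrite /total_weight sum1_count (leq_trans (count_size _ _)) // size_iota subn0. Qed.

Lemma leq_total_weight (p : nat) (W : nat -> nat) (d : nat) : d < p * p ->
  d %/ p != d %% p -> W d <= total_weight p W.
Proof.
move=> dp ne; rewrite /total_weight big_mkord (bigD1 (Ordinal dp)) //=.
exact: leq_addr.
Qed.

Lemma leq_expn (e m n : nat) : m <= n -> m ^ e <= n ^ e.
Proof. by case: e => // e mn; rewrite leq_exp2r. Qed.

Lemma bernoulli_double (q j : nat) : 4 * j <= q + 2 -> (q + 2) ^ j <= 2 * q ^ j.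
Proof.
move=> jq.
(* Bernoulli's inequality [(1 - 2/(q+2))^i >= 1 - 2i/(q+2)], cleared of denominators. *)
have H i : 2 * i <= q + 2 -> (q + 2) ^ i * (q + 2 - 2 * i) <= q ^ i * (q + 2).
  elim: i => [|i IH] iq; first by rewrite !expn0 muln0 subn0.
  have := IH ltac:(lia).
  rewrite !expnS; move: ((q + 2) ^ i) (q ^ i) => u v Huv.
  have E : (q + 2) * (q + 2 - 2 * i.+1) <= q * (q + 2 - 2 * i).
    have [c cE] : exists c, q + 2 = 2 * i.+1 + c by exists (q + 2 - 2 * i.+1); lia.
    rewrite cE (_ : 2 * i.+1 + c - 2 * i.+1 = c); last lia.
    have -> : 2 * i.+1 + c - 2 * i = c + 2 by lia.
    have qE : q = 2 * i + c by lia.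
    by rewrite qE; nia.
  apply: (@leq_trans (u * (q * (q + 2 - 2 * i)))).
    by rewrite -mulnA mulnCA leq_mul2l E orbT.
  by rewrite mulnCA -mulnA leq_mul2l Huv orbT.
have := H j ltac:(lia).
move: ((q + 2) ^ j) (q ^ j) => u v Huv.
have E : q + 2 <= 2 * (q + 2 - 2 * j) by lia.
have : u * (q + 2) <= (2 * v) * (q + 2).
  apply: (@leq_trans (u * (2 * (q + 2 - 2 * j)))); first by rewrite leq_mul2l E orbT.
  by rewrite mulnCA -mulnA leq_mul2l Huv.
by rewrite leq_pmul2r //; lia.
Qed.

(* T is the total weight after t multipliers; a pair colliding under c of them
   has weight 2 ^ c, so that c <= 3 s. *)
Lemma potential_bound (p b s t T : nat) : 0 < b -> p <= 2 ^ s ->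
  t <= 12 * b * s ->
  (48 * b) ^ t * T <= (48 * b + 2) ^ t * (p * p) -> T <= 2 ^ (3 * s).
Proof.
move=> b0 ps ts H.
set q := 48 * b in H *.
have q0 : 0 < q by rewrite /q; lia.
have H1 : q ^ (12 * b * s) * T <= (q + 2) ^ (12 * b * s) * (p * p).
  rewrite -(subnK ts) !expnD -!mulnA.
  by apply: leq_mul H; apply: leq_expn; lia.
(* The multipliers form [s] groups of [12b]. Over one group [(1 + 2/q)^(12b)] is at most 2, as
   [4 * 12b = q]; this is the origin of the factor 48 in [q]. Together with [p * p <= 2^(2s)] it
   gives [2^(3s)]. *)
have H2 : (q + 2) ^ (12 * b * s) <= 2 ^ s * q ^ (12 * b * s).
  rewrite !(expnM _ (12 * b)) -expnMn; apply: leq_expn.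
  by apply: bernoulli_double; rewrite /q; lia.
have Q0 : 0 < q ^ (12 * b * s) by rewrite expn_gt0 q0.
rewrite -(leq_pmul2l Q0); apply: leq_trans H1 _.
apply: leq_trans (leq_mul H2 (leq_mul ps ps)) _.
by rewrite -mulnA mulnCA leq_mul2l -!expnD (_ : s + (s + s) = 3 * s) ?leqnn ?orbT //; lia.
Qed.

(** * The parameters of the covering *)

Definition least_exp (b x k : nat) : Prop :=
  [/\ 0 < k, x <= b ^ k & forall i, 0 < i -> i < k -> b ^ i < x].

Definition next_prime (X p : nat) : Prop :=
  [/\ prime p, X < p & forall r, X < r -> r < p -> ~~ prime r].

Lemma least_exp_ex (b x : nat) : 1 < b -> exists k, least_exp b x k.
Proof.
move=> b1; have ex : exists k, (0 < k) && (x <= b ^ k).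
  exists x.+1; rewrite /=; apply: ltnW; apply: ltn_trans (ltn_expl _ b1); exact: ltnSn.
exists (ex_minn ex); case: ex_minnP => k /andP[k0 xk] kmin; split=> // i i0 ik.
by rewrite ltnNge; apply/negP => H; have := kmin i; rewrite i0 H; lia.
Qed.

Lemma next_prime_ex (X : nat) : 4 <= X -> exists2 p, next_prime X p & p <= 4 ^ 4 * X.
Proof.
move=> X4; have [r pr /andP[Xr rX]] := weak_bertrand X4.
have ex : exists p, prime p && (X < p) by exists r; rewrite pr.
exists (ex_minn ex); case: ex_minnP => p /andP[pp Xp] pmin.
  split=> // s Xs sp; apply/negP => ps.
  by have := pmin s; rewrite ps Xs; lia.
by apply: leq_trans rX; apply: pmin; rewrite pr.
Qed.

(* The values of the outer hash range over p residues, which is enough unless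
   f <= lg x; then they are hashed further, into 48 K f values. *)
Definition use_inner (x K f k : nat) : bool :=
  [&& 16 <= k, f <= lg x & K * f * lg x < k ^ K.+1].

Section CoverSize.
Variables (x K f k p k1 : nat).
Hypothesis f0 : 0 < f.
Hypothesis K0 : 0 < K.
Hypothesis Kf : K <= f.+1.
Hypothesis kP : least_exp (2 * (K * f)) x k.
Hypothesis pP : next_prime (4 * (K * f) * k) p.
Hypothesis pU : p <= 2 ^ 10 * (K * f) * k.
Hypothesis k1P : least_exp p x k1.

Notation use := (use_inner x K f k).

Definition modulus : nat := if use then 48 * (K * f) else p.
Definition inner_len : nat := if use then 12 * (K * f) * (lg p).+1 else 1.
(** The code length is based on [k1] and not on [k]: with [k1] the product with [lg p] is of order
    [lg x] ([use_ks]), so the two lengths together contribute a single logarithm. *)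
Definition hash_len : nat := 4 * (K * f) * k1 * inner_len.
(** A simple path has at most [x] elements. Capping the length keeps the time spent on the digits of
    one tuple linear in [x] even if [K] is much larger. *)
Definition tuple_len : nat := minn K x.+1.
Definition cover_size : nat := hash_len * modulus.+1 ^ tuple_len.

Lemma Kf_gt0 : 0 < K * f. Proof. by rewrite muln_gt0 K0. Qed.
Let b0 := Kf_gt0.

Lemma p_prime : prime p. Proof. by case: pP. Qed.
Lemma p_gt1 : 1 < p. Proof. exact: prime_gt1 p_prime. Qed.
Lemma k_gt0 : 0 < k. Proof. by case: kP. Qed.
Lemma k1_gt0 : 0 < k1. Proof. by case: k1P. Qed.

Lemma p_gt : 4 * (K * f) * k < p. Proof. by case: pP. Qed.

Lemma p_ge : 4 * (K * f) <= p.
Proof. by have := p_gt; have := k_gt0; move: (K * f) => b; nia. Qed.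

Lemma lt_lg : x < 2 ^ (lg x).+1.
Proof. exact: trunc_log_ltn. Qed.

Lemma k_le_lg : k <= (lg x).+1.
Proof.
case: kP => kg xk kmin; case: k kg kmin => // -[|k'] // _ kmin.
rewrite ltnS; apply: trunc_log_max => //.
apply: ltnW; apply: leq_ltn_trans (kmin k'.+1 _ _) => //.
by rewrite leq_exp2r //; lia.
Qed.

Lemma k_le_c (c : nat) : 0 < c -> x <= f ^ c -> k <= c.
Proof.
move=> c0 xc; rewrite leqNgt; apply/negP => ck.
case: kP => _ _ /(_ c c0 ck); rewrite ltnNge => /negP; apply.
by apply: leq_trans xc _; rewrite leq_exp2r //; nia.
Qed.

Lemma k1_le_k : k1 <= k.
Proof.
case: k1P => _ _ k1min; rewrite leqNgt; apply/negP => lt.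
have := k1min k k_gt0 lt; rewrite ltnNge => /negP; apply.
case: kP => kg xk _; apply: leq_trans xk _.
by rewrite leq_exp2r //; apply: leq_trans p_ge; lia.
Qed.

Lemma x_le_pk1 : x <= p ^ k1. Proof. by case: k1P. Qed.

(** This is where the threshold 16 enters: for [k >= 16] one has [p <= 2^9 k * 2Kf <= 2^(k-2) * 2Kf
    <= (2Kf)^(k-1) < x]. *)
Lemma use_p_le_x : use -> p <= x.
Proof.
case/and3P => k16 _ _; apply: leq_trans pU _.
case: kP => _ _ /(_ k.-1) H; apply: ltnW; apply: leq_ltn_trans (H _ _); try lia.
have [t kE] : exists t, k = t + 16 by exists (k - 16); lia.
rewrite kE (_ : (t + 16).-1 = (t + 14).+1); last lia.
rewrite (expnSr (2 * (K * f))).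
apply: (@leq_trans (2 ^ (t + 14) * (2 * (K * f)))); last first.
  by rewrite leq_mul2r leq_expn ?orbT //; lia.
have -> : 2 ^ 10 * (K * f) * (t + 16) = 2 ^ 9 * (t + 16) * (2 * (K * f)).
  by rewrite (expnS 2 9); move: (2 ^ 9) => z; nia.
rewrite leq_mul2r; apply/orP; right.
rewrite (_ : t + 14 = 9 + (t + 5)); last lia.
rewrite expnD leq_mul2l; apply/orP; right.
have := @ltn_expl 2 t erefl; rewrite expnD (_ : 2 ^ 5 = 32) //.
by move: (2 ^ t) => z; lia.
Qed.

Lemma use_q_le_p : use -> 48 * (K * f) <= p.
Proof. by case/and3P => k16 _ _; apply: leq_trans (ltnW p_gt); nia. Qed.

Lemma use_Kf : use -> K * f <= (lg x).+1 ^ 2.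
Proof.
case/and3P => _ fl _; rewrite -mulnn; apply: leq_mul; last by lia.
by apply: leq_trans Kf _.
Qed.

(** The greedy search takes time polynomial in [p], which this bound turns into a polylogarithm of
    [x]. *)
Lemma use_p_polylog : use -> p <= 2 ^ 10 * (lg x).+1 ^ 3.
Proof.
move=> u; apply: leq_trans pU _; rewrite -mulnA leq_mul2l; apply/orP; right.
rewrite (expnSr _ 2); apply: leq_mul (use_Kf u) k_le_lg.
Qed.

(** By minimality [p^(k1-1) < x], so [(k1-1) lg p <= lg x]. The factor 4 absorbs the rounding of
    [k1] and of [lg p], using [1 <= lg p <= lg x]. *)
Lemma use_ks : use -> k1 * (lg p).+1 <= 4 * lg x.
Proof.
move=> u; have px := use_p_le_x u.
have lpx : lg p <= lg x by apply: leq_trunc_log.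
have lp1 : 0 < lg p by rewrite /lg trunc_log_gt0 /= p_gt1.
have [k1le|k1gt] := leqP k1 1; first by nia.
have : lg p * k1.-1 <= lg x.
  apply: trunc_log_max => //; rewrite expnM.
  apply: (@leq_trans (p ^ k1.-1)).
    by rewrite leq_exp2r; [exact: trunc_logP (ltnW p_gt1) | lia].
  by case: k1P => _ _ H; apply: ltnW; apply: H; lia.
have [r ->] : exists r, k1 = r + 2 by exists (k1 - 2); lia.
rewrite (_ : (r + 2).-1 = r.+1); last lia.
move: (lg p) (lg x) lp1 => a b a0 H.
have : r <= a * r by rewrite leq_pmull.
by move: H; rewrite mulnS mulnDl !mulnS; lia.
Qed.

Lemma q_gt0 : 0 < modulus.
Proof. by rewrite /modulus; case: ifP => _; [lia | apply: ltnW p_gt1]. Qed.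

Lemma q_le_p : modulus <= p.
Proof. by rewrite /modulus; case: ifP => // /use_q_le_p. Qed.

Lemma inner_len_gt0 : 0 < inner_len.
Proof. by rewrite /inner_len; case: ifP => // _; nia. Qed.

Lemma hash_len_ge : 4 * (K * f) <= hash_len.
Proof.
by rewrite /hash_len -mulnA leq_pmulr // muln_gt0 k1_gt0 inner_len_gt0.
Qed.

Lemma use_hash_len : use -> hash_len <= 192 * (K * f) ^ 2 * lg x.
Proof.
move=> u; rewrite /hash_len /inner_len u; have := use_ks u.
by rewrite -mulnn; move: (K * f) ((lg p).+1) (lg x) => b s l; nia.
Qed.

Lemma hash_len_polylog : hash_len <= polylog 192 3 x * (K * f).
Proof.
case: (boolP use) => u.
  apply: leq_trans (use_hash_len u) _; rewrite /polylog (expnSr _ 2).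
  have := use_Kf u; rewrite -(mulnn (K * f)); move: (K * f) (lg x) => b l bz.
  have H : b * l <= l.+1 ^ 2 * l.+1 by apply: leq_mul bz _.
  have -> : 192 * (b * b) * l = 192 * b * (b * l) by rewrite -!mulnA.
  by rewrite mulnAC leq_mul2r leq_mul2l H !orbT.
rewrite /hash_len /inner_len (negbTE u) /polylog muln1.
rewrite mulnAC leq_mul2r; apply/orP; right; apply: leq_mul => //.
apply: leq_trans (leq_trans k1_le_k k_le_lg) _.
by rewrite expnS leq_pmulr // expn_gt0.
Qed.

(* Balance: (p + q - 1)/q residues modulo p share a hash value, and each residue
   is taken at most x/p + 1 times. *)
Lemma bucket_balance (d : nat) : d <= K ->
  f * d * ((p + modulus - 1) %/ modulus * (x %/ p).+1) <= maxn x (f * d).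
Proof.
move=> dK; have p0 := ltnW p_gt1; have pg := p_ge.
have fd : f * d <= K * f by rewrite mulnC leq_mul2r dK orbT.
case: (boolP use) => u.
  have px := use_p_le_x u; have qp := use_q_le_p u.
  rewrite /modulus u; apply: leq_trans (leq_maxl _ _).
  set q := 48 * (K * f) in qp *.
  have q0 : 0 < q by rewrite /q; lia.
  have c1 : (p + q - 1) %/ q * q <= 2 * p by apply: leq_trans (leq_divM _ _) _; lia.
  have c2 : (x %/ p).+1 * p <= 2 * x.
    by rewrite mulSn; have := leq_divM x p; lia.
  rewrite -(@leq_pmul2r (p * q)); last by rewrite muln_gt0 p0.
  move: ((p + q - 1) %/ q) ((x %/ p).+1) c1 c2 => c e c1 c2.
  have c3 : c * e * (p * q) <= 4 * (p * x).
    have -> : c * e * (p * q) = (c * q) * (e * p) by rewrite (mulnC p) mulnACA.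
    by apply: leq_trans (leq_mul c1 c2) _; nia.
  rewrite -mulnA; apply: leq_trans (leq_mul fd c3) _.
  by rewrite /q; move: (K * f) => b; nia.
rewrite /modulus (negbTE u).
have -> : (p + p - 1) %/ p = 1.
  by rewrite (_ : p + p - 1 = 1 * p + (p - 1)) ?divnMDl // ?divn_small //; lia.
(* If [x < p] there is a single block, and each path element brings in only one element per bucket;
   this is the term [f * d] of the maximum. *)
rewrite mul1n; have [xp|px] := ltnP x p.
  by rewrite divn_small // muln1 leq_maxr.
apply: leq_trans (leq_maxl _ _).
rewrite -(@leq_pmul2r p) //.
have c2 : (x %/ p).+1 * p <= 2 * x.
  by rewrite mulSn; have := leq_divM x p; lia.
rewrite -mulnA; apply: leq_trans (leq_mul fd c2) _.
by move: pg; move: (K * f) => b; nia.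
Qed.

Lemma cover_size_outer : ~~ use -> cover_size <= (2 ^ 11 * (K * f) * k) ^ K.+1.
Proof.
move=> u; rewrite /cover_size /hash_len /inner_len /modulus (negbTE u) muln1 expnS.
apply: leq_mul.
  apply: leq_mul k1_le_k; rewrite leq_mul2r (expnD 2 2 9); apply/orP; right.
  by rewrite leq_pmulr // expn_gt0.
apply: (@leq_trans (p.+1 ^ K)).
  by rewrite leq_exp2l ?geq_minl //; have := p_gt1; lia.
rewrite leq_exp2r //; have := pU; have := p_gt1; rewrite (expnS 2 10).
by move: (2 ^ 10) (K * f) => z b; nia.
Qed.

Lemma cover_size_inner : use -> cover_size <= 192 * (K * f) ^ 2 * lg x * (49 * (K * f)) ^ K.
Proof.
move=> u; rewrite /cover_size; apply: leq_mul; first exact: use_hash_len.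
rewrite /modulus u; apply: (@leq_trans ((48 * (K * f)).+1 ^ K)).
  by rewrite leq_exp2l ?geq_minl //; lia.
by rewrite leq_exp2r //; lia.
Qed.

Lemma cover_size_bound : covering_value_bound (2 ^ 16) K f x cover_size.
Proof.
have le16 (a : nat) : a <= 16 -> 2 ^ a <= 2 ^ 16 by move=> H; rewrite leq_exp2l.
have c49 : 49 <= 2 ^ 16 by apply: leq_trans (le16 6 _).
have c192 : 192 <= 2 ^ 16 by apply: leq_trans (le16 8 _).
have c11 := le16 11 erefl.
have c15 : 2 ^ 11 * 16 <= 2 ^ 16 by rewrite -[16]/(2 ^ 4) -expnD le16.
have c17 : 2 ^ 11 * 2 <= 2 ^ 16 by rewrite -expnSr le16.
have Kg : 0 < 2 ^ 16 by rewrite expn_gt0.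
move: (2 ^ 16) le16 c49 c192 c11 c15 c17 Kg => al _ c49 c192 c11 c15 c17 al0 c c0; split.
- move=> xc; have kc := k_le_c c0 xc.
  have -> : al * c * K * f = al * (K * f) * c by rewrite -!mulnA; congr (_ * _); rewrite mulnC -mulnA.
  case: (boolP use) => u; last first.
    apply: leq_trans (cover_size_outer u) _; rewrite leq_exp2r //.
    by apply: leq_mul kc; rewrite leq_mul2r c11 orbT.
  apply: leq_trans (cover_size_inner u) _.
  case/and3P: u => _ _ lt.
  apply: (@leq_trans (192 * (K * f) * (49 * (K * f)) ^ K * k ^ K.+1)).
    move: lt => /ltnW; move: (k ^ K.+1) ((49 * (K * f)) ^ K) => Z Y H.
    have -> : 192 * (K * f) ^ 2 * lg x * Y = 192 * (K * f) * Y * (K * f * lg x).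
      by rewrite -mulnn; ring.
    by rewrite leq_mul2l H orbT.
  rewrite [X in _ <= X]expnMn; apply: leq_mul; last by rewrite leq_exp2r.
  rewrite [X in _ <= X]expnS; apply: leq_mul; first by rewrite leq_mul2r c192 orbT.
  by rewrite leq_exp2r // leq_mul2r c49 orbT.
- move=> fl; rewrite -(mulnA al).
  have l0 : 0 < lg x by apply: leq_trans fl.
  case: (boolP use) => u.
    apply: leq_trans (cover_size_inner u) _; rewrite mulnAC leq_mul2r; apply/orP; right.
    rewrite -(addn2 K) (expnD _ K) mulnC; apply: leq_mul.
      by rewrite leq_exp2r // leq_mul2r c49 orbT.
    rewrite [X in _ <= X]expnMn leq_mul2r; apply/orP; right.
    by rewrite -mulnn; nia.
  apply: leq_trans (cover_size_outer u) _.
  rewrite /use_inner fl /= negb_and -ltnNge -leqNgt in u.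
  case/orP: u => [k16|kb].
    apply: leq_trans (leq_pmulr _ l0).
    apply: (@leq_trans ((al * (K * f)) ^ K.+1)); last by rewrite leq_exp2l //; nia.
    rewrite leq_exp2r // mulnAC leq_mul2r; apply/orP; right.
    by apply: leq_trans c15; rewrite leq_mul2l; apply/orP; right; lia.
  rewrite expnMn; apply: leq_trans (leq_mul (leqnn _) kb) _.
  rewrite mulnA leq_mul2r; apply/orP; right.
  rewrite [X in _ <= X]expnSr; apply: leq_mul; last by nia.
  by rewrite leq_exp2r // leq_mul2r c11 orbT.
- move=> xc fl; have u : ~~ use by rewrite /use_inner (negbTE fl) andbF.
  apply: leq_trans (cover_size_outer u) _; rewrite leq_exp2r // -(mulnA al).
  have l0 : 0 < lg x.
    rewrite /lg trunc_log_gt0 /=; rewrite -ltnNge in xc.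
    by apply: leq_ltn_trans xc; rewrite expn_gt0 f0.
  have := k_le_lg; move: (lg x) (K * f) (2 ^ 11) l0 c17 => l b z l0 c17 kl.
  have : z * k <= al * l by nia.
  by nia.
Qed.

End CoverSize.

(** * The covering *)

Definition hash (p q : nat) (A : nat -> nat) (X y e : nat) : nat :=
  inner p q (A y) (rs p X e).

Definition encode_tuple (Q : nat) (hs : seq nat) : nat :=
  foldl (fun c h => c * Q + h.+1) 0 hs.

Lemma encode_tuple_rcons (Q : nat) (hs : seq nat) (h : nat) :
  encode_tuple Q (rcons hs h) = encode_tuple Q hs * Q + h.+1.
Proof. by rewrite /encode_tuple foldl_rcons. Qed.

Lemma encode_tuple_lt (Q : nat) (hs : seq nat) : all (fun h => h.+1 < Q) hs ->
  encode_tuple Q hs < Q ^ size hs.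
Proof.
elim/last_ind: hs => [//|hs h IH]; rewrite all_rcons size_rcons => /andP[hQ /IH].
by rewrite encode_tuple_rcons expnSr; move: (encode_tuple _ _) (_ ^ _) => c E; nia.
Qed.

(** Digits beyond the end of the code are 0 and never equal a successor, so [T] may exceed the
    length of the tuple. *)
Lemma digit_encode (Q T v : nat) (hs : seq nat) :
  all (fun h => h.+1 < Q) hs -> size hs <= T ->
  (exists2 j, j < T & digit Q j (encode_tuple Q hs) = v.+1) <-> v \in hs.
Proof.
elim/last_ind: hs T => [|hs h IH] T.
  move=> _ _; split=> // -[j _]; rewrite /digit div0n.
  by case: Q => [|Q]; rewrite ?modn0 ?mod0n.
rewrite all_rcons size_rcons => /andP[hQ aQ] sT; rewrite encode_tuple_rcons.
case: T sT => // T sT.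
have Q0 : 0 < Q by lia.
have d0 : digit Q 0 (encode_tuple Q hs * Q + h.+1) = h.+1.
  by rewrite /digit expn0 divn1 modnMDl modn_small.
have dS j : digit Q j.+1 (encode_tuple Q hs * Q + h.+1) = digit Q j (encode_tuple Q hs).
  by rewrite digitS divnMDl // divn_small // addn0.
rewrite mem_rcons inE; split.
  move=> [[|j] jT]; first by rewrite d0 => -[->]; rewrite eqxx.
  rewrite dS => E; apply/orP; right; apply/(IH T aQ sT); by exists j.
case/orP => [/eqP ->|/(IH T aQ sT)[j jT E]]; first by exists 0.
by exists j.+1; rewrite ?dS.
Qed.

Lemma sum_pairs (a b : nat) (F : nat -> nat -> nat) : 0 < b ->
  \sum_(i < a * b) F (i %/ b) (i %% b) = \sum_(i < a) \sum_(j < b) F i j.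
Proof.
move=> b0; elim: a => [|a IH]; first by rewrite mul0n !big_ord0.
rewrite big_ord_recr /= -IH -(@big_mkord _ _ _ (a.+1 * b) xpredT (fun i => F (i %/ b) (i %% b))).
rewrite (@big_cat_nat _ _ _ (a * b)) //= ?leq_mul2r ?leqnSn ?orbT // big_mkord.
congr (_ + _); rewrite -{1}[a * b]add0n big_addn mulSn addnK big_mkord.
apply: eq_bigr => j _; rewrite addnC divnMDl // modnMDl.
by rewrite divn_small // modn_small // addn0.
Qed.

Section Covering.
Variables (x K f p q l1 l2 T : nat) (A Inv : nat -> nat).
Hypothesis pp : prime p.
Hypothesis q0 : 0 < q.
Hypothesis l20 : 0 < l2.
Hypothesis AI : forall y, y < l2 -> A y * Inv y %% p = 1.

Notation H := (l1 * l2).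
Notation Q := q.+1.
Notation N := (H * Q ^ T).

Let p1 : 1 < p := prime_gt1 pp.
Let p0 : 0 < p := ltnW p1.

(* In the index i = code * H + (X * l2 + y), code is a tuple of T digits below
   q + 1; the digit v + 1 stands for the hash value v, and 0 is a blank. *)
Definition cover_set (i : nat) : {set 'I_x} :=
  [set e : 'I_x | [exists j : 'I_T,
     digit Q j (i %/ H) == (hash p q A (i %% H %/ l2) (i %% H %% l2) e).+1]].

Definition path_index (s : seq nat) (xy : nat) : nat :=
  encode_tuple Q [seq hash p q A (xy %/ l2) (xy %% l2) e | e <- s] * H + xy.

Lemma hash_lt X y e : hash p q A X y e < q.
Proof. exact: ltn_pmod. Qed.

Lemma all_hash X y (s : seq nat) :
  all (fun h => h.+1 < Q) [seq hash p q A X y e | e <- s].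
Proof. by apply/allP => _ /mapP[e _ ->]; rewrite ltnS hash_lt. Qed.

Lemma encode_hash_lt X y (s : seq nat) : size s <= T ->
  encode_tuple Q [seq hash p q A X y e | e <- s] < Q ^ T.
Proof.
move=> sT; apply: leq_trans (encode_tuple_lt (all_hash _ _ _)) _.
by rewrite size_map leq_exp2l.
Qed.

Lemma path_index_lt (s : seq nat) (xy : nat) : size s <= T -> xy < H ->
  path_index s xy < N.
Proof.
move=> sT xyH; rewrite /path_index.
have := encode_hash_lt (xy %/ l2) (xy %% l2) sT.
by move: (encode_tuple _ _) (Q ^ T) => c E; nia.
Qed.

Lemma path_index_mod (s : seq nat) (xy : nat) : xy < H -> path_index s xy %% H = xy.
Proof. by move=> xyH; rewrite /path_index modnMDl modn_small. Qed.

Lemma path_index_div (s : seq nat) (xy : nat) : xy < H ->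
  path_index s xy %/ H = encode_tuple Q [seq hash p q A (xy %/ l2) (xy %% l2) e | e <- s].
Proof.
move=> xyH; have H0 : 0 < H by case: (H) xyH.
by rewrite /path_index divnMDl // (divn_small xyH) addn0.
Qed.

Lemma mem_path_cover (s : seq nat) (xy : nat) (e : 'I_x) : size s <= T -> xy < H ->
  e \in cover_set (path_index s xy) <->
  hash p q A (xy %/ l2) (xy %% l2) e \in [seq hash p q A (xy %/ l2) (xy %% l2) e' | e' <- s].
Proof.
move=> sT xyH; rewrite inE path_index_mod // path_index_div //.
have sT' : size [seq hash p q A (xy %/ l2) (xy %% l2) e' | e' <- s] <= T.
  by rewrite size_map.
apply: iff_trans (digit_encode _ (all_hash _ _ _) sT').
split => [/existsP[j /eqP E]|[j jT E]]; first by exists j.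
by apply/existsP; exists (Ordinal jT); apply/eqP.
Qed.

(** ** Enumerating the elements with a given hash value *)

Notation cr := ((p + q - 1) %/ q).

(* A block of p consecutive elements contains exactly one element of outer hash
   value u, for every u < p; and u has inner hash value w if and only if
   u = Inv y * (w + j * q) mod p for some j with w + j * q < p.  The number z
   encodes the block and j. *)
Definition bucket_arg (X y w z : nat) : nat :=
  (z %/ cr) * p +
  ((Inv y * (w + z %% cr * q)) %% p + p - (X * rs p X (z %/ cr)) %% p) %% p.

Definition bucket_ok (X y w z : nat) : bool :=
  (w + z %% cr * q < p) && (bucket_arg X y w z < x).

Definition bucket (X y w n : nat) : seq nat :=
  [seq bucket_arg X y w z | z <- iota 0 n & bucket_ok X y w z].

Lemma cr_gt0 : 0 < cr.
Proof. by rewrite divn_gt0 //; lia. Qed.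

Lemma rs_arg (X blk u : nat) : u < p ->
  rs p X (blk * p + (u + p - (X * rs p X blk) %% p) %% p) = u.
Proof.
move=> up; rewrite rs_block ?ltn_pmod //.
rewrite modnDml -modnDmr subnK; last by lia.
by rewrite modnDr modn_small.
Qed.

Lemma bucket_arg_hash (X y w z : nat) : y < l2 -> w + z %% cr * q < p ->
  (A y * rs p X (bucket_arg X y w z)) %% p = w + z %% cr * q.
Proof.
move=> yl rp; rewrite rs_arg ?ltn_pmod // modnMmr mulnA -modnMml AI //.
by rewrite mul1n modn_small.
Qed.

Lemma bucket_uniq (X y w n : nat) : y < l2 -> uniq (bucket X y w n).
Proof.
move=> yl; rewrite map_inj_in_uniq ?filter_uniq ?iota_uniq // => z z'.
rewrite !mem_filter => /andP[/andP[rz _] _] /andP[/andP[rz' _] _] E.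
have := bucket_arg_hash X yl rz; rewrite E bucket_arg_hash // => /eqP.
rewrite eqn_add2l eqn_pmul2r // => /eqP Em.
have : bucket_arg X y w z %/ p = bucket_arg X y w z' %/ p by rewrite E.
rewrite /bucket_arg !divnMDl // !(divn_small (ltn_pmod _ p0)) !addn0 => Ed.
by rewrite (divn_eq z cr) (divn_eq z' cr) Ed Em.
Qed.

Lemma mem_bucket (X y w e : nat) : y < l2 -> w < q ->
  (e \in bucket X y w (cr * (x %/ p).+1)) = (e < x) && (hash p q A X y e == w).
Proof.
move=> yl wq; apply/mapP/andP => [[z]|[ex /eqP hw]].
  rewrite mem_filter => /andP[/andP[rp ax] _] ->; rewrite ax; split=> //.
  by rewrite /hash /inner bucket_arg_hash // addnC modnMDl modn_small.
set r := (A y * rs p X e) %% p.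
have rq : w + r %/ q * q = r by rewrite [RHS](divn_eq r q) addnC -hw.
have rp : r < p by apply: ltn_pmod.
have tcr : r %/ q < cr.
  rewrite (_ : p + q - 1 = 1 * q + (p - 1)); last lia.
  by rewrite divnMDl // add1n ltnS leq_div2r; lia.
(* [e] lies in the block [e %/ p], and [r %/ q] numbers its residue [r] among those of hash value
   [w]. *)
pose z := e %/ p * cr + r %/ q.
have zd : z %/ cr = e %/ p by rewrite divnMDl ?cr_gt0 // (divn_small tcr) addn0.
have zm : z %% cr = r %/ q by rewrite modnMDl modn_small.
have AE : bucket_arg X y w z = e.
  rewrite /bucket_arg zd zm rq [RHS](divn_eq e p); congr (_ + _).
  rewrite /r modnMmr mulnA (mulnC (Inv y)) -modnMml AI // mul1n.
  have ->: rs p X e %% p = (e %% p + X * rs p X (e %/ p)) %% p.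
    by rewrite {1}(divn_eq e p) rs_block ?ltn_pmod // modn_mod.
  have cp := ltn_pmod (X * rs p X (e %/ p)) p0.
  rewrite -addnBA ?(ltnW cp) // modnDml -addnA -modnDmr -modnDml.
  rewrite modnDml.
  have -> : (X * rs p X (e %/ p) + (p - (X * rs p X (e %/ p)) %% p)) %% p = 0.
    by rewrite -modnDml subnKC ?modnn // ltnW.
  by rewrite addn0 modn_mod.
exists z => //; rewrite mem_filter /bucket_ok AE ex zm rq rp /= mem_iota /= add0n.
have : e %/ p <= x %/ p by apply: leq_div2r; lia.
move=> le; apply: (@leq_trans ((e %/ p).+1 * cr)).
  by rewrite mulSn [X in _ < X]addnC /z ltn_add2l.
by rewrite mulnC leq_mul2l ltnS le orbT.
Qed.

Lemma size_bucket (X y w n : nat) : size (bucket X y w n) <= n.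
Proof. by rewrite size_map size_filter (leq_trans (count_size _ _)) ?size_iota. Qed.

Lemma card_path_cover (s : seq nat) (xy : nat) : size s <= T -> xy < H ->
  #|cover_set (path_index s xy)| <= size s * (cr * (x %/ p).+1).
Proof.
move=> sT xyH.
set X := xy %/ l2; set y := xy %% l2.
have yl : y < l2 by apply: ltn_pmod.
pose B := flatten [seq bucket X y (hash p q A X y e) (cr * (x %/ p).+1) | e <- s].
apply: (@leq_trans (size B)); last first.
  rewrite /B size_flatten /shape -map_comp sumnE big_map.
  apply: (@leq_trans (\sum_(e <- s) cr * (x %/ p).+1)).
    by apply: leq_sum => e _; apply: size_bucket.
  by rewrite big_const_seq iter_addn_0 count_predT mulnC.
rewrite cardE -(size_map (@nat_of_ord x)); apply: uniq_leq_size.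
  by rewrite map_inj_uniq ?enum_uniq //; apply: val_inj.
move=> _ /mapP[e ee ->]; move: ee; rewrite mem_enum => /(mem_path_cover e sT xyH) /mapP[e' e's E].
apply/flattenP; exists (bucket X y (hash p q A X y e') (cr * (x %/ p).+1)).
  by apply/mapP; exists e'.
by rewrite mem_bucket ?hash_lt // ltn_ord -E eqxx.
Qed.

Lemma card_cover_set (i : nat) : #|cover_set i| <= T * (cr * (x %/ p).+1).
Proof.
set X := i %% H %/ l2; set y := i %% H %% l2; set n := cr * (x %/ p).+1.
have yl : y < l2 by apply: ltn_pmod.
(* A blank digit is sent to the bucket of 0 by [.-1], which can only enlarge the upper bound. *)
pose B := flatten [seq bucket X y (digit Q j (i %/ H)).-1 n | j <- iota 0 T].
apply: (@leq_trans (size B)); last first.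
  rewrite /B size_flatten /shape -map_comp sumnE big_map.
  apply: (@leq_trans (\sum_(j <- iota 0 T) n)).
    by apply: leq_sum => j _; apply: size_bucket.
  by rewrite big_const_seq iter_addn_0 count_predT size_iota mulnC.
rewrite cardE -(size_map (@nat_of_ord x)); apply: uniq_leq_size.
  by rewrite map_inj_uniq ?enum_uniq //; apply: val_inj.
move=> _ /mapP[e ee ->]; move: ee; rewrite mem_enum inE => /existsP[j /eqP E].
apply/flattenP; exists (bucket X y (digit Q j (i %/ H)).-1 n).
  by apply/mapP; exists (nat_of_ord j); rewrite ?mem_iota /= ?add0n ?ltn_ord.
by rewrite E mem_bucket ?hash_lt // ltn_ord eqxx.
Qed.

(** ** Few collisions *)

Hypothesis f0 : 0 < f.
Hypothesis K0 : 0 < K.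
Hypothesis xp : exists k, x <= p ^ k /\ l1 = 4 * (K * f) * k.
Hypothesis l1p : l1 <= p.
Hypothesis Ainner : forall u u', u < p -> u' < p -> u != u' ->
  4 * (K * f) * \sum_(y < l2) (inner p q (A y) u == inner p q (A y) u') <= l2.

(** Two kinds of collision. The outer values agree at no more than [k] of the [4Kf * k] positions,
    where all [l2] multipliers are counted as collisions; at the other positions distinct residues
    collide under at most [l2/(4Kf)] multipliers. Each kind accounts for a fraction [1/(4Kf)]. *)
Lemma hash_agree (e e' : nat) : e < x -> e' < x -> e != e' ->
  2 * (K * f) * \sum_(xy < H)
     (hash p q A (xy %/ l2) (xy %% l2) e == hash p q A (xy %/ l2) (xy %% l2) e') <= H.
Proof.
move=> ex ex' ne; have [k [xk lk]] := xp.
rewrite (sum_pairs _ (fun X y => nat_of_bool (hash p q A X y e == hash p q A X y e'))) //.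
have R := rs_agree pp l1p (leq_trans ex xk) (leq_trans ex' xk) ne.
have Ai := Ainner; move: (K * f) lk Ai => b lk Ai.
have step X : 4 * b * \sum_(y < l2) (hash p q A X y e == hash p q A X y e') <=
   4 * b * l2 * (rs p X e == rs p X e') + l2.
  have [E|nE] := eqVneq (rs p X e) (rs p X e').
    rewrite muln1; apply: leq_trans (leq_addr _ _).
    rewrite leq_mul2l; apply/orP; right.
    rewrite -[X in _ <= X]card_ord -sum1_card; apply: leq_sum => y _; exact: leq_b1.
  by rewrite muln0 add0n; apply: Ai; rewrite ?rs_lt.
rewrite -(@leq_pmul2l 2) // mulnA (_ : 2 * (2 * b) = 4 * b); last by ring.
rewrite big_distrr /=.
apply: (@leq_trans (\sum_(X < l1) (4 * b * l2 * (rs p X e == rs p X e') + l2))).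
  by apply: leq_sum => X _; apply: step.
rewrite big_split /= -big_distrr /= sum_nat_const card_ord mul2n -addnn leq_add2r.
apply: (@leq_trans (4 * b * k * l2)); last by rewrite -lk.
by rewrite mulnAC leq_mul2r leq_mul2l R !orbT.
Qed.

Section Path.
Variable s : seq 'I_x.
Hypothesis sT : size s <= T.
Hypothesis sK : size s <= K.

Let sn := [seq nat_of_ord e | e <- s].
Let snT : size sn <= T. Proof. by rewrite size_map. Qed.

Lemma path_index_ord_subproof (xy : 'I_H) : path_index sn xy < N.
Proof. exact: path_index_lt. Qed.

Definition path_index_ord (xy : 'I_H) : 'I_N := Ordinal (path_index_ord_subproof xy).

Definition path_family : {set 'I_N} := [set path_index_ord xy | xy : 'I_H].

Lemma path_index_ord_inj : injective path_index_ord.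
Proof.
move=> a b /(congr1 val) /= E; apply: val_inj => /=.
by rewrite -(path_index_mod sn (ltn_ord a)) E path_index_mod.
Qed.

Lemma card_path_family : #|path_family| = H.
Proof. by rewrite card_imset ?card_ord //; apply: path_index_ord_inj. Qed.

Lemma path_family_sub (i : 'I_N) : i \in path_family -> {subset s <= cover_set i}.
Proof.
case/imsetP => xy _ -> e es; apply/mem_path_cover => //.
by apply/mapP; exists (nat_of_ord e) => //; apply/mapP; exists e.
Qed.

Lemma path_family_card (i : 'I_N) : i \in path_family ->
  #|cover_set i| <= size s * (cr * (x %/ p).+1).
Proof.
case/imsetP => xy _ ->; have := card_path_cover snT (ltn_ord xy).
by rewrite size_map.
Qed.

Lemma path_family_disjoint (F : {set 'I_x}) : #|F| <= f ->
  (forall e, e \in s -> e \notin F) ->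
  #|path_family| <= 2 * #|[set i in path_family | [disjoint cover_set i & F]]|.
Proof.
move=> Ff sF; rewrite card_path_family.
pose good := [set xy : 'I_H | [disjoint cover_set (path_index_ord xy) & F]].
have -> : #|[set i in path_family | [disjoint cover_set i & F]]| = #|good|.
  rewrite -(card_imset good path_index_ord_inj); congr #|pred_of_set _|.
  apply/setP => i; rewrite inE; apply/andP/imsetP => [[/imsetP[xy _ ->] d]|[xy]].
    by exists xy; rewrite // inE.
  by rewrite inE => d ->; split => //; apply/imsetP; exists xy.
have badE : 2 * (K * f) * #|~: good| <= K * f * H.
  pose col (xy : 'I_H) (e e' : nat) := nat_of_bool
    (hash p q A (xy %/ l2) (xy %% l2) e == hash p q A (xy %/ l2) (xy %% l2) e').
  apply: (@leq_trans (2 * (K * f) * \sum_(xy < H) \sum_(e in F) \sum_(e' <- s) col xy e e')).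
    rewrite leq_mul2l; apply/orP; right; rewrite -sum1_card big_mkcond /=.
    apply: leq_sum => xy _; rewrite !inE; case: ifP => // /pred0Pn[e /andP[/= ec eF]].
    move/mem_path_cover: ec => /(_ snT (ltn_ord xy)) /mapP[_ /mapP[e' e's ->] E].
    rewrite (bigD1 e) //= (big_rem e') //= /col E eqxx; lia.
  rewrite exchange_big /= big_distrr /=.
  apply: (@leq_trans (\sum_(e in F) K * H)); last first.
    by rewrite sum_nat_const -mulnA mulnCA leq_mul2l leq_mul2r Ff !orbT.
  apply: leq_sum => e eF; rewrite exchange_big big_distrr /=.
  apply: (@leq_trans (\sum_(e' <- s) H)); last first.
    by rewrite big_const_seq iter_addn_0 count_predT mulnC leq_mul2r sK orbT.
  rewrite big_seq [X in _ <= X]big_seq; apply: leq_sum => e' e's.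
  apply: hash_agree => //; apply/negP => /eqP /val_inj E.
  by have := sF e' e's; rewrite -E eF.
have b0 : 0 < K * f by rewrite muln_gt0 K0.
have := cardsC good; rewrite card_ord.
have : 2 * #|~: good| <= H.
  by rewrite -(@leq_pmul2l (K * f)) // mulnA (mulnC (K * f)).
by move: #|~: good| #|good| => a b; lia.
Qed.

End Path.
End Covering.

(** * Reasoning about word RAM programs *)

Fixpoint den (inp : seq nat) (m : nat -> nat) (e : expr) : nat :=
  match e with
  | Const c => c
  | Fetch a => m (den inp m a)
  | Input a => nth 0 inp (den inp m a)
  | Bin o a b => binop_sem o (den inp m a) (den inp m b)
  end.

(* If all memory cells and inputs are below R, the value of e is below
   R ^ magnitude e; so e cannot get stuck when B = R ^ 6 and magnitude e <= 6. *)
Fixpoint magnitude (e : expr) : nat :=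
  match e with
  | Const _ | Fetch _ | Input _ => 1
  | Bin OAdd a b => (maxn (magnitude a) (magnitude b)).+1
  | Bin OMul a b => magnitude a + magnitude b
  | Bin OLt _ _ | Bin OEq _ _ => 1
  | Bin _ a _ => magnitude a
  end.

(** All subexpressions are checked, because every intermediate value has to be a word. Constants up
    to 104 are safe since [machine] requires [104 < R]. *)
Fixpoint bounded_expr (e : expr) : bool :=
  (magnitude e <= 6) &&
  match e with
  | Const c => c <= 104
  | Fetch a | Input a => bounded_expr a
  | Bin _ a b => bounded_expr a && bounded_expr b
  end.

(* The cells below 104 hold scalar variables; the cells from 104 on hold eight
   interleaved arrays, cell i of array k being at the address adr k i. *)
Definition adr (k i : nat) : nat := k + 8 * (i + 13).

Notation Var j := (Fetch (Const j)).
Notation Adr k e := (Bin OAdd (Const k) (Bin OMul (Const 8) (Bin OAdd e (Const 13)))).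
Notation Arr k e := (Fetch (Adr k e)).

Arguments store _ _ _ _ /.

Lemma var_adr (j k i : nat) : j < 104 -> (j == adr k i) = false.
Proof. by move=> j104; apply/negbTE/eqP; rewrite /adr; lia. Qed.

Lemma adr_var (j k i : nat) : j < 104 -> (adr k i == j) = false.
Proof. by move=> j104; rewrite eq_sym var_adr. Qed.

Lemma adr_adr (k k' i i' : nat) : k < 8 -> k' < 8 ->
  (adr k i == adr k' i') = (k == k') && (i == i').
Proof.
move=> k8 k8'; apply/eqP/andP => [|[/eqP -> /eqP -> //]].
by rewrite /adr => E; split; apply/eqP; lia.
Qed.

Lemma adrE (k i : nat) : k + 8 * (i + 13) = adr k i. Proof. by []. Qed.

Arguments adr : simpl never.

Definition cellE := (adr_adr, var_adr, adr_var, eqxx).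

(* frame lo ks m m': only the scalars from lo on and the arrays in ks differ. *)
Definition frame (lo : nat) (ks : seq nat) (m m' : nat -> nat) : Prop :=
  (forall j, j < lo -> j < 104 -> m' j = m j) /\
  (forall k i, k < 8 -> k \notin ks -> m' (adr k i) = m (adr k i)).

Lemma frame_trans lo ks m m' m'' : frame lo ks m m' -> frame lo ks m' m'' -> frame lo ks m m''.
Proof.
move=> [v a] [v' a']; split=> *; first by rewrite v' // v.
by rewrite a' // a.
Qed.

Lemma frame_weak lo lo' ks ks' m m' : frame lo ks m m' -> lo' <= lo -> {subset ks <= ks'} ->
  frame lo' ks' m m'.
Proof.
move=> [v a] le sub; split=> [j jlo|k i k8 kks]; first by apply: v; apply: leq_trans le.
by apply: a => //; apply: contra kks; apply: sub.
Qed.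

Lemma frame_var lo ks m m' j v : frame lo ks m m' -> lo <= j -> j < 104 ->
  frame lo ks m (store m' j v).
Proof.
move=> [fv fa] loj j104; split=> [i ilo i104|k i k8 kks] /=.
  by case: eqP => [E|_]; [lia | apply: fv].
by rewrite adr_var // fa.
Qed.

Lemma frame_arr lo ks m m' k i v : frame lo ks m m' -> k \in ks -> k < 8 ->
  frame lo ks m (store m' (adr k i) v).
Proof.
move=> [fv fa] kks k8; split=> [j jlo j104|k' i' k8' kks'] /=.
  by rewrite var_adr // fv.
rewrite adr_adr //; case: eqP => [E|_]; last exact: fa.
by rewrite E kks in kks'.
Qed.

Definition machine (R : nat) (inp : seq nat) : Prop :=
  104 < R /\ forall j, nth 0 inp j < R.

Section Hoare.
Variables (R : nat) (inp : seq nat).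
Hypothesis M : machine R inp.

Definition bounded_mem (m : nat -> nat) : Prop := forall a, m a < R.

Lemma den_bound (m : nat -> nat) (e : expr) : bounded_mem m -> bounded_expr e ->
  eval (R ^ 6) inp m e = Some (den inp m e) /\ den inp m e < R ^ magnitude e.
Proof.
have [R104 inpR] := M; move=> mR; have R1 : 1 < R by lia.
have word6 v d : v < R ^ d -> d <= 6 -> word (R ^ 6) v = Some v.
  by move=> vd d6; rewrite /word (leq_trans vd) // leq_exp2l.
elim: e => [c|a IHa|a IHa|o a IHa b IHb].
- rewrite [bounded_expr _]/= [magnitude _]/= => c104 /=.
  have cR : c < R ^ 1 by rewrite expn1; lia.
  by split; first exact: word6 cR _.
- rewrite [bounded_expr _]/= => /IHa [Ea _]; rewrite [eval _ _ _ _]/= Ea; rewrite [magnitude _]/= expn1 [obind _ _]/=.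
  by split; [apply: (@word6 _ 1); rewrite ?expn1 //; exact: mR | exact: mR].
- rewrite [bounded_expr _]/= => /IHa [Ea _]; rewrite [eval _ _ _ _]/= Ea; rewrite [magnitude _]/= expn1.
  by split; [apply: (@word6 _ 1); rewrite ?expn1 //; exact: inpR | exact: inpR].
- move=> /andP[mag6 /andP[/IHa [Ea Ba] /IHb [Eb Bb]]].
  set x := den inp m a in Ea Ba; set y := den inp m b in Eb Bb.
  suff lt : binop_sem o x y < R ^ magnitude (Bin o a b).
    split; last exact: lt.
    rewrite -[den _ _ _]/(binop_sem o x y) -[eval _ _ _ _]/(obind (fun x =>
      obind (fun y => word (R ^ 6) (binop_sem o x y)) (eval (R ^ 6) inp m b))
      (eval (R ^ 6) inp m a)) Ea Eb.
    by rewrite -[LHS]/(word _ _) (word6 _ _ lt mag6).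
  case: {mag6} o => /=.
  + rewrite expnS.
    have Bx : x < R ^ maxn (magnitude a) (magnitude b).
      by apply: leq_trans Ba _; rewrite leq_exp2l ?leq_maxl.
    have By : y < R ^ maxn (magnitude a) (magnitude b).
      by apply: leq_trans Bb _; rewrite leq_exp2l ?leq_maxr.
    by move: (R ^ maxn _ _) Bx By => u Bx By; nia.
  + exact: leq_ltn_trans (leq_subr _ _) Ba.
  + by rewrite expnD ltn_mul.
  + exact: leq_ltn_trans (leq_div _ _) Ba.
  + exact: leq_ltn_trans (leq_mod _ _) Ba.
  + by rewrite expn1; case: (x < y); lia.
  + by rewrite expn1; case: (x == y); lia.
Qed.

(** A total-correctness triple with a time bound. Words range up to [R^6] while memory cells stay
    below [R], which leaves room for the intermediate values of an expression. *)
Definition run (c : cmd) (st : state) (T : nat) (P : state -> Prop) : Prop :=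
  exists t st', [/\ exec (R ^ 6) inp c st t st', t <= T, bounded_mem (memory st') & P st'].

Lemma run_weak c st T T' (P P' : state -> Prop) : run c st T P -> T <= T' ->
  (forall st', bounded_mem (memory st') -> P st' -> P' st') -> run c st T' P'.
Proof.
move=> [t [st' [e tT b p]]] TT' PP'; exists t, st'; split=> //; last exact: PP'.
exact: leq_trans TT'.
Qed.

(* Time bounds are written T + k with a numeral k, from which the costs of the
   straight-line instructions are subtracted by computation. *)
Lemma run_skip st T k (P : state -> Prop) : bounded_mem (memory st) -> 0 < k -> P st ->
  run Skip st (T + k) P.
Proof.
move=> b k0 p; exists 1, st; split=> //; first by constructor.
by apply: leq_trans k0 (leq_addl _ _).
Qed.

Lemma run_store a e x v st T k (P : state -> Prop) : bounded_mem (memory st) ->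
  bounded_expr a && bounded_expr e -> ecost a + ecost e < k ->
  den inp (memory st) a = x -> den inp (memory st) e = v -> v < R ->
  P (State (store (memory st) x v) (output st)) ->
  run (Store a e) st (T + k) P.
Proof.
move=> b /andP[ba be] cT <- <- eR p; do 2 eexists; split; last exact: p.
- apply: ExecStore; first by case: (den_bound b ba).
  by case: (den_bound b be).
- exact: leq_trans cT (leq_addl _ _).
- by move=> z /=; case: ifP => _.
Qed.

Lemma run_emit e v st T k (P : state -> Prop) : bounded_mem (memory st) ->
  bounded_expr e -> ecost e < k -> den inp (memory st) e = v ->
  P (State (memory st) (rcons (output st) v)) ->
  run (Emit e) st (T + k) P.
Proof.
move=> b be cT <- p; do 2 eexists; split; last exact: p => //.
- by apply: ExecEmit; case: (den_bound b be).
- exact: leq_trans cT (leq_addl _ _).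
- exact: b.
Qed.

Lemma run_seq c1 c2 st T T1 T2 (P1 P : state -> Prop) :
  run c1 st T1 P1 -> T1 + T2 < T ->
  (forall st1, bounded_mem (memory st1) -> P1 st1 -> run c2 st1 T2 P) ->
  run (Seq c1 c2) st T P.
Proof.
move=> [t1 [st1 [e1 l1 b1 p1]]] TT H.
have [t2 [st2 [e2 l2 b2 p2]]] := H st1 b1 p1.
exists (t1 + t2).+1, st2; split=> //; last by apply: leq_ltn_trans TT; rewrite leq_add.
exact: ExecSeq e1 e2.
Qed.

Lemma run_store_seq a e x v c st T k (P : state -> Prop) : bounded_mem (memory st) ->
  bounded_expr a && bounded_expr e -> ecost a + ecost e + 2 <= k ->
  den inp (memory st) a = x -> den inp (memory st) e = v -> v < R ->
  (bounded_mem (store (memory st) x v) ->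
   run c (State (store (memory st) x v) (output st)) (T + (k - (ecost a + ecost e + 2))) P) ->
  run (Seq (Store a e) c) st (T + k) P.
Proof.
move=> b be cT aE eE eR H.
apply: (@run_seq _ _ _ _ (0 + (ecost a + ecost e).+1) (T + (k - (ecost a + ecost e + 2)))
  (fun st' => st' = State (store (memory st) x v) (output st))).
- exact: run_store aE eE eR _.
- by lia.
- by move=> st1 b1 E; move: b1; rewrite E; apply: H.
Qed.

Lemma run_emit_seq e v c st T k (P : state -> Prop) : bounded_mem (memory st) ->
  bounded_expr e -> ecost e + 2 <= k -> den inp (memory st) e = v ->
  run c (State (memory st) (rcons (output st) v)) (T + (k - (ecost e + 2))) P ->
  run (Seq (Emit e) c) st (T + k) P.
Proof.
move=> b be cT eE H.
apply: (@run_seq _ _ _ _ (0 + (ecost e).+1) (T + (k - (ecost e + 2)))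
  (fun st' => st' = State (memory st) (rcons (output st) v))).
- exact: run_emit eE _.
- by lia.
- by move=> st1 b1 ->.
Qed.

Lemma run_if e v c1 c2 st T k (P : state -> Prop) : bounded_mem (memory st) ->
  bounded_expr e -> den inp (memory st) e = v -> ecost e < k ->
  run (if v != 0 then c1 else c2) st (T + (k - (ecost e).+1)) P ->
  run (If e c1 c2) st (T + k) P.
Proof.
move=> b be <- cT [t [st' [ex tT b' p]]]; exists (ecost e + t).+1, st'; split=> //; last by lia.
by apply: ExecIf ex; case: (den_bound b be).
Qed.

(** The variant [n] only bounds the number of remaining iterations; the guard may fail before it
    reaches 0. *)
Lemma run_while e c (Inv : nat -> state -> Prop) st n T T' (P : state -> Prop) :
  bounded_mem (memory st) -> bounded_expr e ->
  (forall n st, bounded_mem (memory st) -> Inv n st ->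
     (den inp (memory st) e = 0 /\ P st) \/
     [/\ den inp (memory st) e != 0, 0 < n & run c st T' (Inv n.-1)]) ->
  Inv n st -> n * (ecost e + T').+1 + ecost e < T ->
  run (While e c) st T P.
Proof.
move=> b be step; elim: n st b T => [|n IH] st b T I nT.
  have [[e0 p]|[_ //]] := step _ _ b I.
  exists (ecost e).+1, st; split=> //.
  by apply: ExecWhileStop; have [-> _] := den_bound b be; rewrite e0.
have [[e0 p]|[e0 _ [t1 [st1 [e1 l1 b1 I1]]]]] := step _ _ b I.
  exists (ecost e).+1, st; split=> //; last by apply: leq_trans nT; rewrite ltnS leq_addl.
  by apply: ExecWhileStop; have [-> _] := den_bound b be; rewrite e0.
have [t2 [st2 [e2 l2 b2 p2]]] := IH st1 b1 (n * (ecost e + T').+1 + ecost e).+1 I1 (ltnSn _).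
exists (ecost e + t1 + t2).+1, st2; split=> //; last by rewrite mulSn in nT; lia.
by apply: ExecWhileStep e0 e1 e2; have [-> _] := den_bound b be.
Qed.

End Hoare.

(** The bound [e] is evaluated anew in every iteration, so the loop invariants have to fix its value
    and the time bounds charge for it. *)
Definition For (v : nat) (e : expr) (c : cmd) : cmd :=
  Seq (Store (Const v) (Const 0))
      (While (Bin OLt (Var v) e)
             (Seq c (Store (Const v) (Bin OAdd (Var v) (Const 1))))).

Section ForLoop.
Variables (R : nat) (inp : seq nat).
Hypothesis M : machine R inp.

(* The invariant may not mention the cell of the loop variable v, other than
   through the fact that it holds i. *)
Lemma run_for v e c (I : nat -> state -> Prop) st n T T' (P : state -> Prop) :
  bounded_mem R (memory st) -> bounded_expr e -> v < 104 -> n < R ->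
  (forall i st a, I i st -> I i (State (store (memory st) v a) (output st))) ->
  (forall i st, bounded_mem R (memory st) -> I i st -> i <= n -> memory st v = i ->
     den inp (memory st) e = n) ->
  (forall i st, bounded_mem R (memory st) -> I i st -> i < n -> memory st v = i ->
     run R inp c st T' (fun st' => I i.+1 st' /\ memory st' v = i)) ->
  I 0 st -> (forall st, bounded_mem R (memory st) -> I n st -> P st) ->
  n * (ecost e + T' + 13) + ecost e + 10 <= T ->
  run R inp (For v e c) st T P.
Proof.
have [R104 _] := M; move=> b be v104 nR Iv en body I0 IP nT.
have bv : bounded_expr (Const v) by rewrite /=; lia.
have blt : bounded_expr (Bin OLt (Var v) e) by rewrite /= be andbT; lia.
apply: (@run_weak R inp _ _ (n * (ecost e + T' + 13) + ecost e + 10) _ P) => //.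
apply: (run_store_seq M (x := v) (v := 0)) => //.
- by rewrite bv.
- by lia.
move=> b0.
apply: (@run_while R inp M _ _ (fun j st => [/\ j <= n, I (n - j) st & memory st v = n - j])
   _ n _ (T' + 7)) => //=; last by lia.
- move=> j [m o] /= bm [jn Ij vj].
  rewrite vj (en (n - j) (State m o)) ?leq_subr //.
  case: j jn Ij vj => [|j] jn Ij vj.
    by left; rewrite subn0 ltnn; split=> //; apply: IP => //; rewrite -[n]subn0.
  right; have lt : n - j.+1 < n by lia.
  rewrite lt; split=> //.
  apply: (@run_seq R inp _ _ _ _ T' (0 + 6) _ _ (body _ (State m o) bm Ij lt vj)); last first.
    move=> [m1 o1] /= b1 [I1 v1].
    apply: (run_store M (x := v) (v := (n - j.+1).+1)) => //.
    - by rewrite bv /=; lia.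
    - by rewrite /= v1 addn1.
    - by lia.
    - rewrite /= eqxx; split; [lia| |lia].
      by rewrite (_ : n - j = (n - j.+1).+1); [apply: (Iv _ (State m1 o1)) I1 | lia].
  by lia.
- by rewrite subnn eqxx; split=> //; apply: Iv.
Qed.

End ForLoop.

Lemma leq_for_time (n e b k k' d : nat) : e + k + 13 <= k' -> e + 10 <= d ->
  n * (e + (b + k) + 13) + e + 10 <= n * (b + k') + d.
Proof.
move=> kk ed; rewrite -addnA; apply: leq_add ed.
by rewrite leq_mul2l; apply/orP; right; lia.
Qed.

(** * The programs *)

Declare Scope prog_scope.
Delimit Scope prog_scope with prog.
Notation "a + b" := (Bin OAdd a b) : prog_scope.
Notation "a - b" := (Bin OSub a b) : prog_scope.
Notation "a * b" := (Bin OMul a b) : prog_scope.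
Notation "a %/ b" := (Bin ODiv a b) : prog_scope.
Notation "a %% b" := (Bin OMod a b) : prog_scope.
Notation "a < b" := (Bin OLt a b) : prog_scope.
Notation "a == b" := (Bin OEq a b) : prog_scope.
Notation "v ::= e" := (Store (Const v) e%prog) (at level 75).
Notation "c ;; d" := (Seq c d) (at level 76, right associativity).

Notation v_x := 0 (only parsing).
Notation v_K := 1 (only parsing).
Notation v_f := 2 (only parsing).
Notation v_Kf := 3 (only parsing).
Notation v_lg := 4 (only parsing).
Notation v_k := 5 (only parsing).
Notation v_p := 6 (only parsing).
Notation v_k1 := 7 (only parsing).
Notation v_use := 8 (only parsing).
Notation v_q := 9 (only parsing).
Notation v_l2 := 10 (only parsing).
Notation v_T := 11 (only parsing).
Notation v_Q := 12 (only parsing).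
Notation v_H := 13 (only parsing).
Notation v_N := 14 (only parsing).
Notation v_cr := 15 (only parsing).
Notation v_nb := 16 (only parsing).
Notation v_i := 30 (only parsing).
Notation v_stamp := 31 (only parsing).
Notation v_out := 32 (only parsing).
Notation v_y := 40 (only parsing).
Notation v_X := 41 (only parsing).
Notation v_a := 42 (only parsing).
Notation v_j := 43 (only parsing).
Notation v_code := 44 (only parsing).
Notation v_digit := 45 (only parsing).
Notation v_w := 46 (only parsing).
Notation v_t := 47 (only parsing).
Notation v_blk := 48 (only parsing).
Notation v_r := 49 (only parsing).
Notation v_e := 50 (only parsing).
Notation v_cnt := 51 (only parsing).
Notation v_z := 60 (only parsing).
Notation v_acc := 61 (only parsing).
Notation v_pow := 62 (only parsing).

Notation a_mul := 0 (only parsing).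
Notation a_inv := 1 (only parsing).
Notation a_weight := 2 (only parsing).
Notation a_mark := 3 (only parsing).
Notation a_buf := 4 (only parsing).

Definition prog_rs : cmd :=
  v_acc ::= Const 0 ;;
  v_pow ::= Const 1 ;;
  While (Const 0 < Var v_z)%prog
    (v_acc ::= (Var v_acc + (Var v_z %% Var v_p) * Var v_pow) %% Var v_p ;;
     v_pow ::= (Var v_pow * Var v_X) %% Var v_p ;;
     v_z ::= Var v_z %/ Var v_p).

Tactic Notation "assign" constr(M) constr(y) constr(v) := apply: (run_store_seq M (x := y) (v := v));
  [by [] | by [] | by [] | rewrite /= ?adrE ?cellE //; try by [] | rewrite /= ?adrE ?cellE //= | | move=> ? /=].

Section Programs.
Variables (R : nat) (inp : seq nat).
Hypothesis M : machine R inp.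

Lemma R_gt104 : 104 < R. Proof. by case: M. Qed.

(** Since [p >= 2], each division by [p] at least halves [z], so [n] iterations suffice. *)
Lemma prog_rsP (m : nat -> nat) (o : seq nat) (p X z n : nat) : bounded_mem R m ->
  m v_p = p -> m v_X = X -> m v_z = z -> 1 < p -> z < 2 ^ n ->
  run R inp prog_rs (State m o) (60 * n + 60) (fun st' =>
    [/\ output st' = o, frame 60 [::] m (memory st') & memory st' v_acc = rs p X z]).
Proof.
move=> b mp mX mz p1 zn; have R104 := R_gt104.
assign M v_acc 0; first by lia.
assign M v_pow 1; first by lia.
apply: (@run_while R inp M _ _ (fun j st => exists t,
  [/\ output st = o, frame 60 [::] m (memory st),
      memory st v_z = z %/ p ^ t /\ z %/ p ^ t < 2 ^ j,
      memory st v_acc = (\sum_(i < t) digit p i z * X ^ i) %% p &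
      memory st v_pow = X ^ t %% p]) _ n _ (0 + 50)) => //=; last by lia.
  move=> j [m' o'] /= b' [t [-> fr [zE zj] accE powE]].
  have [fv fa] := fr.
  have pE : m' v_p = p by rewrite fv.
  have XE : m' v_X = X by rewrite fv.
  rewrite zE; have [z0|z0] := posnP (z %/ p ^ t).
    left; split=> //; split=> //; rewrite accE -(@rsE _ _ _ t) //.
    have := divn_eq z (p ^ t); rewrite z0 mul0n add0n => ->.
    by rewrite ltn_mod expn_gt0 ltnW.
  right; case: j zj => [|j] zj; first by move: zj; rewrite expn0; lia.
  split=> //.
  have modR u : u %% p < R.
    by apply: ltn_trans (ltn_pmod _ (ltnW p1)) _; rewrite -pE; apply: b'.
  assign M v_acc ((m' v_acc + (z %/ p ^ t %% p) * m' v_pow) %% p).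
  - by rewrite zE pE.
  - exact: modR.
  assign M v_pow ((m' v_pow * X) %% p); [by rewrite pE XE | exact: modR |].
  apply: (run_store M (x := v_z) (v := z %/ p ^ t %/ p)) => //=.
  - by rewrite zE pE.
  - by rewrite -zE; apply: leq_ltn_trans (b' v_z); apply: leq_div.
  exists t.+1; split=> //.
  - by do 3! apply: frame_var => //.
  - rewrite -divnMA -expnSr; split=> //.
    rewrite expnSr divnMA ltn_divLR ?(ltnW p1) //.
    by apply: leq_trans zj _; rewrite expnSr leq_mul2l p1 orbT.
  - rewrite accE powE big_ord_recr /= modnDml -modnDmr modnMmr modnDmr.
    by [].
  - by rewrite powE modnMml expnSr.
exists 0; split=> //.
- by do 2! apply: frame_var => //.
- by rewrite expn0 divn1.
- by rewrite big_ord0 mod0n.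
- by rewrite expn0 modn_small.
Qed.

End Programs.

(** * Listing a bucket and a single subgraph *)

Definition prog_bucket : cmd :=
  For v_t (Var v_nb)
    (v_blk ::= Var v_t %/ Var v_cr ;;
     v_r ::= Var v_w + (Var v_t %% Var v_cr) * Var v_q ;;
     If (Var v_r < Var v_p)%prog
       (v_z ::= Var v_blk ;;
        prog_rs ;;
        v_e ::= Var v_blk * Var v_p +
                (((Var v_a * Var v_r) %% Var v_p + Var v_p)
                 - (Var v_X * Var v_acc) %% Var v_p) %% Var v_p ;;
        If (Var v_e < Var v_x)%prog
          (Store (Adr a_buf (Var v_cnt)) (Var v_e) ;;
           v_cnt ::= Var v_cnt + Const 1)
          Skip)
       Skip).

(* a_mark holds the current stamp at the digits whose buckets were already listed,
   so that it need not be cleared between two runs. *)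
Definition prog_cover : cmd :=
  v_y ::= (Var v_i %% Var v_H) %% Var v_l2 ;;
  v_X ::= (Var v_i %% Var v_H) %/ Var v_l2 ;;
  v_a ::= Arr a_inv (Var v_y) ;;
  v_code ::= Var v_i %/ Var v_H ;;
  v_cnt ::= Const 0 ;;
  For v_j (Var v_T)
    (v_digit ::= Var v_code %% Var v_Q ;;
     v_code ::= Var v_code %/ Var v_Q ;;
     If (Const 0 < Var v_digit)%prog
       (If (Arr a_mark (Var v_digit) == Var v_stamp)%prog
          Skip
          (Store (Adr a_mark (Var v_digit)) (Var v_stamp) ;;
           v_w ::= Var v_digit - Const 1 ;;
           prog_bucket))
       Skip).

Definition buffer (m : nat -> nat) (n : nat) : seq nat :=
  mkseq (fun j => m (adr a_buf j)) n.

Lemma buffer_ext (m m' : nat -> nat) (n : nat) :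
  (forall j, m' (adr a_buf j) = m (adr a_buf j)) -> buffer m' n = buffer m n.
Proof. by move=> E; apply: eq_mkseq. Qed.

Lemma buffer_rcons (m : nat -> nat) (n e : nat) :
  buffer (store m (adr a_buf n) e) n.+1 = rcons (buffer m n) e.
Proof.
rewrite /buffer /mkseq -(addn1 n) iotaD map_cat /= cats1 add0n eqxx; congr rcons.
apply/eq_in_map => j; rewrite mem_iota /= add0n => jn.
by rewrite adr_adr //= (ltn_eqF jn).
Qed.

Definition digits (Q c j : nat) : seq nat := [seq digit Q t c | t <- iota 0 j].

Lemma digits_rcons (Q c j : nat) : digits Q c j.+1 = rcons (digits Q c j) (digit Q j c).
Proof. by rewrite /digits -(addn1 j) iotaD map_cat /= cats1. Qed.

Section Programs.
Variables (R : nat) (inp : seq nat).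
Hypothesis M : machine R inp.

Variables (x p q l1 l2 T : nat) (A Inv : nat -> nat).
Hypothesis pp : prime p.
Hypothesis q0 : 0 < q.
Hypothesis qp : q <= p.
Hypothesis l20 : 0 < l2.
Hypothesis AI : forall y, y < l2 -> A y * Inv y %% p = 1.

Notation H := (l1 * l2).
Notation Q := q.+1.
Notation N := (H * Q ^ T).
Notation cr := ((p + q - 1) %/ q).
Notation nb := (cr * (x %/ p).+1).
Notation D := (lg x).+1.

Hypothesis xR : 2 * x + nb + 4 * p + N + T + 4 < R.

Let p1 : 1 < p := prime_gt1 pp.
Let p0 : 0 < p := ltnW p1.
Let R104 : 104 < R := R_gt104 M.

Definition holds_params (m : nat -> nat) : Prop :=
  [/\ [/\ m v_x = x, m v_p = p, m v_q = q & m v_l2 = l2],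
      [/\ m v_T = T, m v_Q = Q, m v_H = H & m v_N = N],
      m v_cr = cr /\ m v_nb = nb &
      forall y, y < l2 -> m (adr a_mul y) = A y /\ m (adr a_inv y) = Inv y].

Lemma holds_params_frame (m m' : nat -> nat) (lo : nat) (ks : seq nat) :
  holds_params m -> frame lo ks m m' -> 16 < lo -> a_mul \notin ks -> a_inv \notin ks ->
  holds_params m'.
Proof.
move=> [[? ? ? ?] [? ? ? ?] [? ?] ar] [fv fa] lo16 k0 k1.
have E j : j <= 16 -> m' j = m j.
  by move=> jl; apply: fv; apply: leq_ltn_trans jl _.
split; rewrite ?E //.
by move=> y /ar [<- <-]; rewrite !fa.
Qed.

Let xpR : x + p < R.
Proof. by move: N nb xR => u v; lia. Qed.

Let p2R : 2 * p < R.
Proof. by move: N nb xR => u v; lia. Qed.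

Let x_ltR : x < R.
Proof. by move: N nb xR => u v; lia. Qed.

Let nbR : x + nb < R.
Proof. by move: N nb xR => u v; lia. Qed.

Let NTR : N + T + 4 < R.
Proof. by move: N nb xR => u v; lia. Qed.

(** The last candidate residue may overshoot [p]; it is computed before it is tested and must still
    be a word. *)
Lemma residue_lt (w t : nat) : w < q -> w + t %% cr * q < 2 * p.
Proof.
move=> wq; have c0 : 0 < cr := cr_gt0 pp q0 l20.
have := ltn_pmod t c0; have := leq_divM (p + q - 1) q.
move: cr (t %% _) {c0} => c r cq rc.
have : r.+1 * q <= c * q by rewrite leq_mul2r rc orbT.
by rewrite mulSn; lia.
Qed.

Definition bucket_time : nat := nb * (60 * D + 260) + 20.

Lemma prog_bucketP (m : nat -> nat) (o : seq nat) (X y w cnt : nat) : bounded_mem R m ->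
  holds_params m -> m v_X = X -> y < l2 -> m v_a = Inv y -> m v_w = w -> w < q ->
  m v_cnt = cnt -> cnt <= x ->
  run R inp prog_bucket (State m o) bucket_time (fun st' =>
    [/\ output st' = o, frame 47 [:: a_buf] m (memory st'),
        memory st' v_cnt = cnt + size (bucket x p q Inv X y w nb) &
        buffer (memory st') (memory st' v_cnt) = buffer m cnt ++ bucket x p q Inv X y w nb]).
Proof.
move=> b par mX yl ma mw wq mc cx.
have c0 : 0 < cr := cr_gt0 pp q0 l20.
apply: (@run_for R inp M _ _ _ (fun n st => [/\ output st = o, frame 47 [:: a_buf] m (memory st),
        memory st v_cnt = cnt + size (bucket x p q Inv X y w n) &
        buffer (memory st) (memory st v_cnt) = buffer m cnt ++ bucket x p q Inv X y w n])
   _ nb _ (60 * D + 240)) => //.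
- by apply: leq_ltn_trans nbR; apply: leq_addl.
- move=> i [m' o'] a /= [-> fr cE bE]; split=> //; first by apply: frame_var.
  by rewrite -bE; apply: buffer_ext => j; rewrite /= cellE.
- move=> i [m' o'] /= b' [_ [fv fa] _ _] _ _; rewrite fv //.
  by case: par => _ _ [_ ->].
- move=> i [m' o'] /= b' [-> fr cE bE] ilt iE.
  have [fv fa] := fr.
  have par' : holds_params m' by apply: holds_params_frame par fr _ _ _.
  have [[xE pE qE l2E] _ [crE nbE] _] := par'.
  have XE : m' v_X = X by rewrite fv.
  have aE : m' v_a = Inv y by rewrite fv.
  have wE : m' v_w = w by rewrite fv.
  have bucketS : bucket x p q Inv X y w i.+1 = bucket x p q Inv X y w i ++
      (if bucket_ok x p q Inv X y w i then [:: bucket_arg p q Inv X y w i] else [::]).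
    by rewrite /bucket -(addn1 i) iotaD filter_cat map_cat /= add0n; case: ifP.
  rewrite bucketS size_cat.
  have szb : size (bucket x p q Inv X y w i) <= i by apply: size_bucket.
  have blkx : i %/ cr <= x %/ p by rewrite -ltnS ltn_divLR // mulnC.
  set blk := i %/ cr in blkx *; set r := w + i %% cr * q.
  assign M v_blk blk; [by rewrite iE crE | |].
    by apply: leq_ltn_trans (leq_div _ _) _; apply: ltn_trans ilt _; apply: leq_ltn_trans nbR; apply: leq_addl.
  assign M v_r r; [by rewrite wE iE crE qE | |].
    by apply: ltn_trans (residue_lt i wq) _; exact: p2R.
  apply: (run_if M (v := r < p) ) => //=; first by rewrite pE.
  rewrite /bucket_ok -/r; case: ltnP => /= rp; last first.
    rewrite addn0 cats0; apply: run_skip => //=; split=> //; split=> //.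
      by do 2 apply: frame_var => //.
    by rewrite -bE; apply: buffer_ext => j; rewrite /= !cellE.
  assign M v_z blk.
    by apply: leq_ltn_trans blkx _; apply: leq_ltn_trans (leq_div _ _) x_ltR.
  have blkR : blk < 2 ^ D.
    apply: leq_ltn_trans blkx _; apply: leq_ltn_trans (leq_div _ _) _; exact: lt_lg.
  set m2 := (X in State X).
  have fr2 : frame 47 [:: a_buf] m m2 by do 3 apply: frame_var => //.
  apply: (@run_seq R inp _ _ _ _ (60 * D + 60) (0 + 120) _ _
    (@prog_rsP R inp M m2 o p X blk D _ _ _ _ _ blkR)) => //; first by lia.
  move=> [m3 o3] /= b3 [-> fr3 accE].
  have [fv3 fa3] := fr3.
  have v3 j : j < 47 -> m3 j = m' j.
    move=> jl; rewrite fv3; [|by apply: leq_trans jl _|by apply: leq_trans jl _].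
    by rewrite /m2 /= !(ltn_eqF (leq_trans jl _)).
  have tE3 : m3 v_t = i by rewrite fv3.
  have cE3 : m3 v_cnt = cnt + size (bucket x p q Inv X y w i) by rewrite fv3.
  have fr4 : frame 47 [:: a_buf] m m3.
    by apply: frame_trans fr2 _; apply: frame_weak fr3 _ _.
  have bE3 : buffer m3 (cnt + size (bucket x p q Inv X y w i)) = buffer m cnt ++ bucket x p q Inv X y w i.
    by rewrite -bE cE; apply: buffer_ext => j; rewrite fa3 //= /m2 /= !cellE.
  set e := bucket_arg p q Inv X y w i.
  (* The last block may extend past [x], so before the test [e < x] only the bound [x + p] is
     available. *)
  have eR : e < R.
    rewrite /e /bucket_arg.
    have := leq_trans (leq_mul blkx (leqnn p)) (leq_divM x p).
    have := ltn_pmod ((Inv y * (w + i %% cr * q)) %% p + p - (X * rs p X (i %/ cr)) %% p) p0.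
    rewrite -/blk => lt le; apply: leq_ltn_trans (leq_add le (ltnW lt)) _.
    exact: xpR.
  assign M v_e e; [| exact: eR |].
    by rewrite [m3 v_p]v3 // pE [m3 v_a]v3 // aE [m3 v_X]v3 // XE accE !fv3.
  apply: (run_if M (v := e < x)) => //=; first by rewrite v3 // xE.
  case: ltnP => /= ex; last first.
    apply: run_skip => //=; split=> //; split=> //; rewrite ?cats0 ?addn0 //.
      by apply: frame_var.
    by rewrite cE3 -bE3; apply: buffer_ext => j; rewrite /= cellE.
  set c := cnt + size (bucket x p q Inv X y w i) in cE3 bE3 *.
  assign M (adr a_buf c) e; [by rewrite cE3 | exact: eR |].
  apply: (run_store M (x := v_cnt) (v := c.+1)) => //=.
  - by rewrite !cellE //= cE3 addn1.
  - by move: nbR ilt szb cx; rewrite /c; move: (size _) nb => s u; lia.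
  - rewrite !cellE //=; split=> //; split=> //.
    + by apply: frame_var => //; apply: frame_arr => //; apply: frame_var.
    + by rewrite addn1 addnS.
    + rewrite catA -bE3 cats1 -buffer_rcons; apply: eq_mkseq => j /=.
      by rewrite !cellE.
- by rewrite /= addn0 cats0 mc; split.
- exact: leq_for_time.
Qed.


Notation cov := (cover_set x p q l1 l2 T A).

Definition cover_time : nat := T * (bucket_time + 120) + 120.

Lemma prog_coverP (m : nat -> nat) (o : seq nat) (i stamp : nat) : bounded_mem R m ->
  holds_params m -> m v_i = i -> i < N -> m v_stamp = stamp ->
  (forall w, m (adr a_mark w) != stamp) ->
  run R inp prog_cover (State m o) cover_time (fun st' =>
    [/\ output st' = o, frame 40 [:: a_mark; a_buf] m (memory st'),
        forall w, memory st' (adr a_mark w) = m (adr a_mark w) \/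
                  memory st' (adr a_mark w) = stamp &
        lists (buffer (memory st') (memory st' v_cnt)) (cov i)]).
Proof.
move=> b par mi iN ms marks.
have [[xE pE qE l2E] [TE QE HE NE] [crE nbE] AE] := par.
have iR : i < R by apply: ltn_trans iN _; move: NTR; lia.
have stampR : stamp < R by rewrite -ms.
set y := i %% H %% l2; set X := i %% H %/ l2.
have yl : y < l2 by apply: ltn_pmod.
have divR u v : u < R -> u %/ v < R.
  by apply: leq_ltn_trans (leq_div _ _).
have modR u v : u < R -> u %% v < R.
  by apply: leq_ltn_trans (leq_mod _ _).
assign M v_y y; [by rewrite mi HE l2E | exact: modR _ _ (modR _ _ iR) |].
assign M v_X X; [by rewrite mi HE l2E | exact: divR _ _ (modR _ _ iR) |].
assign M v_a (Inv y); [by case: (AE y yl) => _ <- | by case: (AE y yl) => _ <- |].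
have codeR : i %/ H < R by apply: (divR).
set code := i %/ H in codeR *.
assign M v_code code; [by rewrite mi HE | exact: codeR |].
assign M v_cnt 0; first by apply: leq_ltn_trans iR.
set m1 := (X in State X o).
have fr1 : frame 40 [:: a_mark; a_buf] m m1 by do 5! apply: frame_var => //.
have par1 : holds_params m1 by apply: holds_params_frame par fr1 _ _ _.
(* Repeated digits are recognised by their marks, and buckets of different values are disjoint;
   hence the buffer stays free of repetitions. *)
apply: (@run_for R inp M _ _ _ (fun j st => [/\ [/\ output st = o,
     frame 43 [:: a_mark; a_buf] m1 (memory st) & memory st v_code = code %/ Q ^ j],
     forall w, memory st (adr a_mark w) =
       if (0 < w) && (w \in digits Q code j) then stamp else m (adr a_mark w),
     uniq (buffer (memory st) (memory st v_cnt)) &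
     forall e, e \in buffer (memory st) (memory st v_cnt) =
       (e < x) && ((hash p q A X y e).+1 \in digits Q code j)])
   _ T _ (bucket_time + 100)) => //.
- by move: NTR; lia.
- move=> j [m' o'] a /= [[-> fr cE] mE uE bE].
  have bufE : buffer (store m' 43 a) (m' v_cnt) = buffer m' (m' v_cnt).
    by apply: buffer_ext => t; rewrite /= cellE.
  split; [split=> //; exact: frame_var | | by rewrite bufE | by rewrite bufE].
  by move=> w; rewrite cellE.
- move=> j [m' o'] /= b' [[_ [fv fa] _] _ _ _] _ _; rewrite fv //.
- move=> j [m' o'] /= b' [[-> fr cE] mE uE bE] jT jE.
  have [fv fa] := fr.
  have par' : holds_params m' by apply: holds_params_frame par1 fr _ _ _.
  have [_ [_ QE' _ _] _ _] := par'.
  set dg := digit Q j code.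
  (* A duplicate-free buffer of numbers below [x] has at most [x] entries, so the counter remains a
     word. *)
  have cntx : m' v_cnt <= x.
    have := uniq_leq_size uE (s2 := iota 0 x).
    rewrite size_mkseq size_iota; apply=> e; rewrite bE => /andP[ex _].
    by rewrite mem_iota.
  have dgR : dg < R by apply: modR _ _ (divR _ _ codeR).
  assign M v_digit dg; [by rewrite cE QE' | exact: dgR |].
  assign M v_code (code %/ Q ^ j.+1).
  + by rewrite cE QE' -divnMA -expnSr.
  + exact: divR _ _ codeR.
  set m2 := (X in State X o).
  have fr2 : frame 44 [:: a_mark; a_buf] m' m2 by do 2! apply: frame_var => //.
  have fr12 : frame 43 [:: a_mark; a_buf] m1 m2.
    by apply: frame_trans fr _; apply: frame_weak fr2 _ _.
  have buf2 : buffer m2 (m' v_cnt) = buffer m' (m' v_cnt).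
    by apply: buffer_ext => t; rewrite /m2 /= !cellE.
  have mark2 w : m2 (adr a_mark w) = m' (adr a_mark w) by rewrite /m2 /= !cellE.
  have stamp2 : m2 v_stamp = stamp by rewrite /m2 /= fv // /m1 /= ms.
  rewrite digits_rcons -/dg.
  apply: (run_if M (v := 0 < dg)) => //=.
  case: posnP => [dg0|dg0] /=.
    apply: run_skip => //=.
    rewrite dg0; split=> //; split=> //.
    + by move=> w; rewrite mark2 mE mem_rcons inE; case: w.
    + by rewrite buf2.
    + by move=> e; rewrite buf2 bE mem_rcons inE.
  apply: (run_if M (v := m' (adr a_mark dg) == stamp)) => //=.
    by rewrite adrE mark2 stamp2.
  have -> : (m' (adr a_mark dg) == stamp) = (dg \in digits Q code j).
    by rewrite mE dg0 /=; case: ifP => _; [rewrite eqxx | apply/negbTE].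
  case: (boolP (dg \in digits Q code j)) => dgin /=.
    have same (u : nat) : (u \in rcons (digits Q code j) dg) = (u \in digits Q code j).
      by rewrite mem_rcons inE; case: eqP => [->|].
    apply: run_skip => //=.
    split=> //; split=> //.
    + by move=> w; rewrite mark2 mE same.
    + by rewrite buf2.
    + by move=> e; rewrite buf2 bE same.
  assign M (adr a_mark dg) stamp; first exact: stampR.
  assign M v_w dg.-1; [by rewrite subn1 | by apply: leq_ltn_trans (leq_pred _) _ |].
  set m3 := (X in State X o).
  have fr3 : frame 44 [:: a_mark; a_buf] m' m3.
    by apply: frame_var => //; apply: frame_arr => //.
  have fr13 : frame 43 [:: a_mark; a_buf] m1 m3.
    by apply: frame_trans fr _; apply: frame_weak fr3 _ _.
  have par3 : holds_params m3 by apply: holds_params_frame par1 fr13 _ _ _.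
  have [fv13 fa13] := fr13.
  have dgq : dg.-1 < q by rewrite -ltnS prednK // ltn_mod.
  have buf3 : buffer m3 (m' v_cnt) = buffer m' (m' v_cnt).
    by apply: buffer_ext => t; rewrite /m3 /m2 /= !cellE.
  apply: (@run_weak R inp _ _ bucket_time _ (fun st' =>
    [/\ output st' = o, frame 47 [:: a_buf] m3 (memory st'),
        memory st' v_cnt = m' v_cnt + size (bucket x p q Inv X y dg.-1 nb) &
        buffer (memory st') (memory st' v_cnt) = buffer m3 (m' v_cnt) ++ bucket x p q Inv X y dg.-1 nb])).
  + by apply: prog_bucketP => //; [rewrite fv13 | rewrite fv13 | rewrite /m3 /m2 /= !cellE].
  + exact: leq_addr.
  move=> [m4 o4] /= b4 [-> fr4 cE4 bE4].
  have [fv4 fa4] := fr4.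
  have fr14 : frame 43 [:: a_mark; a_buf] m1 m4.
    by apply: frame_trans fr13 _; apply: frame_weak fr4 _ _ => // u; rewrite !inE => ->; rewrite orbT.
  have memb e := mem_bucket x pp q0 l20 AI X e yl dgq.
  rewrite bE4 buf3; split; last by rewrite fv4 // /m3 /m2 /= !cellE.
  split.
  + by split=> //; rewrite fv4 // /m3 /m2 /= !cellE.
  + move=> w; rewrite fa4 // /m3 /m2 /= !cellE //= mE mem_rcons inE.
    by case: (w =P dg) => [->|_] //=; rewrite dg0.
  + rewrite cat_uniq uE (bucket_uniq x pp q0 l20 AI X _ _ yl) andbT /=.
    apply/hasPn => e; rewrite memb => /andP[_ /eqP hE]; rewrite bE hE prednK //.
    by rewrite negb_and dgin orbT.
  + move=> e; rewrite mem_cat bE memb mem_rcons inE -andb_orr orbC.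
    by rewrite -eqSS prednK.
- split.
  + by split=> //; rewrite expn0 divn1.
  + by move=> w; rewrite /m1 /= !cellE // in_nil andbF.
  + by [].
  + by move=> e; rewrite /m1 /= !in_nil andbF.
- move=> [m' o'] /= b' [[-> fr cE] mE uE bE]; split=> //.
  + by apply: frame_trans fr1 _; apply: frame_weak fr _ _.
  + by move=> w; rewrite mE; case: ifP => _; [right|left].
  + apply: uniq_perm => //.
      by rewrite map_inj_uniq ?enum_uniq //; apply: val_inj.
    move=> e; rewrite bE; apply/andP/mapP => [[ex /mapP[t]]|[e' ecov ->]].
      rewrite mem_iota /= add0n => tT E; exists (Ordinal ex) => //.
      rewrite mem_enum inE; apply/existsP; exists (Ordinal tT); apply/eqP; exact: esym E.
    rewrite ltn_ord; split=> //; move: ecov; rewrite mem_enum inE => /existsP[t /eqP E].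
    by apply/mapP; exists (nat_of_ord t); rewrite ?mem_iota //= E.
- exact: leq_for_time.
Qed.

End Programs.

(** * Identification, enumeration and output of the whole family *)

Definition prog_emit_buffer : cmd :=
  For v_out (Var v_cnt) (Emit (Arr a_buf (Var v_out))).

Definition prog_identify : cmd :=
  For v_i (Var v_H)
    (v_y ::= Var v_i %% Var v_l2 ;;
     v_X ::= Var v_i %/ Var v_l2 ;;
     v_a ::= Arr a_mul (Var v_y) ;;
     v_code ::= Const 0 ;;
     For v_j (Input (Const 0))
       (v_z ::= Input (Bin OAdd (Var v_j) (Const 1)) ;;
        prog_rs ;;
        v_code ::= Var v_code * Var v_Q +
                   (((Var v_a * Var v_acc) %% Var v_p) %% Var v_q + Const 1)) ;;
     Emit (Var v_code * Var v_H + Var v_i)%prog).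

(** The construction leaves no mark above [N], so the stamp [N + 1] is fresh. *)
Definition prog_enumerate : cmd :=
  v_i ::= Input (Const 0) ;;
  v_stamp ::= Var v_N + Const 1 ;;
  prog_cover ;;
  prog_emit_buffer.

(** The stamps are [i + 1]: initial cells hold 0, and the runs before the [i]-th leave marks of at
    most [i]. *)
Definition prog_main : cmd :=
  Emit (Var v_N) ;;
  For v_i (Var v_N)
    (v_stamp ::= Var v_i + Const 1 ;;
     prog_cover ;;
     Emit (Var v_cnt) ;;
     prog_emit_buffer).

Section Programs.
Variables (R : nat) (inp : seq nat).
Hypothesis M : machine R inp.

Lemma prog_emit_bufferP (m : nat -> nat) (o : seq nat) (x : nat) : bounded_mem R m ->
  m v_cnt <= x ->
  run R inp prog_emit_buffer (State m o) (30 * x + 20) (fun st' =>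
    output st' = o ++ buffer m (m v_cnt) /\
    forall a, a != v_out -> memory st' a = m a).
Proof.
move=> b cx.
apply: (@run_for R inp M _ _ _ (fun j st => output st = o ++ buffer m j /\
    forall a, a != v_out -> memory st a = m a) _ (m v_cnt) _ (0 + 12)) => //.
- move=> j [m' o'] a /= [-> fr]; split=> // c /negbTE nc; rewrite nc; apply: fr; exact: negbT.
- by move=> j [m' o'] /= b' [_ fr] _ _; apply: fr.
- move=> j [m' o'] /= b' [-> fr] jn jE; apply: (run_emit M (v := m (adr a_buf j))) => //=.
    by rewrite adrE jE fr // adr_var.
  split=> //; split=> //.
  by rewrite /buffer -(addn1 j) /mkseq iotaD map_cat catA /= cats1.
- by rewrite cats0.
- by rewrite /=; move: (m 51) cx => c cx; lia.
Qed.

Variables (x p q l1 l2 T : nat) (A Inv : nat -> nat).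
Hypothesis pp : prime p.
Hypothesis q0 : 0 < q.
Hypothesis qp : q <= p.
Hypothesis l20 : 0 < l2.
Hypothesis AI : forall y, y < l2 -> A y * Inv y %% p = 1.

Notation H := (l1 * l2).
Notation Q := q.+1.
Notation N := (H * Q ^ T).
Notation cr := ((p + q - 1) %/ q).
Notation nb := (cr * (x %/ p).+1).
Notation D := (lg x).+1.
Notation cov := (cover_set x p q l1 l2 T A).
Notation params := (holds_params x p q l1 l2 T A Inv).
Notation ctime := (cover_time x p q T).

Hypothesis xR : 2 * x + nb + 4 * p + N + T + 4 < R.
Hypothesis H0 : 0 < H.

Let p1 : 1 < p := prime_gt1 pp.

Let NR : N + T + 4 < R.
Proof. by move: N nb xR => u v; lia. Qed.

Let HN : H <= N.
Proof. by rewrite leq_pmulr // expn_gt0. Qed.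

Let QN : Q ^ T <= N.
Proof. by rewrite leq_pmull. Qed.

Lemma size_lists (s : seq nat) (i : nat) : lists s (cov i) -> size s <= T * nb.
Proof.
by move/perm_size ->; rewrite size_map -cardE; apply: card_cover_set AI _.
Qed.

Definition identify_time (d : nat) : nat := H * (d * (60 * D + 150) + 120) + 20.

Lemma prog_identifyP (m : nat -> nat) (sn : seq nat) : bounded_mem R m -> params m ->
  inp = size sn :: sn -> size sn <= T -> all (fun e => e < x) sn ->
  run R inp prog_identify (State m [::]) (identify_time (size sn)) (fun st' =>
    output st' = [seq path_index p q l1 l2 A sn xy | xy <- iota 0 H]).
Proof.
move=> b par inpE sT sx; have [_ inpR] := M.
pose out n := [seq path_index p q l1 l2 A sn xy | xy <- iota 0 n].
apply: (@run_for R inp M _ _ _ (fun xy st => output st = out xy /\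
    frame 30 [::] m (memory st)) _ H _ (size sn * (60 * D + 150) + 100)) => //.
- by apply: leq_ltn_trans HN _; apply: leq_ltn_trans NR; rewrite -addnA leq_addr.
- by move=> xy [m' o'] a /= [-> fr]; split=> //; apply: frame_var.
- move=> xy [m' o'] /= b' [_ [fv _]] _ _; rewrite fv //.
  by case: par => _ [].
- move=> xy [m' o'] /= b' [-> fr] xyH xyE.
  set o := out xy.
  have par' : params m' by apply: holds_params_frame par fr _ _ _.
  have [[xE pE qE l2E] [TE QE HE NE] [crE nbE] AE] := par'.
  set y := xy %% l2; set X := xy %/ l2.
  have yl : y < l2 by apply: ltn_pmod.
  have xyR : xy < R by rewrite -xyE.
  assign M v_y y; [by rewrite xyE l2E | by apply: leq_ltn_trans (leq_mod _ _) xyR |].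
  assign M v_X X; [by rewrite xyE l2E | by apply: leq_ltn_trans (leq_div _ _) xyR |].
  assign M v_a (A y); [by case: (AE y yl) => -> | by case: (AE y yl) => <- |].
  assign M v_code 0; first by apply: leq_ltn_trans xyR.
  set m1 := (Y in State Y o).
  have fr1 : frame 40 [::] m' m1 by do 4! apply: frame_var => //.
  have par1 : params m1 by apply: holds_params_frame par' fr1 _ _ _.
  set hs := [seq hash p q A X y e | e <- sn].
  have hsQ : all (fun h => h.+1 < Q) hs by apply: all_hash.
  have szh : size hs = size sn by rewrite size_map.
  set tm := size sn * (60 * D + 150).
  apply: (@run_seq R inp _ _ _ _ (tm + 20) (0 + 20)
     (fun st => [/\ output st = o, frame 42 [::] m1 (memory st) & memory st v_code = encode_tuple Q hs])).
  + apply: (@run_for R inp M _ _ _ (fun j st =>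
      [/\ output st = o, frame 43 [::] m1 (memory st) & memory st v_code = encode_tuple Q (take j hs)])
      _ (size sn) _ (60 * D + 130)) => //.
    * by apply: leq_ltn_trans sT _; apply: leq_ltn_trans NR; rewrite addnAC leq_addl.
    * by move=> j [m2 o2] a /= [-> fr2 cE]; split=> //; apply: frame_var.
    * by move=> j [m2 o2] _ _ _ _; rewrite /= inpE.
    * move=> j [m2 o2] /= b2 [-> fr2 cE] jn jE.
      have [fv2 fa2] := fr2.
      have par2 : params m2 by apply: holds_params_frame par1 fr2 _ _ _.
      have [[xE2 pE2 qE2 l2E2] [TE2 QE2 HE2 NE2] _ _] := par2.
      set e := nth 0 sn j.
      have ex : e < x by apply: (allP sx); apply: mem_nth.
      have eD : e < 2 ^ D by apply: ltn_trans ex (lt_lg _).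
      assign M v_z e.
      - by rewrite jE addn1 inpE.
      - by rewrite /e (_ : nth 0 sn j = nth 0 inp j.+1) // inpE.
      set m3 := (Y in State Y o).
      have fr3 : frame 43 [::] m1 m3 by apply: frame_var.
      have par3 : params m3 by apply: holds_params_frame par1 fr3 _ _ _.
      have [[xE3 pE3 qE3 l2E3] [TE3 QE3 HE3 NE3] _ _] := par3.
      have [fv3 fa3] := fr3.
      apply: (@run_seq R inp _ _ _ _ (60 * D + 60) (0 + 40) _ _
        (@prog_rsP R inp M m3 o p X e D _ _ _ _ _ eD)) => //; rewrite ?fv3 //.
        by rewrite -addnA ltn_add2l.
      move=> [m4 o4] /= b4 [-> fr4 accE].
      have [fv4 fa4] := fr4.
      have hE : nth 0 hs j = hash p q A X y e by rewrite (nth_map 0).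
      have code4 : m4 v_code = encode_tuple Q (take j hs) by rewrite fv4 // /m3 /= cE.
      have encS : encode_tuple Q (take j.+1 hs) = encode_tuple Q (take j hs) * Q + (hash p q A X y e).+1.
        by rewrite (take_nth 0) ?szh // encode_tuple_rcons hE.
      apply: (run_store M (x := v_code) (v := encode_tuple Q (take j.+1 hs))) => //=.
      - by rewrite code4 accE !fv4 // QE3 pE3 qE3 fv3 // encS addn1.
      (* A partial code has at most [T] digits, so the accumulator stays below [Q^T <= N]. *)
      - have atake : all (fun h => h.+1 < Q) (take j.+1 hs).
          by apply/allP => h /mem_take /(allP hsQ).
        apply: leq_trans (encode_tuple_lt atake) _.
        apply: (@leq_trans (Q ^ T)).
          by rewrite leq_exp2l // size_take szh; case: ifP => _ //; lia.
        by apply: leq_trans QN _; apply: ltnW; apply: leq_ltn_trans NR; rewrite -addnA leq_addr.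
      split; last by rewrite fv4 // /m3.
      split=> //; apply: frame_var => //.
      by apply: frame_trans fr3 _; apply: frame_weak fr4 _ _.
    * by split=> //; rewrite take0.
    * move=> [m2 o2] /= b2 [-> fr2 cE]; split=> //; first by apply: frame_weak fr2 _ _.
      by rewrite cE -szh take_size.
    * exact: leq_for_time.
  + by rewrite /tm /=; move: (_ * _) => u; lia.
  move=> [m2 o2] /= b2 [-> fr2 cE].
  have [fv2 fa2] := fr2.
  have par2 : params m2 by apply: holds_params_frame par1 fr2 _ _ _.
  have [_ [_ _ HE2 _] _ _] := par2.
  have xyE2 : m2 v_i = xy by rewrite fv2.
  apply: (run_emit M (v := path_index p q l1 l2 A sn xy)) => //=.
    by rewrite cE HE2 xyE2.
  split=> //; split.
    by rewrite /o /out -(addn1 xy) iotaD map_cat cats1.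
  apply: frame_trans fr _; apply: frame_trans (frame_weak fr1 _ _) _ => //.
  exact: frame_weak fr2 _ _.
- by move=> st' b' [].
- exact: leq_for_time.
Qed.

Definition enumerate_time : nat := ctime + (30 * (T * nb) + 60).

Lemma prog_enumerateP (m : nat -> nat) (i : nat) : bounded_mem R m -> params m ->
  inp = [:: i] -> i < N -> (forall w, m (adr a_mark w) <= N) ->
  run R inp prog_enumerate (State m [::]) enumerate_time (fun st' =>
    lists (output st') (cov i)).
Proof.
move=> b par inpE iN mN.
have [_ [_ _ _ NE] _ _] := par.
have iR : i < R by apply: ltn_trans iN _; apply: leq_ltn_trans NR; rewrite -addnA leq_addr.
rewrite /enumerate_time addnA.
assign M v_i i; [by rewrite inpE | exact: iR |].
assign M v_stamp N.+1; [by rewrite NE addn1 | |].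
  by apply: leq_ltn_trans NR; rewrite -addnA -addn1 leq_add2l addnC.
set m1 := (Y in State Y [::]).
have fr1 : frame 30 [::] m m1 by do 2! apply: frame_var => //.
have par1 : params m1 by apply: holds_params_frame par fr1 _ _ _.
have mark1 w : m1 (adr a_mark w) != N.+1.
  by rewrite /m1 /= !cellE // ltn_eqF // ltnS.
apply: (@run_seq R inp _ _ _ _ ctime (30 * (T * nb) + 20) _ _
  (prog_coverP M pp q0 qp l20 AI xR [::] (m := m1) (i := i) (stamp := N.+1) _ par1 _ iN _ mark1)) => //.
  by rewrite addnA ltn_add2l.
move=> [m2 o2] /= b2 [-> fr2 _ ls].
have sz := size_lists ls; rewrite size_mkseq in sz.
apply: (run_weak (prog_emit_bufferP [::] b2 sz)) => // -[m3 o3] /= _ [-> _].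
by [].
Qed.

Definition main_time : nat := N * (ctime + (30 * (T * nb) + 70)) + 40.

Lemma prog_mainP (m : nat -> nat) : bounded_mem R m -> params m ->
  (forall w, m (adr a_mark w) = 0) ->
  run R inp prog_main (State m [::]) main_time (fun st' =>
    [/\ params (memory st'), forall w, memory st' (adr a_mark w) <= N &
        exists ss, [/\ size ss = N,
          output st' = N :: flatten [seq size l :: l | l <- ss] &
          forall i, i < N -> lists (nth [::] ss i) (cov i)]]).
Proof.
move=> b par mark0; rewrite /main_time.
have [_ [_ _ _ NE] _ _] := par.
apply: (run_emit_seq M (v := N)) => //=.
apply: (@run_for R inp M _ _ _ (fun i st =>
    [/\ frame 30 [:: a_mark; a_buf] m (memory st),
        forall w, memory st (adr a_mark w) <= i &
        exists ss, [/\ size ss = i,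
          output st = N :: flatten [seq size l :: l | l <- ss] &
          forall j, j < i -> lists (nth [::] ss j) (cov j)]])
   _ N _ (ctime + (30 * (T * nb) + 50))) => //.
- by apply: leq_ltn_trans NR; rewrite -addnA leq_addr.
- move=> i [m' o'] a /= [fr mk ss]; split=> //; first by apply: frame_var.
  by move=> w; rewrite cellE.
- by move=> i [m' o'] /= b' [[fv _] _ _] _ _; rewrite fv.
- move=> i [m' o'] /= b' [fr mk [ss [sz oE ls]]] iN iE.
  have par' : params m' by apply: holds_params_frame par fr _ _ _.
  rewrite addnA; assign M v_stamp i.+1; [by rewrite iE addn1 | |].
    by apply: leq_ltn_trans iN _; apply: leq_ltn_trans NR; rewrite -addnA leq_addr.
  set m1 := (Y in State Y o').
  have fr1 : frame 31 [::] m' m1 by apply: frame_var.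
  have par1 : params m1 by apply: holds_params_frame par' fr1 _ _ _.
  have mark1 w : m1 (adr a_mark w) != i.+1.
    by rewrite /m1 /= !cellE // ltn_eqF // ltnS.
  apply: (@run_seq R inp _ _ _ _ ctime (30 * (T * nb) + 30) _ _
    (prog_coverP M pp q0 qp l20 AI xR o' (m := m1) (i := i) (stamp := i.+1) _ par1 iE iN _ mark1)) => //.
    by rewrite addnA ltn_add2l.
  move=> [m2 o2] /= b2 [-> fr2 mk2 ls2].
  have sz2 := size_lists ls2; rewrite size_mkseq in sz2.
  apply: (run_emit_seq M (v := m2 v_cnt)) => //=.
  apply: (run_weak (prog_emit_bufferP _ b2 sz2)); first by rewrite leq_add2l.
  move=> [m3 o3] /= _ [-> fr3].
  have fr23 : frame 31 [::] m2 m3.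
    split=> [j j31 j104|k j k8 _]; apply: fr3; last by rewrite adr_var.
    by rewrite ltn_eqF // ltnW.
  have fr03 : frame 31 [:: a_mark; a_buf] m' m3.
    apply: frame_trans (frame_weak fr1 _ _) _ => //.
    apply: frame_trans (frame_weak fr2 _ _) _ => //.
    exact: frame_weak fr23 _ _.
  split; last by have [fv _] := fr03; rewrite fv.
  split.
  + by apply: frame_trans fr _; apply: frame_weak fr03 _ _.
  + move=> w; rewrite fr3 ?adr_var //.
    case: (mk2 w) => ->; last by [].
    by rewrite /m1 /= !cellE // (leq_trans (mk w)).
  + exists (rcons ss (buffer m2 (m2 v_cnt))); split.
    * by rewrite size_rcons sz.
    * by rewrite map_rcons flatten_rcons oE size_mkseq cat_rcons.
    * move=> j; rewrite ltnS leq_eqVlt => /orP[/eqP ->|ji].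
        by rewrite nth_rcons sz ltnn eqxx.
      by rewrite nth_rcons sz ji; apply: ls.
- split=> //; first by move=> w; rewrite /= mark0.
  by exists [::].
- move=> [m' o'] /= b' [fr mk [ss [sz oE ls]]]; split=> //.
    exact: holds_params_frame par fr _ _ _.
  by exists ss.
- rewrite (addnA ctime (30 * (T * nb)) 50) (addnA ctime (30 * (T * nb)) 70).
  exact: leq_for_time.
Qed.

End Programs.

(** * Programs for the numerical parameters *)

Notation t_in := 20 (only parsing).
Notation t_out := 21 (only parsing).
Notation t_pow := 22 (only parsing).
Notation t_ok := 23 (only parsing).
Notation t_d := 24 (only parsing).
Notation t_thr := 25 (only parsing).

Definition prog_lg : cmd :=
  t_out ::= Const 0 ;;
  While (Const 1 < Var t_in)%prog
    (t_in ::= Var t_in %/ Const 2 ;;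
     t_out ::= Var t_out + Const 1).

Definition prog_least_exp : cmd :=
  t_out ::= Const 1 ;;
  t_pow ::= Var t_in ;;
  While (Var t_pow < Var v_x)%prog
    (t_pow ::= Var t_pow * Var t_in ;;
     t_out ::= Var t_out + Const 1).

(** Trial division by all smaller numbers costs about [p * p] in total, which [p_sqr_le] shows to be
    within the budget of the construction. *)
Definition prog_next_prime : cmd :=
  t_ok ::= Const 0 ;;
  While (Var t_ok == Const 0)%prog
    (t_out ::= Var t_out + Const 1 ;;
     t_ok ::= Const 1 ;;
     For t_d (Var t_out)
       (If (Const 1 < Var t_d)%prog
          (If ((Var t_out %% Var t_d) == Const 0)%prog
             (t_ok ::= Const 0)
             Skip)
          Skip)).

(* The power is computed only until it exceeds the threshold, so that it stays
   a word. *)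
Definition prog_power_test : cmd :=
  t_pow ::= Const 1 ;;
  For t_d (Var v_K + Const 1)%prog
    (If (Var t_thr < Var t_pow)%prog
       Skip
       (t_pow ::= Var t_pow * Var v_k)) ;;
  t_out ::= (Var t_thr < Var t_pow).

Section Programs.
Variables (R : nat) (inp : seq nat).
Hypothesis M : machine R inp.

Let R104 : 104 < R := R_gt104 M.

Lemma prog_lgP (m : nat -> nat) (o : seq nat) (z : nat) : bounded_mem R m ->
  m t_in = z ->
  run R inp prog_lg (State m o) (lg z * 20 + 20) (fun st' =>
    [/\ output st' = o, frame 20 [::] m (memory st') & memory st' t_out = lg z]).
Proof.
move=> b mz; assign M t_out 0; first by lia.
apply: (@run_while R inp M _ _ (fun j st =>
  [/\ output st = o, frame 20 [::] m (memory st), lg (memory st t_in) = j &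
      memory st t_out + j = lg z]) _ (lg z) _ (0 + 15)) => //=.
- move=> j [m' o'] /= b' [-> fr lE oE]; case: ltnP => z1; last first.
    left; split=> //; split=> //; rewrite -oE -lE.
    suff -> : lg (m' 20) = 0 by rewrite addn0.
    by apply/eqP; rewrite /lg trunc_log_eq0 z1.
  have lS : lg (m' 20) = (lg (m' 20 %/ 2)).+1 by rewrite divn2 /lg -trunc_log2S.
  right; rewrite -lE lS; split=> //=.
  assign M t_in (m' 20 %/ 2); first by apply: leq_ltn_trans (leq_div _ _) _.
  have oS : m' 21 + 1 + lg (m' 20 %/ 2) = lg z by rewrite -oE -lE lS -addnA add1n.
  apply: (run_store M (x := t_out) (v := m' 21 + 1)) => //=.
    apply: (@leq_ltn_trans (lg z)); first by rewrite -oS leq_addr.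
    rewrite -mz; apply: leq_ltn_trans (b t_in).
    have [->|z0] := posnP (m 20); first by [].
    by apply: ltnW; apply: leq_trans (ltn_expl _ (isT : 1 < 2)) (trunc_logP _ z0).
  by split=> //; do 2! apply: frame_var => //.
- by split=> //; [apply: frame_var | rewrite mz].
- by move: (lg z) => l; lia.
Qed.

(** A power is multiplied by [c] only while it is below [x], so no power computed in the loop
    exceeds [x * c]. *)
Lemma prog_least_expP (m : nat -> nat) (o : seq nat) (x c k : nat) : bounded_mem R m ->
  m t_in = c -> m v_x = x -> least_exp c x k -> x * c < R -> k < R ->
  run R inp prog_least_exp (State m o) (k * 25 + 30) (fun st' =>
    [/\ output st' = o, frame 20 [::] m (memory st') & memory st' t_out = k]).
Proof.
move=> b mc mx [k0 xk kmin] xcR kR.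
assign M t_out 1; first by lia.
assign M t_pow c; first by rewrite -mc.
apply: (@run_while R inp M _ _ (fun j st =>
  [/\ output st = o, frame 20 [::] m (memory st), memory st t_in = c,
      memory st t_pow = c ^ memory st t_out &
      0 < memory st t_out /\ memory st t_out + j = k]) _ k.-1 _ (0 + 15)) => //=.
- move=> j [m' o'] /= b' [-> fr cE pE [o0 oE]]; have [fv _] := fr.
  have xE : m' v_x = x by rewrite fv.
  rewrite pE xE; case: ltnP => cx; last first.
    left; split=> //; split=> //; apply/eqP; rewrite -oE -[X in X == _]addn0 eqn_add2l eq_sym.
    case: j oE => // j oE; have := kmin (m' 21) o0; rewrite -oE addnS ltnS leq_addr => /(_ isT).
    by rewrite ltnNge cx.
  have j0 : 0 < j.
    case: j oE => // oE; rewrite addn0 in oE.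
    by move: cx; rewrite oE ltnNge xk.
  right; split=> //.
  assign M t_pow (c ^ (m' 21).+1); [by rewrite pE cE expnSr | |].
    by apply: leq_ltn_trans xcR; rewrite expnSr leq_mul2r (ltnW cx) orbT.
  apply: (run_store M (x := t_out) (v := (m' 21).+1)) => //=; first by rewrite addn1.
    by apply: leq_ltn_trans kR; rewrite -oE -addn1 leq_add2l.
  split=> //; first by do 2! apply: frame_var => //.
  by rewrite addSnnS prednK.
- split=> //; last by rewrite add1n prednK.
  by do 2! apply: frame_var => //.
- by case: k k0 {xk kmin kR} => // k _; rewrite /=; lia.
Qed.

Definition trial (c j : nat) : bool := ~~ has (fun d => (1 < d) && (d %| c)) (iota 0 j).

Lemma prime_trial (c : nat) : 1 < c -> trial c c = prime c.
Proof.
move=> c1; apply/idP/idP => [/hasPn tr|pc].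
  apply/primeP; split=> // d dc; have d0 : 0 < d by apply: dvdn_gt0 dc; apply: ltnW.
  have dle := dvdn_leq (ltnW c1) dc.
  case: (ltnP 1 d) => d1; last by rewrite eqn_leq d1 d0.
  case: (ltnP d c) => dc'; last by rewrite [d == c]eqn_leq dle dc' orbT.
  by have := tr d; rewrite mem_iota /= add0n d1 dc => /(_ dc').
apply/hasPn => d; rewrite mem_iota /= add0n => dc; rewrite negb_and -leqNgt.
case: leqP => //= d1; apply/negP => dvd.
have [_ /(_ d dvd)] := primeP pc.
by rewrite !eqn_leq leqNgt d1 /= [c <= d]leqNgt dc andbF.
Qed.

Lemma prog_next_primeP (m : nat -> nat) (o : seq nat) (X p : nat) : bounded_mem R m ->
  m t_out = X -> 0 < X -> next_prime X p -> p < R ->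
  run R inp prog_next_prime (State m o) ((p - X) * (p * 40 + 50) + 20) (fun st' =>
    [/\ output st' = o, frame 20 [::] m (memory st') & memory st' t_out = p]).
Proof.
move=> b mX X0 [pp Xp pmin] pR; assign M t_ok 0; first by lia.
apply: (@run_while R inp M _ _ (fun j st =>
  [/\ output st = o, frame 20 [::] m (memory st), memory st t_ok = (j == 0),
      memory st t_out + j = p & X <= memory st t_out]) _ (p - X) _ (p * 40 + 40)) => //=.
- move=> j [m' o'] /= b' [-> fr okE oE Xo].
  rewrite okE; case: j okE oE => [|j] okE oE /=.
    by left; split=> //; split=> //; rewrite -oE addn0.
  right; split=> //; set c := (m' 21).+1.
  have cp : c <= p by rewrite -oE addnS ltnS leq_addr.
  have c1 : 1 < c by rewrite ltnS; apply: leq_trans X0 Xo.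
  have cR : c < R by apply: leq_ltn_trans cp pR.
  assign M t_out c; [by rewrite addn1 | exact: cR |].
  assign M t_ok 1; first by lia.
  set m1 := (Y in State Y o).
  have fr1 : frame 20 [::] m m1 by do 2! apply: frame_var => //.
  apply: (@run_for R inp M _ _ _ (fun d st =>
    [/\ output st = o, frame 20 [::] m (memory st), memory st t_out = c &
        memory st t_ok = trial c d]) _ c _ (0 + 25)) => //.
  + move=> d [m2 o2] a /= [-> fr2 cE tE]; split=> //; exact: frame_var.
  + by move=> d [m2 o2] /= _ [].
  + move=> d [m2 o2] /= b2 [-> fr2 cE tE] dc dE.
    have trS : trial c d.+1 = trial c d && ~~ ((1 < d) && (d %| c)).
      by rewrite /trial -(addn1 d) iotaD has_cat /= add0n orbF negb_or.
    apply: (run_if M (v := 1 < d)) => //=; first by rewrite dE.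
    move: trS; case: (ltnP 1 d) => d1 /= trS; last first.
      by apply: run_skip => //=; rewrite trS andbT.
    apply: (run_if M (v := d %| c)) => //=; first by rewrite cE dE.
    move: trS; case: (boolP (d %| c)) => dvd /= trS; last first.
      by apply: run_skip => //=; rewrite trS andbT.
    apply: (run_store M (x := t_ok) (v := 0)) => //=; first by lia.
    by rewrite trS andbF; split=> //; split=> //; apply: frame_var.
  + move=> [m2 o2] /= b2 [-> fr2 cE tE]; split=> //.
    * rewrite tE prime_trial //; congr nat_of_bool.
      apply/idP/eqP => [pc|j0]; last by rewrite /c; move: oE; rewrite j0 addn1 => ->.
      case: j oE {okE} => // j oE; exfalso.
      have Xc : X < c by rewrite ltnS.
      have cp' : c < p by rewrite -oE /c !addnS !ltnS leq_addr.
      by have := pmin c Xc cp'; rewrite pc.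
    * by rewrite cE -oE addnS.
    * by rewrite cE leqW.
  + apply: (@leq_trans (p * 40 + 12)).
      by rewrite -addnA; apply: leq_add => //; exact: leq_mul cp (leqnn 40).
    by rewrite leq_add2l.
- split=> //; [by apply: frame_var | | by rewrite mX subnKC // ltnW | by rewrite mX].
  by rewrite subn_eq0 leqNgt Xp.
- move: (p - X) (p * 40) => u v.
  have -> : (4 + (v + 40)).+1 = v + 45 by lia.
  by nia.
Qed.

Lemma prog_power_testP (m : nat -> nat) (o : seq nat) (K k thr : nat) : bounded_mem R m ->
  m v_K = K -> m v_k = k -> m t_thr = thr -> 0 < k -> K.+1 < R -> thr * k < R -> k < R ->
  run R inp prog_power_test (State m o) (K.+1 * 40 + 50) (fun st' =>
    [/\ output st' = o, frame 20 [::] m (memory st') & memory st' t_out = (thr < k ^ K.+1)]).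
Proof.
move=> b mK mk mthr k0 KR tkR kR; assign M t_pow 1; first by lia.
set m1 := (Y in State Y o).
apply: (@run_seq R inp _ _ _ _ (K.+1 * 40 + 20) (0 + 15) (fun st =>
    [/\ output st = o, frame 20 [::] m (memory st), memory st t_thr = thr &
        (thr < memory st t_pow) = (thr < k ^ K.+1)])).
(* Below the threshold the cell holds the exact power. Once above it the cell is frozen, and
   [k >= 1] keeps the true power above the threshold too. *)
- apply: (@run_for R inp M _ _ _ (fun j st =>
    [/\ output st = o, frame 20 [::] m (memory st), memory st t_thr = thr &
        if memory st t_pow <= thr then memory st t_pow = k ^ j else thr < k ^ j]) _ K.+1 _ (0 + 20)) => //.
  + move=> j [m2 o2] a /= [-> fr2 tE pE]; split=> //; exact: frame_var.
  + by move=> j [m2 o2] /= _ [_ [fv _] _ _] _ _; rewrite fv // mK addn1.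
  + move=> j [m2 o2] /= b2 [-> fr2 tE pE] jK jE; have [fv _] := fr2.
    apply: (run_if M (v := thr < m2 t_pow)) => //=; first by rewrite tE.
    move: pE; case: (leqP (m2 t_pow) thr) => pthr pE /=; last first.
      apply: run_skip => //=; split=> //; split=> //; rewrite leqNgt pthr /=.
      by apply: leq_trans pE _; rewrite leq_pexp2l.
    apply: (run_store M (x := t_pow) (v := k ^ j.+1)) => //=.
    * by rewrite pE fv // mk expnSr.
    * by apply: leq_ltn_trans tkR; rewrite expnSr leq_mul2r -pE pthr orbT.
    split=> //; split=> //; [by apply: frame_var | by case: leqP].
  + split=> //; first by apply: frame_var.
    by case: leqP.
  + move=> [m2 o2] /= b2 [-> fr2 tE pE]; split=> //.
    by move: pE; case: (leqP (m2 t_pow) thr) => [h <-|h ->] //; rewrite ltnNge h.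
  + exact: leq_for_time.
- by rewrite -addnA ltn_add2l.
move=> [m2 o2] /= b2 [-> fr2 tE pE].
apply: (run_store M (x := t_out) (v := thr < k ^ K.+1)) => //=.
- by rewrite tE pE.
- by apply: leq_ltn_trans (leq_b1 _) _; apply: ltn_trans R104.
by split=> //; apply: frame_var.
Qed.

End Programs.

(** * Greedy multipliers and their inverses *)

Notation g_y := 30 (only parsing).
Notation g_a := 31 (only parsing).
Notation g_best := 32 (only parsing).
Notation g_arg := 33 (only parsing).
Notation g_cand := 34 (only parsing).
Notation g_d := 36 (only parsing).
Notation g_u := 37 (only parsing).
Notation g_u' := 38 (only parsing).
Notation g_sum := 39 (only parsing).

Definition prog_for_coll (c : cmd) : cmd :=
  For g_d (Var v_p * Var v_p)%prog
    (g_u ::= Var g_d %/ Var v_p ;;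
     g_u' ::= Var g_d %% Var v_p ;;
     If (Var g_u == Var g_u')%prog
       Skip
       (If (((Var g_cand * Var g_u) %% Var v_p) %% Var v_q ==
            ((Var g_cand * Var g_u') %% Var v_p) %% Var v_q)%prog
          c
          Skip)).

Definition prog_coll_weight : cmd :=
  g_sum ::= Const 0 ;;
  prog_for_coll (g_sum ::= Var g_sum + Arr a_weight (Var g_d)).

Definition prog_double_coll : cmd :=
  prog_for_coll (Store (Adr a_weight (Var g_d))
                       (Bin OMul (Const 2) (Arr a_weight (Var g_d)))).

(** Multipliers are nonzero, so [g_arg = 0] signals that no candidate has been examined yet. The sum
    of the two tests serves as a disjunction. *)
Definition prog_greedy : cmd :=
  For g_d (Var v_p * Var v_p)%prog (Store (Adr a_weight (Var g_d)) (Const 1)) ;;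
  For g_y (Var v_l2)
    (g_arg ::= Const 0 ;;
     g_best ::= Const 0 ;;
     For g_a (Var v_p)
       (If (Var g_a == Const 0)%prog
          Skip
          (g_cand ::= Var g_a ;;
           prog_coll_weight ;;
           If ((Var g_arg == Const 0) + (Var g_sum < Var g_best))%prog
             (g_best ::= Var g_sum ;;
              g_arg ::= Var g_a)
             Skip)) ;;
     g_cand ::= Var g_arg ;;
     prog_double_coll ;;
     Store (Adr a_mul (Var g_y)) (Var g_arg)).

Definition prog_inverse : cmd :=
  For g_y (Var v_l2)
    (For g_d (Var v_p)
       (If ((Arr a_mul (Var g_y) * Var g_d) %% Var v_p == Const 1)%prog
          (Store (Adr a_inv (Var g_y)) (Var g_d))
          Skip)).

Lemma inverse_exists (p a : nat) : prime p -> 0 < a < p -> exists2 d, d < p & a * d %% p = 1.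
Proof.
move=> pp /andP[a0 ap]; have p1 := prime_gt1 pp; have p0 := ltnW p1.
have [c cp] := Bezoutl a p0.
have -> : gcdn p a = 1.
  by apply/eqP; rewrite -/(coprime p a) prime_coprime // gtnNdvd.
move=> dv; exists ((p - c) %% p); first by rewrite ltn_mod.
rewrite modnMmr; apply/eqP; rewrite -[1](modn_small p1) -(eqn_modDr (c * a)).
rewrite (mulnC a) -mulnDl subnK ?(ltnW cp) // mulnC modnMl.
by rewrite eq_sym; move: dv; rewrite /dvdn.
Qed.

Section Programs.
Variables (R : nat) (inp : seq nat).
Hypothesis M : machine R inp.
Let R104 : 104 < R := R_gt104 M.

Variables (p q : nat).
Hypothesis pp : prime p.
Hypothesis q0 : 0 < q.
Hypothesis ppR : p * p < R.
Hypothesis qR : q < R.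

Let p1 : 1 < p := prime_gt1 pp.
Let p0 : 0 < p := ltnW p1.

Let pR : p < R.
Proof. by apply: leq_ltn_trans ppR; rewrite leq_pmulr. Qed.

Definition pairs_time (t : nat) : nat := p * p * (t + 100) + 20.

(* The body c may only touch the sum and the weights; I d holds before pair d. *)
Lemma prog_for_collP (c : cmd) (t : nat) (m : nat -> nat) (o : seq nat) (a : nat)
    (I : nat -> (nat -> nat) -> Prop) :
  bounded_mem R m -> m v_p = p -> m v_q = q -> m g_cand = a ->
  (forall d m' j v, I d m' -> 35 < j < 39 -> I d (store m' j v)) ->
  (forall d m', bounded_mem R m' -> d < p * p -> m' g_d = d ->
     frame 36 [:: a_weight] m m' -> I d m' ->
     if coll p q a d then
       run R inp c (State m' o) (t + 30) (fun st' =>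
         [/\ output st' = o, frame 39 [:: a_weight] m' (memory st') & I d.+1 (memory st')])
     else I d.+1 m') ->
  I 0 m ->
  run R inp (prog_for_coll c) (State m o) (pairs_time t) (fun st' =>
    [/\ output st' = o, frame 36 [:: a_weight] m (memory st') & I (p * p) (memory st')]).
Proof.
move=> b mp mq ma Ist body I0.
apply: (@run_for R inp M _ _ _ (fun d st =>
   [/\ output st = o, frame 36 [:: a_weight] m (memory st) & I d (memory st)])
   _ (p * p) _ (t + 80)) => //.
- by move=> d [m' o'] v /= [-> fr Id]; split=> //; [apply: frame_var | apply: Ist].
- by move=> d [m' o'] /= b' [_ [fv _] _] _ _; rewrite fv // mp.
- move=> d [m' o'] /= b' [-> fr Id] dp dE; have [fv fa] := fr.
  have pE : m' v_p = p by rewrite fv.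
  have qE : m' v_q = q by rewrite fv.
  have aE : m' g_cand = a by rewrite fv.
  have dR : d < R by rewrite -dE.
  assign M g_u (d %/ p); [by rewrite dE pE | by apply: leq_ltn_trans (leq_div _ _) dR |].
  assign M g_u' (d %% p); [by rewrite dE pE | by apply: leq_ltn_trans (leq_mod _ _) dR |].
  set m1 := (Y in State Y o).
  have b1 : bounded_mem R m1 by [].
  have fr1 : frame 36 [:: a_weight] m m1 by do 2! apply: frame_var => //.
  have I1 : I d m1 by apply: (Ist) => //; apply: (Ist).
  have body1 := body d m1 b1 dp dE fr1 I1.
  apply: (run_if M (v := d %/ p == d %% p)) => //=.
  move: body1; rewrite /coll; case: eqP => /= _ body1.
    by apply: run_skip => //=.
  apply: (run_if M (v := inner p q a (d %/ p) == inner p q a (d %% p))) => //=.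
    by rewrite /m1 /= aE pE qE.
  move: body1; case: eqP => /= _ body1; last by apply: run_skip => //=.
  apply: (run_weak body1); first by rewrite leq_add2l.
  move=> [m2 o2] /= b2 [-> fr2 I2]; split; last by have [-> //] := fr2.
  split=> //; apply: frame_trans fr1 _; exact: frame_weak fr2 _ _.
- exact: leq_for_time.
Qed.

Lemma prog_coll_weightP (m : nat -> nat) (o : seq nat) (a : nat) : bounded_mem R m ->
  m v_p = p -> m v_q = q -> m g_cand = a ->
  total_weight p (fun d => m (adr a_weight d)) < R ->
  run R inp prog_coll_weight (State m o) (pairs_time 0 + 10) (fun st' =>
    [/\ output st' = o, frame 36 [::] m (memory st') &
        memory st' g_sum = coll_weight p q (fun d => m (adr a_weight d)) a]).
Proof.
move=> b mp mq ma tR; assign M g_sum 0; first by lia.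
set W := fun d => m (adr a_weight d) in tR *.
set m1 := (Y in State Y o).
pose S d := \sum_(0 <= i < d | coll p q a i) W i.
(* Partial sums over colliding pairs are at most the total weight, which is assumed to be a word. *)
have SR d : d <= p * p -> S d < R.
  move=> dp; apply: leq_ltn_trans tR; rewrite /S /total_weight (@big_cat_nat _ _ _ d 0 (p * p)) //=.
  apply: leq_trans (leq_addr _ _); rewrite big_mkcond [X in _ <= X]big_mkcond.
  by apply: leq_sum => i _; rewrite /coll; case: (_ != _) => //=; case: ifP.
apply: (@run_weak R inp _ _ (pairs_time 0) _ (fun st' =>
    [/\ output st' = o, frame 36 [:: a_weight] m1 (memory st') &
      (fun d m' => [/\ m' g_sum = S d & forall i, m' (adr a_weight i) = W i]) (p * p) (memory st')])).
- apply: (@prog_for_collP _ 0 m1 o a (fun d m' =>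
    [/\ m' g_sum = S d & forall i, m' (adr a_weight i) = W i])) => //.
  + move=> d m' j v [sE wE] /andP[j1 j2]; split=> [/=|i].
      by case: eqP => // E; rewrite -E in j2.
    by rewrite /= adr_var ?wE //; apply: ltn_trans j2 _.
  + move=> d m' b' dp dE fr [sE wE].
    have SS : S d.+1 = S d + if coll p q a d then W d else 0.
      by rewrite /S big_mkcond big_nat_recr //= -big_mkcond.
    case: ifP SS => _ SS; last by rewrite SS addn0.
    apply: (run_store M (x := g_sum) (v := S d.+1)) => //=.
    * by rewrite adrE dE sE wE SS.
    * exact: SR.
    by split=> //; [apply: frame_var | split=> // i; rewrite /= cellE].
  + by rewrite /S big_geq //; split=> // i; rewrite /m1 /= cellE.
- by apply: leq_addr.
move=> [m2 o2] /= b2 [-> fr [sE wE]]; split=> //.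
have fr' : frame 36 [:: a_weight] m m2.
  by apply: frame_trans fr; apply: frame_var.
have [fv fa] := fr'; split=> // k i k8 _.
case: (k =P 2) => [->|k2]; first by rewrite wE.
by apply: fa => //; rewrite inE; apply/eqP.
Qed.

Lemma prog_double_collP (m : nat -> nat) (o : seq nat) (a : nat) : bounded_mem R m ->
  m v_p = p -> m v_q = q -> m g_cand = a ->
  total_weight p (double_coll p q a (fun d => m (adr a_weight d))) < R ->
  run R inp prog_double_coll (State m o) (pairs_time 0) (fun st' =>
    [/\ output st' = o, frame 36 [:: a_weight] m (memory st') &
        forall d, d < p * p ->
          memory st' (adr a_weight d) = double_coll p q a (fun d => m (adr a_weight d)) d]).
Proof.
move=> b mp mq ma tR.
set W := fun d => m (adr a_weight d) in tR *.
apply: (@run_weak R inp _ _ (pairs_time 0) _ (fun st' =>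
    [/\ output st' = o, frame 36 [:: a_weight] m (memory st') &
      (fun d m' => forall i, m' (adr a_weight i) = if i < d then double_coll p q a W i else W i)
        (p * p) (memory st')])) => //.
- apply: (@prog_for_collP _ 0 m o a (fun d m' =>
    forall i, m' (adr a_weight i) = if i < d then double_coll p q a W i else W i)) => //.
  + move=> d m' j v wE /andP[j1 j2] i.
    by rewrite /= adr_var ?wE //; apply: ltn_trans j2 _.
  + move=> d m' b' dp dE fr wE.
    have wS i : (if i < d.+1 then double_coll p q a W i else W i) =
       if i == d then double_coll p q a W d else if i < d then double_coll p q a W i else W i.
      by rewrite ltnS leq_eqVlt; case: eqP => [->|].
    case: ifP => cl; last first.
      by move=> i; rewrite wS wE; case: eqP => [->|//]; rewrite ltnn /double_coll cl.
    have dv : double_coll p q a W d = 2 * W d by rewrite /double_coll cl.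
    apply: (run_store M (x := adr a_weight d) (v := 2 * W d)) => //=.
    * by rewrite adrE dE.
    * by rewrite adrE dE wE ltnn.
    * rewrite -dv; apply: leq_ltn_trans tR; apply: (@leq_total_weight p (double_coll p q a W)) => //.
      by case/andP: cl.
    split=> //; first by apply: frame_arr.
    by move=> i; rewrite /= adr_adr //= wS dv; case: eqP => // _; rewrite wE.
- move=> [m2 o2] /= b2 [-> fr wE]; split=> // d dp.
  by rewrite wE dp.
Qed.

Lemma eq_total (W W' : nat -> nat) : (forall d, d < p * p -> W d = W' d) ->
  total_weight p W = total_weight p W'.
Proof.
move=> E; rewrite /total_weight big_nat_cond [RHS]big_nat_cond.
by apply: eq_bigr => d /andP[/andP[_ dp] _]; apply: E.
Qed.

Definition agreement (A : nat -> nat) (y d : nat) : nat :=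
  \sum_(i < y) (inner p q (A i) (d %/ p) == inner p q (A i) (d %% p)).

Variables (b0 s : nat).
Hypothesis b00 : 0 < b0.
Hypothesis qE : q = 48 * b0.
Hypothesis ps : p <= 2 ^ s.
Hypothesis wR : 2 ^ (3 * s) < R.

Definition greedy_time : nat :=
  12 * b0 * s * (p * (pairs_time 0 + 80) + pairs_time 0 + 100) + (p * p * 40 + 40).

(** The weight of a pair is 2 to the number of its collisions so far, and the potential [pot] bounds
    the total weight by [2^(3s)]. This bound serves twice: it limits the collisions of each pair,
    and it keeps all weights below [R] while the program runs. *)
Lemma prog_greedyP (m : nat -> nat) (o : seq nat) : bounded_mem R m ->
  m v_p = p -> m v_q = q -> m v_l2 = 12 * b0 * s ->
  run R inp prog_greedy (State m o) greedy_time (fun st' =>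
    [/\ output st' = o, frame 30 [:: a_mul; a_weight] m (memory st'),
        forall y, y < 12 * b0 * s -> 0 < memory st' (adr a_mul y) < p &
        forall u u', u < p -> u' < p -> u != u' ->
          4 * b0 * \sum_(y < 12 * b0 * s)
            (inner p q (memory st' (adr a_mul y)) u == inner p q (memory st' (adr a_mul y)) u')
          <= 12 * b0 * s]).
Proof.
move=> b mp mq ml.
set l2 := 12 * b0 * s in ml *.
have l2R : l2 < R by rewrite -ml.
pose weight (m' : nat -> nat) d := m' (adr a_weight d).
pose pot y W := q ^ y * total_weight p W <= (q + 2) ^ y * (p * p).
have pot_bound y W : y <= l2 -> pot y W -> total_weight p W <= 2 ^ (3 * s).
  by move=> yl; rewrite /pot qE; apply: potential_bound.
apply: (@run_seq R inp _ _ _ _ (p * p * 40 + 20)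
   (l2 * (p * (pairs_time 0 + 80) + pairs_time 0 + 100) + 15) (fun st =>
   [/\ output st = o, frame 36 [:: a_weight] m (memory st) &
       forall d, d < p * p -> memory st (adr a_weight d) = 1])).
- apply: (@run_for R inp M _ _ _ (fun d st =>
     [/\ output st = o, frame 36 [:: a_weight] m (memory st) &
       forall i, i < d -> memory st (adr a_weight i) = 1]) _ (p * p) _ (0 + 20)) => //.
  + move=> d [m' o'] v /= [-> fr wE]; split=> //; first by apply: frame_var.
    by move=> i id; rewrite cellE // wE.
  + by move=> d [m' o'] /= b' [_ [fv _] _] _ _; rewrite fv // mp.
  + move=> d [m' o'] /= b' [-> fr wE] dp dE.
    apply: (run_store M (x := adr a_weight d) (v := 1)) => //=.
    * by rewrite adrE dE.
    * by apply: ltn_trans R104.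
    rewrite cellE //; split=> //; split=> //; first by apply: frame_arr.
    move=> i; rewrite ltnS leq_eqVlt adr_adr //= => /orP[->//|id].
    by rewrite wE //; case: ifP.
  + exact: leq_for_time.
- by rewrite /greedy_time -/l2; move: (l2 * _) (_ * 40) => u v; lia.
move=> [m1 o1] /= b1 [-> fr1 w1].
have [fv1 fa1] := fr1.
apply: (@run_for R inp M _ _ _ (fun y st =>
    [/\ output st = o, frame 30 [:: a_mul; a_weight] m1 (memory st),
        forall i, i < y -> 0 < memory st (adr a_mul i) < p, pot y (weight (memory st)) &
        forall d, d < p * p -> d %/ p != d %% p ->
          memory st (adr a_weight d) = 2 ^ agreement (fun i => memory st (adr a_mul i)) y d])
   _ l2 _ (p * (pairs_time 0 + 80) + pairs_time 0 + 85)) => //.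
- move=> y [m' o'] v /= [-> fr A0 P W]; split=> //; first by apply: frame_var.
  + by move=> i iy; rewrite cellE // A0.
  + rewrite /pot (@eq_total _ (weight m')) // => d _.
    by rewrite /weight /= cellE.
  + move=> d dp ne; rewrite cellE // W //; congr (2 ^ _).
    by apply: eq_bigr => i _; rewrite cellE.
- by move=> y [m' o'] /= b' [_ [fv _] _ _ _] _ _; rewrite fv // fv1.
- move=> y [m' o'] /= b' [-> fr A0 P W] yl yE; have [fv fa] := fr.
  have totR : total_weight p (weight m') < R.
    by apply: leq_ltn_trans wR; apply: pot_bound P; apply: ltnW.
  assign M g_arg 0; first by lia.
  assign M g_best 0; first by lia.
  set m2 := (Y in State Y o).
  have pE2 : m2 v_p = p by rewrite /m2 /= fv // fv1.
  have qE2 : m2 v_q = q by rewrite /m2 /= fv // fv1.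
  have b2 : bounded_mem R m2 by [].
  have w2 d : m2 (adr a_weight d) = weight m' d by rewrite /m2 /= !cellE.
  apply: (@run_seq R inp _ _ _ _ (p * (pairs_time 0 + 80) + 20) (pairs_time 0 + 40) (fun st =>
     [/\ output st = o, frame 31 [::] m2 (memory st), 0 < memory st g_arg < p &
         forall a, 0 < a < p -> coll_weight p q (weight m') (memory st g_arg) <= coll_weight p q (weight m') a])).
  (* Before iteration [j] the candidates [1, ..., j-1] have been examined. Hence [g_arg] is 0
     exactly for [j <= 1], and [maxn 1 j] bounds it in both cases. *)
  + apply: (@run_for R inp M _ _ _ (fun j st =>
      [/\ output st = o, frame 31 [::] m2 (memory st),
         (memory st g_arg == 0) = (j <= 1),
         memory st g_arg < maxn 1 j &
         forall a, 0 < a < j ->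
           memory st g_best = coll_weight p q (weight m') (memory st g_arg) /\
           memory st g_best <= coll_weight p q (weight m') a]) _ p _ (pairs_time 0 + 60)) => //.
    * by move=> j [m3 o3] v /= [-> fr3 z3 lt3 best3]; split=> //; apply: frame_var.
    * by move=> j [m3 o3] /= b3 [_ [fv3 _] _ _ _] _ _; rewrite fv3.
    * move=> j [m3 o3] /= b3 [-> fr3 z3 lt3 best3] jp jE.
      have [fv3 fa3] := fr3.
      apply: (run_if M (v := j == 0)) => //=; first by rewrite jE.
      case: (posnP j) => [j0|j0] /=.
        apply: run_skip => //=; split=> //; split=> //; rewrite ?j0 //; last by move=> a; lia.
        + by rewrite z3 j0.
        + by move: lt3; rewrite j0.
      have jR : j < R by rewrite -jE.
      assign M g_cand j; first exact: jR.
      set m4 := (Y in State Y o).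
      have b4 : bounded_mem R m4 by [].
      have fr4 : frame 31 [::] m2 m4 by apply: frame_var.
      have [fv4 fa4] := fr4.
      have wE4 : total_weight p (fun d => m4 (adr a_weight d)) = total_weight p (weight m').
        by apply: eq_total => d _; rewrite fa4.
      have cE4 a : coll_weight p q (fun d => m4 (adr a_weight d)) a = coll_weight p q (weight m') a.
        by apply: eq_bigr => d _; rewrite fa4.
      apply: (@run_seq R inp _ _ _ _ (pairs_time 0 + 10) (0 + 30) _ _
        (@prog_coll_weightP m4 o j _ _ _ _ _)) => //; rewrite ?fv4 ?wE4 //.
        by rewrite -addnA ltn_add2l.
      move=> [m5 o5] /= b5 [-> fr5 sE]; have [fv5 fa5] := fr5.
      have argE : m5 g_arg = m3 g_arg by rewrite fv5.
      have bestE : m5 g_best = m3 g_best by rewrite fv5.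
      have aE : m5 g_a = j by rewrite fv5.
      have fr25 : frame 31 [::] m2 m5.
        by apply: frame_trans fr4 _; apply: frame_weak fr5 _ _.
      apply: (run_if M (v := (m3 g_arg == 0) + (coll_weight p q (weight m') j < m3 g_best))) => //=.
        by rewrite argE bestE sE cE4.
      rewrite z3; case: (leqP j 1) => j1 /=.
        have {j0 j1 z3 lt3 best3} j1 : j = 1 by lia.
        rewrite j1 in sE cE4 aE jE *.
        assign M g_best (coll_weight p q (weight m') 1).
        - by rewrite sE cE4.
        - by rewrite -cE4 -sE.
        apply: (run_store M (x := g_arg) (v := 1)) => //=; first by lia.
        split; last by rewrite aE.
        split=> //; first by do 2! apply: frame_var => //.
        by move=> a a12; have -> : a = 1 by lia.
      have arg0 : m3 g_arg < j by move: lt3; rewrite /maxn j1.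
      have arg1 : (m3 g_arg == 0) = false by rewrite z3 leqNgt j1.
      have j21 : (j.+1 <= 1) = false by rewrite ltnS leqNgt j0.
      have mx : maxn 1 j.+1 = j.+1 by apply/maxn_idPr.
      rewrite add0n; case: ltnP => lt /=.
        assign M g_best (coll_weight p q (weight m') j).
        - by rewrite sE cE4.
        - by rewrite -cE4 -sE.
        apply: (run_store M (x := g_arg) (v := j)) => //=.
        split; last by rewrite aE.
        split=> //; first by do 2! apply: frame_var => //.
        + by rewrite j21; apply: gtn_eqF.
        + by rewrite mx.
        move=> a /andP[a0]; rewrite ltnS leq_eqVlt => /orP[/eqP ->//|aj]; split=> //.
        apply: leq_trans (ltnW lt) _; by have [] := best3 a; rewrite ?a0.
      apply: run_skip => //=; split; last by rewrite aE.
      split=> //; rewrite ?argE ?bestE //.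
      + by rewrite arg1 j21.
      + by rewrite mx ltnW // ltnS.
      have [bE _] := best3 1 j1.
      move=> a /andP[a0]; rewrite ltnS leq_eqVlt => /orP[/eqP ->//|aj]; split=> //.
      by have [] := best3 a; rewrite ?a0.
    * split=> //; by move=> a; lia.
    * move=> [m3 o3] /= b3 [-> fr3 z3 lt3 best3]; split=> //.
        move: z3 lt3; rewrite leqNgt p1 /= /maxn p1 => /negbT; by rewrite lt0n => -> ->.
      move=> a ap; have [E le] := best3 a ap; by rewrite -E.
    * exact: leq_for_time.
  + by rewrite -!addnA ltn_add2l addnCA ltn_add2l.
  move=> [m3 o3] /= b3 [-> fr3 arg03 min3].
  set a := m3 g_arg in arg03 min3 *.
  have [fv3 fa3] := fr3.
  assign M g_cand a; first by rewrite /a.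
  set m4 := (Y in State Y o).
  have b4 : bounded_mem R m4 by [].
  have fr4 : frame 31 [::] m2 m4 by apply: frame_var.
  have [fv4 fa4] := fr4.
  pose dW := double_coll p q a (weight m').
  have potS : pot y.+1 dW by apply: total_step.
  have w4 d : m4 (adr a_weight d) = weight m' d by rewrite fa4.
  have dW4 d : double_coll p q a (fun d => m4 (adr a_weight d)) d = dW d.
    by rewrite /dW /double_coll w4.
  apply: (@run_seq R inp _ _ _ _ (pairs_time 0) (0 + 30) _ _
    (@prog_double_collP m4 o a _ _ _ _ _)) => //; rewrite ?fv4 //.
  + rewrite (@eq_total _ dW) //; apply: leq_ltn_trans wR; exact: pot_bound potS.
  + by rewrite ltn_add2l.
  move=> [m5 o5] /= b5 [-> fr5 wE5]; have [fv5 fa5] := fr5.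
  have yE5 : m5 g_y = y by rewrite fv5 // fv4.
  have aE5 : m5 g_arg = a by rewrite fv5 // /m4 /= -/a.
  have mul5 i : m5 (adr a_mul i) = m' (adr a_mul i).
    by rewrite fa5 // fa4 // /m2 /= !cellE.
  apply: (run_store M (x := adr a_mul y) (v := a)) => //=.
  + by rewrite adrE yE5.
  + by rewrite -aE5.
  have frm5 : frame 30 [:: a_mul; a_weight] m' m5.
    apply: (@frame_trans _ _ _ m2); first by do 2! apply: frame_var => //.
    apply: (@frame_trans _ _ _ m4); first exact: frame_weak fr4 _ _.
    apply: frame_weak fr5 _ _ => // k; rewrite !inE => ->; exact: orbT.
  rewrite cellE // yE5; split=> //; split=> //.
  + by apply: frame_arr => //; apply: frame_trans fr frm5.
  + move=> i; rewrite adr_adr //= ltnS leq_eqVlt; case: eqP => [//|_] /= iy.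
    by rewrite mul5 A0.
  + rewrite /pot (@eq_total _ dW) // => d dp.
    by rewrite /weight /= adr_adr //= wE5.
  + move=> d dp ne; rewrite adr_adr //= wE5 // dW4 /dW /double_coll /coll ne /=.
    rewrite /agreement big_ord_recr /= eqxx.
    rewrite (eq_bigr (fun i : 'I_y => nat_of_bool (inner p q (m' (adr a_mul i)) (d %/ p) ==
       inner p q (m' (adr a_mul i)) (d %% p)))); last first.
      by move=> i _; rewrite adr_adr //= (ltn_eqF (ltn_ord i)) mul5.
    rewrite expnD -W //.
    by case: eqP => _; rewrite ?expn1 ?expn0 ?muln1 // mulnC.
- split=> //.
  + rewrite /pot !expn0 !mul1n; apply: leq_trans (total_one p).
    by rewrite (@eq_total _ (fun=> 1)) // => d dp; rewrite /weight /= w1.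
  + by move=> d dp _; rewrite /agreement big_ord0 expn0 /= w1.
- move=> [m2 o2] /= b2 [-> fr A0 P W]; split=> //.
    apply: frame_trans (frame_weak fr1 _ _) fr => // k; rewrite !inE => ->; exact: orbT.
  move=> u u' up up' ne.
  pose d := u * p + u'.
  have du : d %/ p = u by rewrite /d divnMDl // (divn_small up') addn0.
  have du' : d %% p = u' by rewrite /d modnMDl modn_small.
  have dp : d < p * p by rewrite -ltn_divLR // du.
  have := W d dp; rewrite du du' => /(_ ne) Wd.
  have : weight m2 d <= 2 ^ (3 * s).
    apply: leq_trans (pot_bound _ _ (leqnn _) P).
    by apply: leq_total_weight; rewrite ?du ?du'.
  rewrite /weight Wd leq_exp2l // /agreement du du' => le.
  (* At most [3s] collisions among [12 * b0 * s] multipliers are the fraction [1/(4 * b0)]. *)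
  apply: (@leq_trans (4 * b0 * (3 * s))); first by rewrite leq_mul2l le orbT.
  by rewrite /l2; lia.
- exact: leq_for_time.
Qed.

Lemma prog_inverseP (m : nat -> nat) (o : seq nat) (l2 : nat) : bounded_mem R m ->
  m v_p = p -> m v_l2 = l2 ->
  (forall y, y < l2 -> 0 < m (adr a_mul y) < p) ->
  run R inp prog_inverse (State m o) (l2 * (p * 60 + 40) + 20) (fun st' =>
    [/\ output st' = o, frame 30 [:: a_inv] m (memory st') &
        forall y, y < l2 -> memory st' (adr a_mul y) * memory st' (adr a_inv y) %% p = 1]).
Proof.
move=> b mp ml mA; have l2R : l2 < R by rewrite -ml.
apply: (@run_for R inp M _ _ _ (fun y st =>
    [/\ output st = o, frame 30 [:: a_inv] m (memory st) &
        forall i, i < y -> memory st (adr a_mul i) * memory st (adr a_inv i) %% p = 1])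
   _ l2 _ (p * 60 + 20)) => //.
- move=> y [m' o'] v /= [-> fr E]; split=> //; first by apply: frame_var.
  by move=> i iy; rewrite !cellE // E.
- by move=> y [m' o'] /= b' [_ [fv _] _] _ _; rewrite fv.
- move=> y [m' o'] /= b' [-> fr E] yl yE; have [fv fa] := fr.
  set c := m' (adr a_mul y).
  have cp : 0 < c < p by rewrite /c fa // mA.
  apply: (@run_for R inp M _ _ _ (fun d st =>
    [/\ output st = o, frame 30 [:: a_inv] m (memory st), memory st g_y = y,
        forall i, i < y -> memory st (adr a_mul i) * memory st (adr a_inv i) %% p = 1 &
        (exists2 t, t < d & c * t %% p = 1) -> c * memory st (adr a_inv y) %% p = 1])
    _ p _ (0 + 40)) => //.
  + move=> d [m2 o2] v /= [-> fr2 y2 E2 I2]; split=> //; first by apply: frame_var.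
    * by move=> i iy; rewrite !cellE // E2.
    * by rewrite cellE.
  + by move=> d [m2 o2] /= b2 [_ [fv2 _] _ _ _] _ _; rewrite fv2.
  + move=> d [m2 o2] /= b2 [-> fr2 y2 E2 I2] dp dE; have [fv2 fa2] := fr2.
    have c2 : m2 (adr a_mul y) = c by rewrite /c fa2 // fa.
    apply: (run_if M (v := c * d %% p == 1)) => //=.
      by rewrite adrE y2 c2 dE fv2 // mp.
    case: (c * d %% p =P 1) => /= cd; last first.
      apply: run_skip => //=; split=> //; split=> // -[t]; rewrite ltnS leq_eqVlt.
      by case/orP => [/eqP -> //|td tE]; apply: I2; exists t.
    apply: (run_store M (x := adr a_inv y) (v := d)) => //=.
    * by rewrite adrE y2.
    * by apply: ltn_trans dp pR.
    rewrite (@var_adr 30) // (@var_adr 36) //; split=> //; split=> //.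
    * by apply: frame_arr.
    * by move=> i iy; rewrite !adr_adr //= (ltn_eqF iy) E2.
    * by move=> _; rewrite adr_adr //= eqxx.
  + by split=> // -[].
  + move=> [m2 o2] /= b2 [-> fr2 y2 E2 I2]; have [fv2 fa2] := fr2.
    split=> //; split=> // i; rewrite ltnS leq_eqVlt => /orP[/eqP ->|]; last exact: E2.
    by rewrite fa2 // -[m (adr 0 y)](fa 0) // I2 //; apply: inverse_exists.
  + exact: (@leq_for_time p _ 0 40 60 20).
- exact: leq_for_time.
Qed.

End Programs.

(** * The set-up program: parameters, multipliers, inverses and sizes *)

Definition prog_numbers : cmd :=
  v_Kf ::= Var v_K * Var v_f ;;
  t_in ::= Var v_x ;;
  prog_lg ;;
  v_lg ::= Var t_out ;;
  t_in ::= Const 2 * Var v_Kf ;;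
  prog_least_exp ;;
  v_k ::= Var t_out ;;
  t_out ::= (Const 4 * Var v_Kf) * Var v_k ;;
  prog_next_prime ;;
  v_p ::= Var t_out ;;
  t_in ::= Var v_p ;;
  prog_least_exp ;;
  v_k1 ::= Var t_out ;;
  If (Var v_k < Const 16)%prog
    (v_use ::= Const 0)
    (If (Var v_lg < Var v_f)%prog
       (v_use ::= Const 0)
       (t_thr ::= Var v_Kf * Var v_lg ;;
        prog_power_test ;;
        v_use ::= Var t_out)).

(** Without the inner hash, the single multiplier 1 and the modulus [p] make [inner] the identity on
    residues, so the later programs need no case distinction. *)
Definition prog_multipliers : cmd :=
  If (Var v_use)
    (v_q ::= Const 48 * Var v_Kf ;;
     t_in ::= Var v_p ;;
     prog_lg ;;
     v_l2 ::= (Const 12 * Var v_Kf) * (Var t_out + Const 1) ;;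
     prog_greedy)
    (v_q ::= Var v_p ;;
     v_l2 ::= Const 1 ;;
     Store (Adr a_mul (Const 0)) (Const 1)).

Definition prog_sizes : cmd :=
  v_T ::= Var v_x + Const 1 ;;
  If (Var v_K < Var v_T)%prog (v_T ::= Var v_K) Skip ;;
  v_Q ::= Var v_q + Const 1 ;;
  v_H ::= ((Const 4 * Var v_Kf) * Var v_k1) * Var v_l2 ;;
  v_N ::= Var v_H ;;
  For t_d (Var v_T) (v_N ::= Var v_N * Var v_Q) ;;
  v_cr ::= ((Var v_p + Var v_q) - Const 1) %/ Var v_q ;;
  v_nb ::= Var v_cr * (Var v_x %/ Var v_p + Const 1).

Definition prog_setup : cmd :=
  prog_numbers ;; prog_multipliers ;; prog_inverse ;; prog_sizes.

Lemma run_seq_split (R : nat) (inp : seq nat) (k2 : nat) c1 c2 st a b k1 k (P1 P : state -> Prop) :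
  run R inp c1 st (a + k1) P1 -> k1 + k2 < k ->
  (forall st1, bounded_mem R (memory st1) -> P1 st1 -> run R inp c2 st1 (b + k2) P) ->
  run R inp (Seq c1 c2) st (a + b + k) P.
Proof. by move=> r1 kk r2; apply: run_seq r1 _ r2; lia. Qed.

Section Setup.
Variables (R : nat) (inp : seq nat).
Hypothesis M : machine R inp.
Let R104 : 104 < R := R_gt104 M.

Variables (x K f k p k1 : nat).
Hypothesis f0 : 0 < f.
Hypothesis K0 : 0 < K.
Hypothesis Kf : K <= f.+1.
Hypothesis kP : least_exp (2 * (K * f)) x k.
Hypothesis pP : next_prime (4 * (K * f) * k) p.
Hypothesis pU : p <= 2 ^ 10 * (K * f) * k.
Hypothesis k1P : least_exp p x k1.

Notation b := (K * f).
Notation use := (use_inner x K f k).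
Notation q := (modulus x K f k p).
Notation l2 := (inner_len x K f k p).
Notation H := (hash_len x K f k p k1).
Notation T := (tuple_len x K).
Notation N := (cover_size x K f k p k1).

(** A common upper bound for the parameters and for the constants up to 60. Each value stored by the
    set-up is at most a product of four such quantities, possibly smaller, and so below [R]. *)
Definition word_size : nat := x + b + p + N + K + f + 60.
Notation Z := word_size.
Hypothesis ZR : Z ^ 6 < R.

Let Z60 : 60 <= Z. Proof. by rewrite /Z leq_addl. Qed.

Let le_R (u v w t : nat) : u <= Z -> v <= Z -> w <= Z -> t <= Z -> u * v * w * t < R.
Proof.
move=> uZ vZ wZ tZ; apply: leq_ltn_trans ZR.
apply: (@leq_trans (Z ^ 4)); last by rewrite leq_exp2l //; apply: leq_trans Z60.
by rewrite !expnS expn0 muln1 !mulnA; do 3! apply: leq_mul => //.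
Qed.

Let le_R1 (u : nat) : u <= Z -> u < R.
Proof.
by move=> uZ; have := @le_R u 1 1 1 uZ; rewrite !muln1; apply; apply: leq_trans Z60.
Qed.

Let le_R2 (u v : nat) : u <= Z -> v <= Z -> u * v < R.
Proof.
move=> uZ vZ; have := @le_R u v 1 1 uZ vZ; rewrite !muln1; apply; exact: leq_trans Z60.
Qed.

Let le_R3 (u v w : nat) : u <= Z -> v <= Z -> w <= Z -> u * v * w < R.
Proof.
move=> uZ vZ wZ; have := @le_R u v w 1 uZ vZ wZ; rewrite !muln1; apply; exact: leq_trans Z60.
Qed.

Let xZ : x <= Z. Proof. by rewrite /Z -!addnA leq_addr. Qed.
Let pZ : p <= Z. Proof. by rewrite /Z; lia. Qed.
Let NZ : N <= Z. Proof. by rewrite /Z; lia. Qed.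
Let bZ : b <= Z. Proof. by rewrite /Z; lia. Qed.
Let KZ : K.+1 <= Z. Proof. by rewrite /Z; lia. Qed.
Let cZ (c : nat) : c <= 60 -> c <= Z. Proof. by move=> c60; apply: leq_trans Z60. Qed.

Lemma leq_lg (z : nat) : lg z <= z.
Proof.
have [->|z0] := posnP z; first by rewrite /lg trunc_log0.
by apply: ltnW; apply: leq_trans (ltn_expl _ (isT : 1 < 2)) (trunc_logP _ z0).
Qed.

Let lZ : lg x <= Z. Proof. exact: leq_trans (leq_lg x) xZ. Qed.
Let kZ : k <= Z.
Proof. by apply: leq_trans (k_le_lg f0 K0 Kf kP pU) _; have := leq_lg x; rewrite /Z; lia. Qed.
Let k1Z : k1 <= Z.
Proof. exact: leq_trans (k1_le_k f0 K0 Kf kP pP pU k1P) kZ. Qed.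

Let b0 : 0 < b. Proof. by rewrite muln_gt0 K0. Qed.
Let pp : prime p. Proof. by case: pP. Qed.
Let p1 : 1 < p. Proof. exact: prime_gt1. Qed.

Definition numbers_time : nat :=
  lg x * 20 + (k * 25 + ((p - 4 * b * k) * (p * 40 + 50) + (k1 * 25 + K.+1 * 40))) + 400.

Definition holds_numbers (m : nat -> nat) : Prop :=
  [/\ [/\ m v_x = x, m v_K = K & m v_f = f],
      [/\ m v_Kf = b, m v_lg = lg x & m v_k = k] &
      [/\ m v_p = p, m v_k1 = k1 & m v_use = use]].

Lemma holds_numbers_frame (m m' : nat -> nat) (lo : nat) (ks : seq nat) :
  holds_numbers m -> frame lo ks m m' -> 8 < lo -> holds_numbers m'.
Proof.
move=> [[? ? ?] [? ? ?] [? ? ?]] [fv _] lo8.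
have E j : j <= 8 -> m' j = m j.
  by move=> j8; apply: fv; [exact: leq_ltn_trans j8 lo8 | exact: leq_ltn_trans j8 _].
by split; rewrite !E.
Qed.

Lemma prog_numbersP (m : nat -> nat) (o : seq nat) : bounded_mem R m ->
  m v_x = x -> m v_K = K -> m v_f = f ->
  run R inp prog_numbers (State m o) numbers_time (fun st' =>
    [/\ output st' = o, holds_numbers (memory st') & frame 3 [::] m (memory st')]).
Proof.
move=> bm mx mK mf; rewrite /numbers_time.
assign M v_Kf b; [by rewrite mK mf | exact: le_R1 |].
assign M t_in x; first exact: le_R1.
set m1 := (Y in State Y o).
have b1 : bounded_mem R m1 by [].
apply: (run_seq_split (k2 := 340) (@prog_lgP R inp M m1 o x b1 erefl)).
  by [].
move=> [m2 o2] /= b2 [-> [fv2 fa2] lE].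
assign M v_lg (lg x); first exact: le_R1.
assign M t_in (2 * b); [by rewrite fv2 | exact: le_R2 (cZ _) _ |].
set m3 := (Y in State Y o).
have b3 : bounded_mem R m3 by [].
have x3 : m3 v_x = x by rewrite /m3 /= fv2.
apply: (run_seq_split (k2 := 280) (@prog_least_expP R inp M m3 o x _ k b3 erefl x3 kP _ _)).
- by rewrite mulnC; exact: le_R3 (cZ _) _ _.
- exact: le_R1.
- by [].
move=> [m4 o4] /= b4 [-> [fv4 fa4] kE].
assign M v_k k; first exact: le_R1.
assign M t_out (4 * b * k); [by rewrite fv4 // /m3 /= fv2 | exact: le_R3 (cZ _) _ _ |].
set m5 := (Y in State Y o).
have b5 : bounded_mem R m5 by [].
apply: (run_seq_split (k2 := 220) (@prog_next_primeP R inp M m5 o _ p b5 erefl _ pP _)).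
- by rewrite !muln_gt0 K0 f0 /=; case: kP.
- exact: le_R1.
- by [].
move=> [m6 o6] /= b6 [-> [fv6 fa6] pE].
assign M v_p p; first exact: le_R1.
assign M t_in p; first exact: le_R1.
set m7 := (Y in State Y o).
have b7 : bounded_mem R m7 by [].
have x7 : m7 v_x = x by rewrite /m7 /= fv6 // /m5 /= fv4 // /m3 /= fv2.
apply: (run_seq_split (k2 := 160) (@prog_least_expP R inp M m7 o x _ k1 b7 erefl x7 k1P _ _)).
- exact: le_R2.
- exact: le_R1.
- by [].
move=> [m8 o8] /= b8 [-> [fv8 fa8] k1E].
assign M v_k1 k1; first exact: le_R1.
set m9 := (Y in State Y o).
have V9 : [/\ [/\ m9 v_x = x, m9 v_K = K & m9 v_f = f],
      [/\ m9 v_Kf = b, m9 v_lg = lg x & m9 v_k = k] &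
       m9 v_p = p /\ m9 v_k1 = k1].
  by split; split; rewrite /m9 //= ?fv8 // /m7 //= ?fv6 // /m5 //= ?fv4 // /m3 //= ?fv2.
have fr9 : frame 3 [::] m m9.
  split=> [j j3 j104|i j i8 _].
    have lt j' : 3 <= j' -> (j == j') = false by move=> h; rewrite ltn_eqF // (leq_trans j3).
    have j20 : j < 20 by apply: leq_trans j3 _.
    by rewrite /m9 /= lt // fv8 // /m7 /= !lt // fv6 // /m5 /= !lt // fv4 // /m3 /= !lt // fv2 // /m1 /= !lt.
  by rewrite /m9 /= cellE // fa8 // /m7 /= !cellE // fa6 // /m5 /= !cellE // fa4 // /m3 /= !cellE // fa2 // /m1 /= !cellE.
have [[x9 K9 f9] [b9' l9 k9] [p9 k19]] := V9.
have final m' : bounded_mem R m' -> frame 8 [::] m9 m' -> m' v_use = use ->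
    [/\ o = o, holds_numbers m' & frame 3 [::] m m'].
  move=> _ fr' uE; have [fv' _] := fr'; split=> //.
    by split; split=> //; rewrite fv'.
  apply: frame_trans fr9 _; exact: frame_weak fr' _ _.
apply: (run_if M (v := k < 16)) => //=; first by rewrite k9.
rewrite -/use in final; move: final; rewrite /use_inner leqNgt.
case: (ltnP k 16) => k16 /= final.
  apply: (run_store M (x := v_use) (v := 0)) => //=; first by apply: ltn_trans R104.
  by apply: final => //; [move=> a /=; case: ifP => // _; apply: ltn_trans R104 | apply: frame_var].
apply: (run_if M (v := lg x < f)) => //=; first by rewrite l9 f9.
move: final; rewrite leqNgt.
case: (ltnP (lg x) f) => lf /= final.
  apply: (run_store M (x := v_use) (v := 0)) => //=; first by apply: ltn_trans R104.
  by apply: final => //; [move=> a /=; case: ifP => // _; apply: ltn_trans R104 | apply: frame_var].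
assign M t_thr (b * lg x); [by rewrite b9' l9 | exact: le_R2 |].
set m10 := (Y in State Y o).
have b10 : bounded_mem R m10 by [].
apply: (@run_seq R inp _ _ _ _ (K.+1 * 40 + 50) (0 + 10) _ _ (@prog_power_testP R inp M m10 o K k _ b10 K9 k9 erefl _ _ _ _)).
- by case: kP.
- exact: le_R1.
- exact: le_R3.
- exact: le_R1.
- by rewrite -!addnA ltn_add2l.
move=> [m11 o11] /= b11 [-> fr11 uE].
apply: (run_store M (x := v_use) (v := b * lg x < k ^ K.+1)) => //=.
- by apply: leq_ltn_trans (leq_b1 _) _; apply: ltn_trans R104.
apply: final.
- by move=> a /=; case: ifP => // _; apply: leq_ltn_trans (leq_b1 _) _; apply: ltn_trans R104.
- apply: frame_var => //; apply: (@frame_trans _ _ _ m10); first by apply: frame_var.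
  exact: frame_weak fr11 _ _.
- by [].
Qed.

Let s_ge : p <= 2 ^ (lg p).+1. Proof. exact: ltnW (lt_lg p). Qed.

Let weight_R : 2 ^ (3 * (lg p).+1) < R.
Proof.
have le : 2 ^ (lg p).+1 <= 2 * p.
  by rewrite expnS leq_mul2l; apply: trunc_logP => //; apply: ltnW.
rewrite mulnC expnM; apply: leq_ltn_trans (leq_expn 3 le) _.
rewrite (_ : (2 * p) ^ 3 = 8 * p * p * p); last by rewrite !expnS expn0; ring.
exact: le_R (cZ _) _ _ _.
Qed.

Let qZ : q <= Z.
Proof. exact: leq_trans (q_le_p x f0 K0 Kf pP pU) pZ. Qed.

Let HN : H <= N.
Proof. by rewrite /cover_size leq_pmulr // expn_gt0. Qed.

Let l2H : l2 <= H.
Proof. by rewrite /hash_len leq_pmull // !muln_gt0 K0 f0; case: k1P. Qed.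

Let l2Z : l2 <= Z.
Proof. exact: leq_trans l2H (leq_trans HN NZ). Qed.

Definition multipliers_time : nat :=
  lg p * 20 + (if use then greedy_time p b (lg p).+1 else 0) + 100.

Definition good_multipliers (A : nat -> nat) : Prop :=
  (forall y, y < l2 -> 0 < A y < p) /\
  forall u u', u < p -> u' < p -> u != u' ->
    4 * b * \sum_(y < l2) (inner p q (A y) u == inner p q (A y) u') <= l2.

Lemma prog_multipliersP (m : nat -> nat) (o : seq nat) : bounded_mem R m ->
  holds_numbers m ->
  run R inp prog_multipliers (State m o) multipliers_time (fun st' =>
    [/\ output st' = o, frame 9 [:: a_mul; a_weight] m (memory st'),
        memory st' v_q = q, memory st' v_l2 = l2 &
        good_multipliers (fun y => memory st' (adr a_mul y))]).
Proof.
move=> bm nm; rewrite /multipliers_time /good_multipliers.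
have [[mx mK mf] [mKf ml mk] [mp mk1 mu]] := nm.
apply: (run_if M (v := use)) => //=.
have qR := le_R1 qZ; have l2R := le_R1 l2Z.
move: qR l2R; rewrite /modulus /inner_len; case: ifP => u /= qR l2R; last first.
  rewrite addn0.
  assign M v_q p; first exact: qR.
  assign M v_l2 1; first exact: l2R.
  apply: (run_store M (x := adr a_mul 0) (v := 1)) => //=.
  split=> //.
  - by apply: frame_arr => //; do 2! apply: frame_var => //.
  split=> [y|v v' vp vp' ne].
    by rewrite ltnS leqn0 => /eqP ->; rewrite adr_adr.
  rewrite big_ord1 adr_adr //= /inner !mul1n !(modn_small vp) !(modn_small vp').
  by rewrite (negbTE ne) muln0.
assign M v_q (48 * b); [by rewrite mKf | exact: qR |].
assign M t_in p; first exact: le_R1.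
set m1 := (Y in State Y o).
have b1 : bounded_mem R m1 by [].
apply: (run_seq_split (k2 := 50) (@prog_lgP R inp M m1 o p b1 erefl)) => //.
move=> [m2 o2] /= b2 [-> fr2 lE]; have [fv2 fa2] := fr2.
assign M v_l2 (12 * b * (lg p).+1).
- by rewrite lE addn1 fv2 // /m1 /= mKf.
- exact: l2R.
set m3 := (Y in State Y o).
have b3 : bounded_mem R m3 by [].
have fr3 : frame 9 [:: a_mul; a_weight] m m3.
  apply: frame_var => //; apply: (@frame_trans _ _ _ m1); first by do 2! apply: frame_var => //.
  exact: frame_weak fr2 _ _.
have [fv3 fa3] := fr3.
have q0' : 0 < 48 * b by rewrite muln_gt0.
apply: (run_weak (@prog_greedyP R inp M p (48 * b) pp q0' (le_R2 pZ pZ) qR b (lg p).+1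
  b0 erefl s_ge weight_R m3 o b3 _ _ _)) => //.
- by rewrite fv3.
- by rewrite /m3 /= fv2.
- by rewrite leq_addr.
move=> [m4 o4] /= b4 [-> fr4 A4 ag4]; have [fv4 fa4] := fr4; split=> //.
- by apply: frame_trans fr3 _; apply: frame_weak fr4 _ _.
- by rewrite fv4 // /m3 /= fv2.
- by rewrite fv4.
Qed.

Definition sizes_time : nat := T * 30 + 150.

Lemma prog_sizesP (m : nat -> nat) (o : seq nat) : bounded_mem R m ->
  holds_numbers m -> m v_q = q -> m v_l2 = l2 ->
  run R inp prog_sizes (State m o) sizes_time (fun st' =>
    [/\ output st' = o, frame 11 [::] m (memory st'),
        [/\ memory st' v_T = T, memory st' v_Q = q.+1, memory st' v_H = H & memory st' v_N = N] &
        memory st' v_cr = (p + q - 1) %/ q /\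
        memory st' v_nb = (p + q - 1) %/ q * (x %/ p).+1]).
Proof.
move=> bm [[mx mK mf] [mKf ml mk] [mp mk1 mu]] mq ml2; rewrite /sizes_time.
have q0 : 0 < q := q_gt0 x f0 K0 Kf pP pU.
have qp : q <= p := q_le_p x f0 K0 Kf pP pU.
have xS : x.+1 <= Z by rewrite /Z; lia.
assign M v_T x.+1; [by rewrite mx addn1 | exact: le_R1 |].
set m1 := (Y in State Y o).
have b1 : bounded_mem R m1 by [].
apply: (@run_seq R inp _ _ _ _ (0 + 20) (T * 30 + 120) (fun st =>
   [/\ output st = o, memory st v_T = T & frame 11 [::] m (memory st)])).
- apply: (run_if M (v := K < x.+1)) => //=; first by rewrite /m1 /= mK.
  case: (ltnP K x.+1) => KT /=.
    apply: (run_store M (x := v_T) (v := K)) => //=; first by apply: le_R1; apply: ltnW.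
    split=> //; first by rewrite /tuple_len; apply/esym/minn_idPl; apply: ltnW.
    by do 2! apply: frame_var => //.
  apply: run_skip => //=; split=> //; first by rewrite /m1 /= /tuple_len; apply/esym/minn_idPr.
  by apply: frame_var.
- by rewrite addnCA; move: (T * 30) => t; rewrite ltn_add2l.
move=> [m2 o2] /= b2 [-> T2 fr2]; have [fv2 fa2] := fr2.
have N0 : H <= Z := leq_trans HN NZ.
have QZ : q.+1 <= Z by apply: leq_ltn_trans qp _; rewrite /Z; lia.
assign M v_Q q.+1; [by rewrite fv2 // mq addn1 | exact: le_R1 |].
assign M v_H H.
- by rewrite !fv2 // mKf mk1 ml2.
- exact: le_R1.
assign M v_N H; first exact: le_R1.
set m3 := (Y in State Y o).
have b3 : bounded_mem R m3 by [].
have fr3 : frame 11 [::] m m3 by do 3! apply: frame_var => //.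
apply: (@run_seq R inp _ _ _ _ (T * 30 + 20) (0 + 50) (fun st =>
   [/\ output st = o, frame 14 [::] m3 (memory st) & memory st v_N = N])).
- apply: (@run_for R inp M _ _ _ (fun j st =>
     [/\ output st = o, frame 14 [::] m3 (memory st) & memory st v_N = H * q.+1 ^ j])
     _ T _ (0 + 15)) => //.
  + by apply: le_R1; apply: leq_trans (geq_minl _ _) _; apply: ltnW.
  + by move=> j [m4 o4] a /= [-> fr4 NE]; split=> //; apply: frame_var.
  + by move=> j [m4 o4] /= b4 [_ [fv4 _] _] _ _; rewrite fv4 // /m3 /= T2.
  + move=> j [m4 o4] /= b4 [-> fr4 NE] jT jE; have [fv4 fa4] := fr4.
    apply: (run_store M (x := v_N) (v := H * q.+1 ^ j.+1)) => //=.
    * by rewrite NE fv4 // /m3 /= -mulnA -expnSr.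
    * apply: le_R1; apply: leq_trans NZ; rewrite /cover_size leq_mul2l.
      by rewrite leq_exp2l // jT orbT.
    by split=> //; split=> //; apply: frame_var.
  + by split=> //; rewrite expn0 muln1.
  + exact: (@leq_for_time T _ 0 15 30 20).
- by rewrite -addnA ltn_add2l.
move=> [m4 o4] /= b4 [-> fr4 N4]; have [fv4 fa4] := fr4.
have fr04 : frame 11 [::] m m4 by apply: frame_trans fr3 _; apply: frame_weak fr4 _ _.
have [fv04 fa04] := fr04.
have crb : (p + q - 1) %/ q <= 2 * p.
  apply: leq_trans (leq_div _ _) _; rewrite mul2n -addnn.
  by apply: leq_trans (leq_subr _ _) _; rewrite leq_add2l.
assign M v_cr ((p + q - 1) %/ q).
- by rewrite !fv04 // mp mq.
- by apply: leq_ltn_trans crb _; apply: le_R2 (cZ _) pZ.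
apply: (run_store M (x := v_nb) (v := (p + q - 1) %/ q * (x %/ p).+1)) => //=.
- by rewrite addn1 !fv04 // mx mp.
- apply: (@leq_ltn_trans (2 * p * x.+1)); last exact: le_R3 (cZ _) pZ xS.
  by apply: leq_mul crb _; rewrite ltnS leq_div.
split=> //.
- by do 2! apply: frame_var => //.
- by split=> //; rewrite fv4 // /m3 /= T2.
Qed.

Definition setup_time : nat :=
  numbers_time + (multipliers_time + (l2 * (p * 60 + 40) + 20 + (sizes_time + 0))) + 20.

Lemma prog_setupP (m : nat -> nat) (o : seq nat) : bounded_mem R m ->
  m v_x = x -> m v_K = K -> m v_f = f ->
  run R inp prog_setup (State m o) setup_time (fun st' =>
    [/\ output st' = o, forall w, memory st' (adr a_mark w) = m (adr a_mark w) &
        exists A Inv, [/\ holds_params x p q (4 * b * k1) l2 T A Inv (memory st'),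
          forall y, y < l2 -> A y * Inv y %% p = 1 & good_multipliers A]]).
Proof.
move=> bm mx mK mf; rewrite /setup_time.
apply: (@run_seq R inp _ _ _ _ numbers_time
  (multipliers_time + (l2 * (p * 60 + 40) + 20 + (sizes_time + 0)) + 15) _ _
  (prog_numbersP o bm mx mK mf)).
  by rewrite -!addnA !ltn_add2l.
move=> [m1 o1] /= b1 [-> nm1 fr1].
apply: (@run_seq R inp _ _ _ _ multipliers_time
  (l2 * (p * 60 + 40) + 20 + (sizes_time + 0) + 10) _ _ (prog_multipliersP o b1 nm1)).
  by rewrite -!addnA !ltn_add2l.
move=> [m2 o2] /= b2 [-> fr2 q2 l22 good2].
have nm2 : holds_numbers m2 by apply: holds_numbers_frame nm1 fr2 _.
have p2 : m2 v_p = p by case: nm2 => _ _ [].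
apply: (@run_seq R inp _ _ _ _ (l2 * (p * 60 + 40) + 20) (sizes_time + 0) _ _
  (@prog_inverseP R inp M p pp (le_R2 pZ pZ) m2 o l2 b2 p2 l22 (proj1 good2))).
  by rewrite -!addnA !ltn_add2l.
move=> [m3 o3] /= b3 [-> fr3 inv3].
have nm3 : holds_numbers m3 by apply: holds_numbers_frame nm2 fr3 _.
have [fv3 fa3] := fr3.
have q3 : m3 v_q = q by rewrite fv3.
have l3 : m3 v_l2 = l2 by rewrite fv3.
apply: (run_weak (prog_sizesP o b3 nm3 q3 l3)); first by rewrite leq_addr.
move=> [m4 o4] /= b4 [-> fr4 [TE QE HE NE] crnb].
have [fv4 fa4] := fr4.
have [fv1 fa1] := fr1; have [fv2 fa2] := fr2.
split=> //.
- by move=> w; rewrite fa4 // fa3 // fa2 // fa1.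
exists (fun y => m4 (adr a_mul y)), (fun y => m4 (adr a_inv y)).
have [[x3 _ _] _ [p3 _ _]] := nm3.
split.
- by split=> //; split=> //; rewrite fv4.
- by move=> y yl; rewrite !fa4 // inv3.
- have [g1 g2] := good2; split.
    by move=> y yl; rewrite fa4 // fa3 // g1.
  move=> u u' up up' ne; have := g2 u u' up up' ne.
  by congr (_ * _ <= _); apply: eq_bigr => y _; rewrite fa4 // fa3.
Qed.

End Setup.

(** * Running times *)

(** Here [U] stands for the budget [D^14 * N], and [V] and [W] for [c^2 * U] and [c^4 * U] with
    [c = 2^10]. *)
Lemma setup_arith (l k' P k'' K' t lp g lp2 l2' U V W : nat) :
  l <= U -> k' <= U -> P <= 90 * V -> k'' <= U -> K' <= U -> t <= U -> 0 < U -> lp <= V ->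
  g <= 12 * 500 * W + 80 * V -> lp2 <= 12 * V -> l2' <= lp2 ->
  l * 20 + (k' * 25 + (P + (k'' * 25 + K'.+1 * 40))) + 400 +
    (lp * 20 + g + 100 + (lp2 * 60 + l2' * 40 + 20 + (t * 30 + 150 + 0))) + 20 <=
  10 * 100 * U + 15 * 100 * V + 12 * 500 * W.
Proof. by lia. Qed.

Section Times.
Variables (x K f k p k1 : nat).
Hypothesis f0 : 0 < f.
Hypothesis K0 : 0 < K.
Hypothesis Kf : K <= f.+1.
Hypothesis kP : least_exp (2 * (K * f)) x k.
Hypothesis pP : next_prime (4 * (K * f) * k) p.
Hypothesis pU : p <= 2 ^ 10 * (K * f) * k.
Hypothesis k1P : least_exp p x k1.

Notation b := (K * f).
Notation use := (use_inner x K f k).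
Notation q := (modulus x K f k p).
Notation l2 := (inner_len x K f k p).
Notation H := (hash_len x K f k p k1).
Notation T := (tuple_len x K).
Notation N := (cover_size x K f k p k1).
Notation D := (lg x).+1.
Notation nb := ((p + q - 1) %/ q * (x %/ p).+1).

Let b0 : 0 < b. Proof. by rewrite muln_gt0 K0. Qed.
Let p1 : 1 < p. Proof. by case: pP => /prime_gt1. Qed.

Let T0 : 0 < T. Proof. by rewrite /tuple_len leq_min K0. Qed.

Let H0 : 0 < H.
Proof. by apply: leq_trans (hash_len_ge f0 K0 Kf pU k1P); rewrite muln_gt0. Qed.

Let HN : H <= N. Proof. by rewrite /cover_size leq_pmulr // expn_gt0. Qed.

Let N0 : 0 < N. Proof. exact: leq_trans H0 HN. Qed.

(** The balance bound at [d = T] leaves two cases: [f * T * nb <= x], or [T * nb <= T], where the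
    cap on the tuple length applies. *)
Lemma tuple_bucket : T * nb <= x.+1.
Proof.
have := bucket_balance f0 K0 Kf kP pP pU (geq_minl K x.+1 : T <= K).
rewrite -mulnA; move: (T * nb) (geq_minr K x.+1 : T <= x.+1) => u.
move: T => t tx; rewrite leq_max => /orP[h|].
  by apply: leqW; apply: leq_trans h; rewrite leq_pmull.
by rewrite leq_pmul2l // => h; apply: leq_trans tx.
Qed.

Lemma cover_time_le : cover_time x p q T <= 600 * D * (T * nb + T + 1).
Proof.
rewrite /cover_time /bucket_time; move: T nb (ltn0Sn (lg x)) => t n; move: D => d d0.
have h1 : t * (n * (60 * d + 260) + 20 + 120) <= 320 * d * (t * n) + 140 * d * t.
  rewrite (_ : 320 * d * (t * n) + 140 * d * t = t * (n * (320 * d) + 140 * d)); last by ring.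
  rewrite leq_mul2l -addnA; apply/orP; right; apply: leq_add; last by lia.
  by rewrite leq_mul2l; apply/orP; right; lia.
have -> : 600 * d * (t * n + t + 1) = 600 * (d * (t * n)) + 600 * (d * t) + 600 * d by ring.
by move: h1; rewrite -!mulnA; move: (d * (t * n)) (d * t) => u v; lia.
Qed.

Lemma main_time_le :
  main_time x p q (4 * b * k1) l2 T <= 2000 * D * x.+1 * N.
Proof.
have arith n c u t d X : 0 < n -> 0 < d -> 0 < X -> c <= 600 * d * (u + t + 1) ->
    u <= X -> t <= X -> n * (c + (30 * u + 70)) + 40 <= 2000 * d * X * n.
  move=> n0 d0 X0 cu uX tX.
  have h1 : c <= 1800 * (d * X).
    apply: leq_trans cu _; rewrite -mulnA (_ : 1800 = 600 * 3) // -mulnA leq_mul2l /=.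
    by rewrite mulnCA leq_mul2l; apply/orP; right; lia.
  have h2 : X <= d * X by rewrite leq_pmull.
  have h3 : c + (30 * u + 70) <= 1900 * (d * X) by move: h1 h2 => *; lia.
  have h4 : 40 <= 40 * n by lia.
  have h5 : n <= d * X * n by rewrite leq_pmull // muln_gt0 d0.
  have h6 : n * (c + (30 * u + 70)) <= 1900 * (d * X * n).
    by rewrite mulnA [X in _ <= X]mulnC leq_mul2l h3 orbT.
  rewrite -!mulnA mulnA; move: h4 h5 h6; rewrite -!mulnA.
  by move: (d * (X * n)) (n * _) => v w; lia.
by apply: arith cover_time_le tuple_bucket (geq_minr K x.+1).
Qed.

Lemma identify_time_le (d : nat) :
  identify_time x (4 * b * k1) l2 d <= polylog (192 * 300) 4 x * (b * d.+1).
Proof.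
have arith h e B y : 0 < h -> 0 < e -> h <= 192 * y * B ->
    h * (d * (60 * e + 150) + 120) + 20 <= 192 * 300 * (e * y) * (B * d.+1).
  move=> h0 e0 hB.
  have h1 : h * (d * (60 * e + 150) + 120) + 20 <= h * (300 * e * d.+1).
    have le : d * (60 * e + 150) + 140 <= 300 * e * d.+1.
      rewrite (_ : 300 * e * d.+1 = d * (60 * e) + d * (240 * e) + 300 * e); last by ring.
      have : d * 150 <= d * (240 * e) by rewrite leq_mul2l; apply/orP; right; lia.
      by rewrite mulnDr; move: (d * (60 * e)) (d * (240 * e)) => u v; lia.
    apply: (@leq_trans (h * (d * (60 * e + 150) + 140))); last by rewrite leq_mul2l le orbT.
    by rewrite !mulnDr; lia.
  apply: leq_trans h1 _; apply: leq_trans (leq_mul hB (leqnn _)) _.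
  by rewrite (_ : _ * _ * _ * (_ * _ * _) = 192 * 300 * (e * y) * (B * d.+1)) //; ring.
rewrite /identify_time /polylog expnS; apply: arith => //.
exact: (hash_len_polylog f0 K0 Kf kP pP pU k1P).
Qed.

(** The time is a polylogarithm times the number of bucket slots tried plus the number of digits
    read. After multiplication by [f], the slots are controlled by [bucket_balance] and the digits
    by [Kf]. *)
Lemma enumerate_time_le :
  f * enumerate_time x p q T <= polylog 2000 1 x * maxn x (b).
Proof.
have arith c u t d m : 0 < d -> c <= 600 * d * (u + t + 1) -> f * u <= m -> f * t <= m -> f <= m ->
    f * (c + (30 * u + 60)) <= 2000 * d * m.
  move=> d0 cu um tm fm.
  have h1 : f * c <= 600 * d * (3 * m).
    apply: (@leq_trans (f * (600 * d * (u + t + 1)))); first by rewrite leq_mul2l cu orbT.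
    rewrite mulnCA leq_mul2l; apply/orP; right; rewrite !mulnDr muln1.
    by move: (f * u) (f * t) um tm => v w; lia.
  have h2 : m <= d * m by rewrite leq_pmull.
  rewrite mulnDr mulnDr (mulnCA f 30 u).
  move: h1; rewrite (_ : 600 * d * (3 * m) = 1800 * (d * m)); last by ring.
  rewrite -[X in _ -> _ <= X]mulnA; move: (d * m) (f * c) (f * u) h2 um => v w z; lia.
rewrite /enumerate_time /polylog expn1.
have tK := geq_minl K x.+1 : T <= K.
have bal := bucket_balance f0 K0 Kf kP pP pU tK.
have fT : f * T <= b by rewrite mulnC leq_mul2r tK orbT.
apply: arith => //.
- exact: cover_time_le.
- rewrite mulnA; apply: leq_trans bal _; rewrite geq_max leq_maxl /=.
  exact: leq_trans fT (leq_maxr _ _).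
- exact: leq_trans fT (leq_maxr _ _).
- by apply: leq_trans (leq_maxr _ _); rewrite leq_pmull.
Qed.

(** With the inner hash [p] is polylogarithmic. Otherwise one factor [p <= 2^10 * Kf * k] is paid
    for by the at least [Kf] hash functions, up to the logarithmic [k], and the other by the at
    least [p + 1] tuples. *)
Lemma p_sqr_le : p * p <= 2 ^ 10 * 2 ^ 10 * D ^ 6 * N.
Proof.
have kD := k_le_lg f0 K0 Kf kP pU.
case: (boolP use) => u.
  apply: leq_trans (leq_pmulr _ N0).
  have h := use_p_polylog f0 K0 Kf kP pU u.
  by apply: leq_trans (leq_mul h h) _; rewrite mulnACA -(expnD _ 3 3).
have pN : b * p <= N.
  rewrite /cover_size /modulus (negbTE u); apply: leq_mul.
    by apply: leq_trans (hash_len_ge f0 K0 Kf pU k1P); rewrite leq_pmull.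
  by apply: leq_trans (leqnSn p) _; rewrite -{1}(expn1 p.+1) leq_exp2l // ltnS ltnW.
apply: leq_trans (leq_mul pU (leqnn p)) _.
rewrite (_ : 2 ^ 10 * b * k * p = 2 ^ 10 * k * (b * p)); last first.
  by move: (2 ^ 10) b => c e; ring.
apply: leq_mul pN; rewrite -mulnA leq_mul2l; apply/orP; right.
apply: leq_trans kD _; apply: (@leq_trans (D ^ 6)); last by rewrite leq_pmull // expn_gt0.
by rewrite expnS leq_pmulr // expn_gt0.
Qed.

Lemma lg_lt (z : nat) : 0 < z -> lg z < z.
Proof.
by move=> z0; apply: leq_trans (ltn_expl _ (isT : 1 < 2)) (trunc_logP _ z0).
Qed.

Definition setup_const : nat :=
  10 * 100 + 15 * 100 * (2 ^ 10 * 2 ^ 10) + 12 * 500 * (2 ^ 10 * 2 ^ 10 * (2 ^ 10 * 2 ^ 10)).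

Let D_pow (i j : nat) : i <= j -> D ^ i <= D ^ j.
Proof. by move=> ij; apply: leq_pexp2l. Qed.

Lemma inner_len_p_le : l2 * p <= 12 * D ^ 2 * (p * p).
Proof.
rewrite mulnA leq_mul2r; apply/orP; right; rewrite /inner_len; case: ifP => u.
  apply: leq_mul; last exact: lg_lt (ltnW p1).
  by rewrite leq_mul2l; apply/orP; right; apply: use_Kf f0 K0 Kf pU u.
by apply: leq_trans (leq_pmull _ _); [apply: ltnW | rewrite muln_gt0 expn_gt0].
Qed.

(** The origin of the exponent 14: there are at most [12 * D^2 * p] rounds, each of cost at most
    [500 * p^3], and [p^4] is of order [D^12]. *)
Lemma greedy_time_le (c : nat) : use -> p <= c * D ^ 3 ->
  greedy_time p b (lg p).+1 <= (12 * 500 * (c * c * (c * c)) + 80 * (c * c)) * D ^ 14.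
Proof.
have arith v w : v <= w -> 0 < v -> v * 40 + 40 <= 80 * w by lia.
move=> u pc; rewrite /greedy_time /pairs_time add0n.
have P2 : p * p <= c * c * D ^ 6.
  by apply: leq_trans (leq_mul pc pc) _; rewrite mulnACA -(expnD _ 3 3).
have P4 : p * p * (p * p) <= c * c * (c * c) * D ^ 12.
  by apply: leq_trans (leq_mul P2 P2) _; rewrite mulnACA -(expnD _ 6 6).
have l2p : 12 * b * (lg p).+1 <= 12 * D ^ 2 * p.
  apply: leq_mul; last exact: lg_lt (ltnW p1).
  by rewrite leq_mul2l; apply/orP; right; apply: use_Kf f0 K0 Kf pU u.
have inn : p * (p * p * 100 + 20 + 80) + (p * p * 100 + 20) + 100 <= 500 * (p * (p * p)).
  have h1 : p * p <= p * (p * p) by rewrite leq_pmull // ltnW.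
  have h2 : p <= p * p by rewrite leq_pmull // ltnW.
  have -> : p * (p * p * 100 + 20 + 80) + (p * p * 100 + 20) + 100 =
     100 * (p * (p * p)) + 100 * (p * p) + 100 * p + 120 by ring.
  by move: h1 h2 (ltnW p1); move: (p * (p * p)) (p * p) => v w; lia.
have E14 : D ^ 2 * D ^ 12 = D ^ 14 by rewrite -expnD.
have h1 : 12 * b * (lg p).+1 * (p * (p * p * 100 + 20 + 80) + (p * p * 100 + 20) + 100)
    <= 12 * 500 * (c * c * (c * c)) * D ^ 14.
  apply: leq_trans (leq_mul l2p inn) _.
  rewrite (_ : 12 * D ^ 2 * p * (500 * (p * (p * p))) = 12 * 500 * (D ^ 2 * (p * p * (p * p)))); last first.
    by move: (D ^ 2) => y; ring.
  rewrite -[X in _ <= X]mulnA leq_mul2l; apply/orP; right.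
  by rewrite -E14 [X in _ <= X]mulnCA leq_mul2l P4 orbT.
have h2 : p * p * 40 + 40 <= 80 * (c * c) * D ^ 14.
  have h3 : c * c * D ^ 6 <= c * c * D ^ 14 by rewrite leq_mul2l D_pow ?orbT.
  have h4 : 0 < p * p by rewrite muln_gt0 (ltnW p1).
  apply: (@leq_trans (80 * (c * c * D ^ 14))); last by rewrite mulnA.
  exact: arith (leq_trans P2 h3) h4.
by apply: leq_trans (leq_add h1 h2) _; rewrite -mulnDl; exact: leqnn.
Qed.

Lemma next_prime_time_le : (p - 4 * b * k) * (p * 40 + 50) <= 90 * (p * p).
Proof.
have le v : 1 < v -> v * 40 + 50 <= 90 * v by clear; lia.
by rewrite [X in _ <= X]mulnCA; apply: leq_mul (leq_subr _ _) (le _ p1).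
Qed.

Lemma setup_time_le : setup_time x K f k p k1 <= setup_const * (D ^ 14 * N).
Proof.
have kD := k_le_lg f0 K0 Kf kP pU.
have k1D := leq_trans (k1_le_k f0 K0 Kf kP pP pU k1P) kD.
have DU : D <= D ^ 14 * N.
  by apply: leq_trans (leq_pmulr _ N0); rewrite expnS leq_pmulr // expn_gt0.
have KN : K <= N.
  apply: leq_trans HN; apply: leq_trans (hash_len_ge f0 K0 Kf pU k1P).
  by rewrite mulnCA leq_pmulr // muln_gt0.
have NU : N <= D ^ 14 * N by rewrite leq_pmull // expn_gt0.
have pU2 := p_sqr_le; have gU := fun u => greedy_time_le u (use_p_polylog f0 K0 Kf kP pU u).
have l2U := inner_len_p_le.
rewrite /setup_const; move: (2 ^ 10) pU2 gU l2U => c pU2 gU l2U.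
have ppU : p * p <= c * c * (D ^ 14 * N).
  by apply: leq_trans pU2 _; rewrite -mulnA leq_mul2l leq_mul2r D_pow ?orbT.
have l2pU : l2 * p <= 12 * (c * c * (D ^ 14 * N)).
  apply: leq_trans l2U _; rewrite -mulnA leq_mul2l /=.
  apply: leq_trans (leq_mul (leqnn _) pU2) _.
  have assoc u v w : u * (c * c * v * w) = c * c * (u * v * w) by ring.
  by rewrite assoc leq_mul2l leq_mul2r -expnD D_pow ?orbT.
have grU : (if use then greedy_time p b (lg p).+1 else 0) <=
    (12 * 500 * (c * c * (c * c)) + 80 * (c * c)) * (D ^ 14 * N).
  case: ifP => // u; rewrite mulnA; apply: leq_trans (leq_pmulr _ N0).
  exact: gU.
rewrite /setup_time /numbers_time /multipliers_time /sizes_time.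
rewrite (_ : l2 * (p * 60 + 40) = l2 * p * 60 + l2 * 40); last by rewrite mulnDr mulnA.
move: grU; rewrite [X in _ <= X]mulnDl -[12 * 500 * _ * _]mulnA -[80 * _ * _]mulnA => grU.
have pV : p * p <= c * c * (D ^ 14 * N) := ppU.
have U0 : 0 < D ^ 14 * N by rewrite muln_gt0 expn_gt0 N0.
have lD : lg x <= D := leqnSn _.
have lpV : lg p <= c * c * (D ^ 14 * N).
  by apply: leq_trans pV; apply: leq_trans (leq_lg p) _; rewrite leq_pmull // ltnW.
have tU : T <= D ^ 14 * N := leq_trans (geq_minl _ _) (leq_trans KN NU).
have l2l : l2 <= l2 * p by rewrite leq_pmulr // ltnW.
have prV : (p - 4 * b * k) * (p * 40 + 50) <= 90 * (c * c * (D ^ 14 * N)).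
  by apply: leq_trans next_prime_time_le _; rewrite leq_mul2l pV orbT.
apply: leq_trans (setup_arith (leq_trans lD DU) (leq_trans kD DU) prV (leq_trans k1D DU)
  (leq_trans KN NU) tU U0 lpV grU l2pU l2l) _.
have dist a e g u v U : a * U + e * (u * U) + g * (v * U) = (a + e * u + g * v) * U by ring.
by rewrite (dist (10 * 100) (15 * 100) (12 * 500) (c * c) (c * c * (c * c))); exact: leqnn.
Qed.

End Times.

(** * The covering of an abstract ground set *)

Definition build_const : nat := setup_const + 2000 + 61.

Lemma build_arith (a t1 t2 U : nat) : t1 <= a * U -> t2 <= 2000 * U -> 0 < U ->
  (t1 + t2).+1 + 60 <= (a + 2000 + 61) * U.
Proof.
rewrite (mulnDl (a + 2000) 61) (mulnDl a 2000).
by move: (a * U) (2000 * U) => V W; lia.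
Qed.

(** The origin of the exponent 100: since [p <= 2^10 * Kf * k <= B^13], each of the seven summands
    is at most [B^13], their sum is at most [8 * B^13 <= B^16], and the sixth power is at most
    [B^96]. *)
Lemma word_size_lt (x K f k p k1 B : nat) : 0 < f -> K <= f.+1 -> k <= (lg x).+1 ->
  p <= 2 ^ 10 * (K * f) * k -> (x + f + cover_size x K f k p k1).+2 <= B ->
  word_size x K f k p k1 ^ 6 < B ^ 100.
Proof.
move=> f0 Kf kx pU; rewrite /word_size; move: (cover_size _ _ _ _ _ _) => N xB.
have B2 : 2 <= B by lia.
have pw i j : i <= j -> B ^ i <= B ^ j by move=> ij; apply: leq_pexp2l => //; lia.
have up1 u : u <= B -> u <= B ^ 13 by move=> uB; apply: leq_trans uB _; rewrite -{1}[B]expn1 pw.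
have KB : K <= B by lia.
have fB : f <= B by lia.
have bB : K * f <= B ^ 13.
  by apply: leq_trans (leq_mul KB fB) _; rewrite mulnn pw.
have kB : k <= B by apply: leq_trans kx _; have := leq_lg x; lia.
have pB : p <= B ^ 13.
  apply: leq_trans pU _; rewrite (_ : B ^ 13 = B ^ 10 * (B * B) * B).
    by apply: leq_mul kB; apply: leq_mul (leq_mul KB fB); apply: leq_expn.
  by rewrite mulnn -expnD -expnSr.
have c60 : 60 <= B ^ 13 by apply: (@leq_trans (2 ^ 6)) => //; apply: leq_trans (leq_expn 6 B2) (pw _ _ _).
have xB' : x <= B ^ 13 by apply: up1; lia.
have NB : N <= B ^ 13 by apply: up1; lia.
have sum7 (a b c d e g h y : nat) : a <= y -> b <= y -> c <= y -> d <= y -> e <= y -> g <= y ->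
  h <= y -> a + b + c + d + e + g + h <= 2 ^ 3 * y by clear; lia.
apply: (@leq_ltn_trans ((B ^ 16) ^ 6)); last by rewrite -expnM ltn_exp2l.
apply: leq_expn; apply: leq_trans (sum7 _ _ _ _ _ _ _ _ xB' bB pB NB (up1 _ KB) (up1 _ fB) c60) _.
by rewrite (expnD B 3 13) leq_mul2r leq_expn ?orbT.
Qed.

Lemma params_lt_word (x b p n K f c t : nat) : c <= 2 * p * x.+1 -> t <= K ->
  2 * x + c + 4 * p + n + t + 4 <= (x + b + p + n + K + f + 60) ^ 6.
Proof.
move=> cb tK; apply: (@leq_trans ((x + b + p + n + K + f + 60) ^ 2)); last first.
  by apply: leq_pexp2l => //; rewrite addnC.
have h1 : 2 * p * x.+1 = 2 * (p * x) + 2 * p by ring.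
rewrite -mulnn; set z := x + b + p + n + K + f + 60.
have h2 : (x + p) * (x + p) + 60 * z <= z * z.
  apply: (@leq_trans ((x + p) * z + (b + n + K + f + 60) * z)).
    by apply: leq_add; [rewrite leq_mul2l | rewrite leq_mul2r]; apply/orP; right; rewrite /z; lia.
  by rewrite -mulnDl leq_mul2r; apply/orP; right; rewrite /z; lia.
have h3 : (x + p) * (x + p) = x * x + 2 * (p * x) + p * p by ring.
apply: leq_trans h2; rewrite h3 /z; move: (x * x) (p * x) (p * p) h1 cb tK => u v w.
by clear; lia.
Qed.

Lemma polylog_mono (C C' k k' x : nat) : C <= C' -> k <= k' -> polylog C k x <= polylog C' k' x.
Proof. by move=> CC kk; apply: leq_mul CC _; apply: leq_pexp2l. Qed.

Section Core.
Variables (x K f : nat).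
Hypothesis f0 : 0 < f.
Hypothesis K0 : 0 < K.
Hypothesis Kf : K <= f.+1.

(* What the identification and enumeration programs deliver, started on the
   memory mem left by the construction. *)
Definition serves (R N : nat) (cov : 'I_N -> {set 'I_x}) (mem : nat -> nat) : Prop :=
  (forall s : seq 'I_x, uniq s -> size s <= K ->
   exists GP : {set 'I_N},
    [/\ K * f <= #|GP| /\ #|GP| <= polylog 192 3 x * (K * f),
        machine R (encode_seq s) ->
          run R (encode_seq s) prog_identify (State mem [::])
            (polylog (192 * 300) 4 x * (K * f * (size s).+1)) (fun st => lists (output st) GP),
        forall i, i \in GP -> {subset s <= cov i},
        forall F : {set 'I_x}, #|F| <= f -> (forall e, e \in s -> e \notin F) ->
          #|GP| <= 2 * #|[set i in GP | [disjoint cov i & F]]| &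
        forall i, i \in GP -> f * #|cov i| <= maxn x (f * size s)]) /\
  (forall i : 'I_N, machine R [:: nat_of_ord i] ->
   exists2 t, f * t <= polylog 2000 1 x * maxn x (K * f) &
     run R [:: nat_of_ord i] prog_enumerate (State mem [::]) t (fun st => lists (output st) (cov i))).

(** [N] is determined by the parameters alone and is fixed first, because the word size depends on
    it. The covering depends on the multipliers found by the program, so it is read off the memory
    after the set-up. *)
Lemma covering_exists : exists N, covering_value_bound (2 ^ 16) K f x N /\
  forall (R : nat) (inp : seq nat) (m0 : nat -> nat), (x + f + N).+2 ^ 100 <= R ->
  machine R inp -> bounded_mem R m0 -> m0 v_x = x -> m0 v_K = K -> m0 v_f = f ->
  (forall w, m0 (adr a_mark w) = 0) ->
  exists (cov : 'I_N -> {set 'I_x}) (t : nat) (mem : nat -> nat) (out : seq nat),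
    [/\ exec (R ^ 6) inp (prog_setup ;; prog_main) (State m0 [::]) t (State mem out) /\ bounded_mem R mem,
        t + 60 <= polylog build_const 14 x * x.+1 * N,
        lists_family out cov & serves R cov mem].
Proof.
have b0 : 0 < K * f by rewrite muln_gt0 K0.
have [k kP] := @least_exp_ex (2 * (K * f)) x ltac:(lia).
have k0 : 0 < k by case: kP.
have X4 : 4 <= 4 * (K * f) * k by rewrite -mulnA leq_pmulr // muln_gt0 b0.
have [p pP pU0] := next_prime_ex X4.
have pU : p <= 2 ^ 10 * (K * f) * k.
  apply: leq_trans pU0 _; rewrite !mulnA leq_mul2r; apply/orP; right.
  by rewrite -!mulnA leq_mul2r; apply/orP; right.
have pp : prime p by case: pP.
have p1 := prime_gt1 pp.
have [k1 k1P] := @least_exp_ex p x p1.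
set N := cover_size x K f k p k1; exists N.
split; first exact: (cover_size_bound f0 K0 Kf kP pP pU k1P).
move=> R inp m0 BR M bm0 mx mK mf mark0.
set q := modulus x K f k p; set l2 := inner_len x K f k p; set l1 := 4 * (K * f) * k1.
set T := tuple_len x K.
have ZR : word_size x K f k p k1 ^ 6 < R.
  apply: leq_trans BR.
  exact: word_size_lt f0 Kf (k_le_lg f0 K0 Kf kP pU) pU (leqnn _).
have q0 : 0 < q := q_gt0 x f0 K0 Kf pP pU.
have qp : q <= p := q_le_p x f0 K0 Kf pP pU.
have l20 : 0 < l2 := inner_len_gt0 x f0 K0 Kf pU.
have Hge : 4 * (K * f) <= l1 * l2 := hash_len_ge f0 K0 Kf pU k1P.
have H0 : 0 < l1 * l2 by apply: leq_trans Hge; rewrite muln_gt0.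
set nb := (p + q - 1) %/ q * (x %/ p).+1.
have xR : 2 * x + nb + 4 * p + l1 * l2 * q.+1 ^ T + T + 4 < R.
  have nbZ : nb <= 2 * p * x.+1.
    apply: leq_mul; last by rewrite ltnS leq_div.
    apply: leq_trans (leq_div _ _) _; apply: leq_trans (leq_subr _ _) _.
    by rewrite mul2n -addnn leq_add2l.
  have TK : T <= K := geq_minl _ _.
  by apply: leq_ltn_trans ZR; apply: params_lt_word nbZ TK.
have [t1 [[m1 o1] [ex1 t1le b1 [/= o1E mk1 [A [Inv [par AI good]]]]]]] :=
  prog_setupP M f0 K0 Kf kP pP pU k1P ZR [::] bm0 mx mK mf.
have mk0 w : m1 (adr a_mark w) = 0 by rewrite mk1.
have [t2 [[mem out] [ex2 t2le b2 [/= par2 mk2 [ss [ssz oE ls]]]]]] :=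
  prog_mainP M pp q0 qp l20 AI xR H0 b1 par mk0.
rewrite o1E in ex1.
have fold_cov : l1 * l2 * q.+1 ^ T = N by [].
pose cov (i : 'I_N) := cover_set x p q l1 l2 T A i.
exists cov, (t1 + t2).+1, mem, out; split.
- by split=> //; apply: ExecSeq ex1 ex2.
- have s1 := leq_trans t1le (setup_time_le f0 K0 Kf kP pP pU k1P).
  have s2 := leq_trans t2le (main_time_le f0 K0 Kf kP pP pU k1P).
  have N0 : 0 < N by rewrite -fold_cov muln_gt0 H0 expn_gt0.
  have D0 : 0 < (lg x).+1 ^ 14 by rewrite expn_gt0.
  have h1 : t1 <= setup_const * ((lg x).+1 ^ 14 * x.+1 * N).
    apply: leq_trans s1 _; rewrite leq_mul2l leq_mul2r leq_pmulr ?orbT //.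
  have h2 : t2 <= 2000 * ((lg x).+1 ^ 14 * x.+1 * N).
    have gen d d' X n : d <= d' -> 2000 * d * X * n <= 2000 * (d' * X * n).
      by move=> le; rewrite -!mulnA leq_mul2l leq_mul2r le orbT.
    apply: leq_trans s2 _; apply: gen.
    by rewrite (expnS _ 13) leq_pmulr // expn_gt0.
  have h3 : 0 < (lg x).+1 ^ 14 * x.+1 * N
    by apply: leq_trans N0 _; rewrite leq_pmull //; apply: leq_trans D0 _; rewrite leq_pmulr.
  have -> : polylog build_const 14 x * x.+1 * N = build_const * ((lg x).+1 ^ 14 * x.+1 * N).
    by rewrite /polylog !mulnA.
  move: ((lg x).+1 ^ 14 * x.+1 * N) h1 h2 h3 => U h1 h2 h3.
  exact: build_arith.
- exists ss; split=> // i; exact: ls.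
split.
- move=> s us sK.
  have sT : size s <= T.
    rewrite leq_min sK; apply: leqW.
    by rewrite -[X in _ <= X]card_ord -(card_uniqP us) max_card.
  exists (path_family l1 A pp q0 l20 sT); split.
  + rewrite card_path_family; split.
      by apply: leq_trans Hge; rewrite leq_pmull.
    exact: (hash_len_polylog f0 K0 Kf kP pP pU k1P).
  + move=> Ms; pose sn := [seq nat_of_ord i | i <- s].
    have sz : size sn = size s by rewrite size_map.
    have inpE : encode_seq s = size sn :: sn by rewrite /encode_seq sz.
    have snT : size sn <= T by rewrite sz.
    have snx : all (fun e => e < x) sn by apply/allP => _ /mapP[e _ ->].
    apply: (run_weak (prog_identifyP Ms pp q0 qp l20 xR H0 b2 par2 inpE snT snx)).
      by rewrite sz; apply: (identify_time_le f0 K0 Kf kP pP pU k1P).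
    move=> [m o] _ /= ->; apply: uniq_perm.
    * rewrite map_inj_in_uniq ?iota_uniq // => u v.
      rewrite !mem_iota /= !add0n => uH vH E.
      by rewrite -(path_index_mod p q A sn uH) E path_index_mod.
    * by rewrite map_inj_uniq ?enum_uniq //; apply: val_inj.
    move=> z; apply/mapP/mapP => [[xy]|[i]].
      rewrite mem_iota /= add0n => xyH ->.
      exists (path_index_ord A pp q0 l20 sT (Ordinal xyH)) => //.
      by rewrite mem_enum; apply: imset_f.
    rewrite mem_enum => /imsetP[xy _ ->] ->; exists (nat_of_ord xy) => //.
    by rewrite mem_iota /= add0n ltn_ord.
  + by move=> i; apply: path_family_sub.
  + have [_ ag] := good.
    apply: (path_family_disjoint pp q0 l20 f0 K0 _ _ ag sT sK).
      by exists k1; split=> //; exact: (x_le_pk1 k1P).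
    rewrite /l1; apply: ltnW; apply: leq_ltn_trans (p_gt pP).
    by rewrite leq_mul2l (k1_le_k f0 K0 Kf kP pP pU k1P) orbT.
  + move=> i iGP; have le := path_family_card AI iGP.
    apply: leq_trans (bucket_balance f0 K0 Kf kP pP pU sK).
    by rewrite -mulnA leq_mul2l le orbT.
- move=> i Mi; exists (enumerate_time x p q T).
    exact: (enumerate_time_le f0 K0 Kf kP pP pU k1P).
  exact: (prog_enumerateP Mi pp q0 qp l20 AI xR H0 b2 par2 (i := i) erefl (ltn_ord i) mk2).
Qed.

End Core.

Lemma ltn_exp100 (B : nat) : 1 < B -> B < B ^ 100.
Proof. by move=> B1; have : B ^ 1 < B ^ 100 by [rewrite ltn_exp2l]; rewrite expn1. Qed.

Definition prog_build (ex eK : expr) : cmd :=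
  v_x ::= ex ;; v_K ::= eK ;; v_f ::= Input (Const 3) ;; (prog_setup ;; prog_main).

Lemma covering_runs (x K f : nat) : 0 < f -> 0 < K -> K <= f.+1 ->
  exists N, covering_value_bound (2 ^ 16) K f x N /\
  forall (R : nat) (inp : seq nat) (ex eK : expr), (x + f + N).+2 ^ 100 <= R ->
  machine R inp -> bounded_expr ex -> bounded_expr eK -> ecost ex <= 5 -> ecost eK <= 5 ->
  (forall m, den inp m ex = x) -> (forall m, den inp m eK = K) -> nth 0 inp 3 = f ->
  exists (cov : 'I_N -> {set 'I_x}) (mem : nat -> nat),
    [/\ bounded_mem R mem,
        exists (t : nat) (out : seq nat),
          [/\ runs (R ^ 6) (prog_build ex eK) inp mem0 t mem out,
              lists_family out cov & t <= polylog build_const 14 x * x.+1 * N] &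
        serves K f R cov mem].
Proof.
move=> f0 K0 Kf; have [N [cvb core]] := covering_exists x f0 K0 Kf.
exists N; split=> // R inp ex eK BR M bx bK cx cK xE KE fE.
have RB : (x + f + N).+2 < R.
  by apply: leq_trans BR; apply: ltn_exp100.
have xR : x < R by apply: leq_ltn_trans RB; clear; lia.
have KR : K < R by apply: leq_ltn_trans RB; move: Kf; clear; lia.
have fR : f < R by apply: leq_ltn_trans RB; clear; lia.
pose m0 := store (store (store mem0 0 x) 1 K) 2 f.
have R0 : 0 < R by apply: leq_ltn_trans xR.
have bm : bounded_mem R m0.
  by move=> a; rewrite /m0 /=; do 3! case: ifP => // _.
have mk w : m0 (adr a_mark w) = 0 by rewrite /m0 /store !adr_var.
have [cov [t [mem [out [[e0 bmem] tle lf srv]]]]] := core R inp m0 BR M bm erefl erefl erefl mk.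
exists cov, mem; split=> //; move: {core BR} e0 tle => e0 tle.
have : run R inp (prog_build ex eK) (State mem0 [::]) (t + 60) (fun st => st = State mem out).
  apply: (run_store_seq M (x := 0) (v := x)) => //; first by rewrite /=; lia.
  move=> b1; apply: (run_store_seq M (x := 1) (v := K)) => //; first by rewrite /=; lia.
  move=> b2; apply: (run_store_seq M (x := 2) (v := f)) => //; first by rewrite /=; lia.
  move=> b3; exists t, (State mem out); split=> //; exact: leq_addr.
case=> t' [st' [e' t'le _ E]]; rewrite E in e'.
by exists t', out; split=> //; apply: leq_trans tle.
Qed.

(** * Paths *)

Section Graphs.
Variables (n m : nat) (G : graph n m).

Lemma edge_of_ends (u v : 'I_n) (e : 'I_m) : edge_of G u v = Some e ->
  ((G e).1 = u /\ (G e).2 = v) \/ ((G e).1 = v /\ (G e).2 = u).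
Proof.
rewrite /edge_of; case: pickP => // e' /orP[/eqP E|/eqP E] [<-]; rewrite E; [by left | by right].
Qed.

Lemma path_edges_cons (s v : 'I_n) (p : seq 'I_n) :
  path_edges G s (v :: p) =
  if edge_of G s v is Some e then e :: path_edges G v p else path_edges G v p.
Proof. by rewrite /path_edges /=; case: (edge_of G s v). Qed.

Lemma path_edges_ends (s : 'I_n) (p : seq 'I_n) (e : 'I_m) :
  e \in path_edges G s p -> (G e).1 \in s :: p /\ (G e).2 \in s :: p.
Proof.
elim: p s => [//|v p IH] s; rewrite path_edges_cons.
have tl : e \in path_edges G v p -> (G e).1 \in s :: v :: p /\ (G e).2 \in s :: v :: p.
  by move=> /IH [h1 h2]; rewrite ![_ \in s :: _]inE h1 h2 !orbT.
case E: (edge_of G s v) => [e'|//]; rewrite inE => /orP[/eqP -> {tl}|//].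
by case: (edge_of_ends E) => -[-> ->]; rewrite !inE !eqxx ?orbT.
Qed.

(** The first edge has [s] as an endpoint, whereas all endpoints of later edges lie on the rest of
    the simple path. *)
Lemma path_edges_uniq (s : 'I_n) (p : seq 'I_n) : uniq (s :: p) -> uniq (path_edges G s p).
Proof.
elim: p s => [//|v p IH] s /andP[sp /IH up]; rewrite path_edges_cons.
case E: (edge_of G s v) => [e|//]; rewrite /= up andbT.
apply: contra sp => /path_edges_ends [h1 h2].
by case: (edge_of_ends E) => -[e1 e2]; [rewrite -e1 | rewrite -e2].
Qed.

Lemma size_path_edges (s : 'I_n) (p : seq 'I_n) : size (path_edges G s p) <= size p.
Proof.
rewrite /path_edges size_pmap; apply: leq_trans (count_size _ _) _.
by rewrite size_zip geq_minr.
Qed.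

Lemma path_edges_avoid (F : {set 'I_m}) (s : 'I_n) (p : seq 'I_n) (e : 'I_m) :
  path (adj_minus G F) s p -> e \in path_edges G s p -> e \notin F.
Proof.
elim: p s => [//|v p IH] s /= /andP[av /IH pv]; rewrite path_edges_cons.
move: av; rewrite /adj_minus; case E: (edge_of G s v) => [e'|//] e'F.
by rewrite inE => /orP[/eqP ->|/pv].
Qed.

Lemma st_path_fault_free (FE : {set 'I_m}) (FV : {set 'I_n}) (s t : 'I_n) (p : seq 'I_n) :
  st_path G FE FV s t p -> st_path G set0 set0 s t p.
Proof.
case/and4P => ph up lp _; apply/and4P; split=> //; last by apply/allP => v _; rewrite inE.
apply: sub_path ph => u v; rewrite /adj_minus; case: (edge_of G u v) => // e _.
by rewrite inE.
Qed.

Lemma encode_instance_bound (L f e : nat) : L <= f ->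
  e \in encode_instance G L f -> e <= n + m + f.
Proof.
move=> Lf; rewrite /encode_instance mem_cat => /orP[|/flattenP[l /mapP[d _ ->]]].
  by rewrite !inE => /or4P[]/eqP ->; lia.
by rewrite !inE => /orP[]/eqP ->; have := ltn_ord (G d).1; have := ltn_ord (G d).2; lia.
Qed.

End Graphs.

(** * From the abstract ground set to edge and vertex faults *)

Lemma machine_bound (B : nat) (inp : seq nat) : 2 <= B -> (forall e, e \in inp -> e <= B) ->
  machine (B ^ 100) inp.
Proof.
move=> B2 le; have BB := ltn_exp100 B2.
split.
  apply: (@leq_trans (2 ^ 7)); first by [].
  by apply: leq_trans (leq_expn 7 B2) _; apply: leq_pexp2l; [apply: ltnW | ].
move=> j; have [jl|jl] := ltnP j (size inp); last by rewrite nth_default // (leq_ltn_trans _ BB).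
by apply: leq_ltn_trans BB; apply: le; apply: mem_nth.
Qed.

Lemma machine_encode_seq (B x : nat) (s : seq 'I_x) : 2 <= B -> x <= B -> uniq s ->
  machine (B ^ 100) (encode_seq s).
Proof.
move=> B2 xB us; apply: machine_bound => // e; rewrite inE => /orP[/eqP ->|/mapP[i _ ->]].
  by rewrite -(card_uniqP us); apply: leq_trans (max_card _) _; rewrite card_ord.
by apply: leq_trans xB; apply: ltnW.
Qed.

Lemma polylog_gt0 (C k x : nat) : 0 < C -> 0 < polylog C k x.
Proof. by move=> C0; rewrite muln_gt0 C0 expn_gt0. Qed.

Lemma run_runs (R : nat) (inp : seq nat) (c : cmd) (mem : nat -> nat) (T N : nat) (A : {set 'I_N}) :
  run R inp c (State mem [::]) T (fun st => lists (output st) A) ->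
  exists (t : nat) (out : seq nat) (mem' : nat -> nat),
    [/\ runs (R ^ 6) c inp mem t mem' out, lists out A & t <= T].
Proof. by move=> [t [[mem' out] [e tT _ l]]]; exists t, out, mem'. Qed.

(** The family of the path is nonempty, having at least [Kf] members, and half of it avoids the
    faults. *)
Lemma serves_good (x K f R N : nat) (cov : 'I_N -> {set 'I_x}) (mem : nat -> nat)
    (s : seq 'I_x) (F : {set 'I_x}) : 0 < f -> 0 < K -> serves K f R cov mem ->
  uniq s -> size s <= K -> #|F| <= f -> (forall e, e \in s -> e \notin F) ->
  exists i, {subset s <= cov i} /\ [disjoint F & cov i].
Proof.
move=> f0 K0 [srv _] us sK Ff sF; have [GP [[GPl _] _ I3 I4 _]] := srv s us sK.
have GP0 : 0 < #|GP| by apply: leq_trans GPl; rewrite muln_gt0 K0.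
have : 0 < #|[set i in GP | [disjoint cov i & F]]|.
  by have := leq_trans GP0 (I4 F Ff sF); rewrite muln_gt0.
case/card_gt0P => i; rewrite inE => /andP[iGP dis].
by exists i; rewrite disjoint_sym; split=> //; apply: I3.
Qed.

(** One constant for construction, identification and enumeration. The factor 4 pays for stating the
    vertex bounds with [L] in place of [L.+1]. *)
Definition time_const : nat := build_const + 4 * (192 * 300) + 2000.

Lemma le_time_const : [/\ build_const <= time_const, 4 * (192 * 300) <= time_const & 2000 <= time_const].
Proof.
rewrite /time_const; split; last exact: leq_addl.
  by rewrite -addnA leq_addr.
by rewrite addnAC leq_addl.
Qed.

Lemma polylog_time_const (C k x c u v : nat) : C * c <= time_const -> k <= 14 -> u <= c * v ->
  polylog C k x * u <= polylog time_const 14 x * v.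
Proof.
move=> Cc k14 uv; apply: leq_trans (leq_mul (leqnn _) uv) _.
rewrite mulnA leq_mul2r; apply/orP; right; rewrite /polylog mulnAC.
by apply: leq_mul Cc _; apply: leq_pexp2l.
Qed.

Lemma identify_const (d : nat) : d <= 4 -> 192 * d <= time_const /\ 192 * 300 * d <= time_const.
Proof.
move=> d4; have [_ le _] := le_time_const.
have h : 192 * 300 * d <= time_const.
  by apply: leq_trans le; rewrite [leqRHS]mulnC; apply: leq_mul.
by split; [apply: leq_trans h|exact: h]; rewrite mulnAC leq_pmulr.
Qed.

(** Two factors of 2, from [L.+1 <= 2 * L] and [d.+2 <= 2 * d.+1]. *)
Lemma vertex_time_le (L f d : nat) : 0 < L -> L.+1 * f * d.+2 <= 4 * (f * d.+1 * L).
Proof.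
move=> L0; have -> : L.+1 * f * d.+2 = f * (L.+1 * d.+2) by ring.
have -> : 4 * (f * d.+1 * L) = f * (4 * (d.+1 * L)) by ring.
by rewrite leq_mul2l; apply/orP; right; nia.
Qed.

Theorem theorem4p5 :
  exists alpha : nat,
  (* edge faults *)
  (exists (build identify enumerate : cmd) (C k kappa : nat),
   forall (n m : nat) (G : graph n m) (L f : nat), 0 < L -> L <= f ->
   exists (N : nat) (cov : 'I_N -> {set 'I_m}) (mem : nat -> nat),
   let B := (n + m + f + N).+2 ^ kappa in
     (forall (R : realDomainType) (w : 'I_m -> R), edge_rpc G w L f cov) /\
     covering_value_bound alpha L f m N /\
     (exists (t : nat) (out : seq nat),
        [/\ runs B build (encode_instance G L f) mem0 t mem out,
            lists_family out cov & t <= polylog C k m * m.+1 * N]) /\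
     (forall (s u : 'I_n) (p : seq 'I_n),
        st_path G set0 set0 s u p -> size p <= L ->
      exists GP : {set 'I_N},
        (* I1 *)
        (f * L <= polylog C k m * #|GP| /\
         #|GP| <= polylog C k m * (f * L)) /\
        (* I2 *)
        (exists (t : nat) (out : seq nat) (mem' : nat -> nat),
           [/\ runs B identify (encode_seq (path_edges G s p)) mem t mem' out,
               lists out GP
             & t <= polylog C k m * (f * (size p).+1 * L)]) /\
        (* I3 *)
        (forall i, i \in GP -> {subset path_edges G s p <= cov i}) /\
        (* I4 *)
        (forall F : {set 'I_m}, #|F| <= f ->
           (forall e, e \in path_edges G s p -> e \notin F) ->
           #|GP| <= 2 * #|[set i in GP | [disjoint cov i & F]]|) /\
        (* I5 *)
        (forall i, i \in GP -> f * #|cov i| <= maxn m (f * size p))) /\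
     (* I6 *)
     (forall i : 'I_N,
      exists (t : nat) (out : seq nat) (mem' : nat -> nat),
        [/\ runs B enumerate [:: nat_of_ord i] mem t mem' out,
            lists out (cov i)
          & f * t <= polylog C k m * maxn m (f * L)]))
  /\
  (* vertex faults *)
  (exists (build identify enumerate : cmd) (C k kappa : nat),
   forall (n m : nat) (G : graph n m) (L f : nat), 0 < L -> L <= f ->
   exists (N : nat) (cov : 'I_N -> {set 'I_n}) (mem : nat -> nat),
   let B := (n + m + f + N).+2 ^ kappa in
     (forall (R : realDomainType) (w : 'I_m -> R), vertex_rpc G w L f cov) /\
     covering_value_bound alpha L.+1 f n N /\
     (exists (t : nat) (out : seq nat),
        [/\ runs B build (encode_instance G L f) mem0 t mem out,
            lists_family out cov & t <= polylog C k n * n.+1 * N]) /\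
     (forall (s u : 'I_n) (p : seq 'I_n),
        st_path G set0 set0 s u p -> size p <= L ->
      exists GP : {set 'I_N},
        (* I1 *)
        (f * L <= polylog C k n * #|GP| /\
         #|GP| <= polylog C k n * (f * L)) /\
        (* I2 *)
        (exists (t : nat) (out : seq nat) (mem' : nat -> nat),
           [/\ runs B identify (encode_seq (s :: p)) mem t mem' out,
               lists out GP
             & t <= polylog C k n * (f * (size p).+1 * L)]) /\
        (* I3 *)
        (forall i, i \in GP -> {subset s :: p <= cov i}) /\
        (* I4 *)
        (forall F : {set 'I_n}, #|F| <= f ->
           (forall v, v \in s :: p -> v \notin F) ->
           #|GP| <= 2 * #|[set i in GP | [disjoint cov i & F]]|) /\
        (* I5v *)
        (forall i, i \in GP -> f * #|cov i| <= maxn n (f * (size p).+1))) /\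
     (* I6v *)
     (forall i : 'I_N,
      exists (t : nat) (out : seq nat) (mem' : nat -> nat),
        [/\ runs B enumerate [:: nat_of_ord i] mem t mem' out,
            lists out (cov i)
          & f * t <= polylog C k n * maxn n (f * L.+1)])).
Proof.
exists (2 ^ 16); split.
  exists (prog_build (Input (Const 1)) (Input (Const 2))), prog_identify, prog_enumerate.
  (* The exponent [kappa] combines [R = B0^100], the bound on memory and inputs, with the word bound
     [R^6]. *)
  exists time_const, 14, (100 * 6) => n m G L f L0 Lf.
  have f0 : 0 < f := leq_trans L0 Lf.
  have [N [cvb core]] := covering_runs m f0 L0 (leqW Lf); exists N.
  pose B0 := (n + m + f + N).+2.
  have B2 : 2 <= B0 by [].
  have [mB NB iB] : [/\ m <= B0, N <= B0 & n + m + f <= B0].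
    by rewrite /B0; clear; split; lia.
  have BR : (m + f + N).+2 ^ 100 <= B0 ^ 100.
    by apply: leq_expn; rewrite !ltnS -!addnA leq_addl.
  have Minst : machine (B0 ^ 100) (encode_instance G L f).
    by apply: machine_bound => // e /(encode_instance_bound Lf) /leq_trans; apply.
  have [cov [mem [bmem [t [out [r lf tle]]] srv]]] :=
    core _ _ (Input (Const 1)) (Input (Const 2)) BR Minst erefl erefl isT isT
      (fun=> erefl) (fun=> erefl) erefl.
  have Mb := machine_bound B2; have Me := machine_encode_seq B2 mB.
  exists cov, mem; rewrite expnM -/B0 => B; move: {core BR Minst} r bmem srv Mb Me @B.
  move: (B0 ^ 100) => R r bmem srv Mb Me B.
  have pe s u p : st_path G set0 set0 s u p -> size p <= L ->
      uniq (path_edges G s p) /\ size (path_edges G s p) <= L.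
    case/and4P => _ up _ _ pL; split; first exact: path_edges_uniq.
    exact: leq_trans (size_path_edges _ _ _) pL.
  split.
    (* Every simple path with at most [L] edges that avoids [F] lies in a fault-free subgraph; the
       given replacement path is such a path. *)
    move=> Rt w s u F Ff [p [rp pL]]; case: (rp) => stp _.
    have [us sL] := pe _ _ _ (st_path_fault_free stp) pL.
    have [e|i [pi dis]] := serves_good f0 L0 srv us sL Ff; last by exists p, i.
    by case/and4P: stp => ph _ _ _; apply: path_edges_avoid.
  split=> //; split.
    exists t, out; split; [exact: r | exact: lf | apply: leq_trans tle _].
    case: le_time_const => le _ _; apply: leq_mul (leqnn N).
    exact: leq_mul (polylog_mono m le (leqnn _)) (leqnn _).
  case: (srv) => srv1 srv2; split.
    move=> s u p stp pL; have [us sL] := pe _ _ _ stp pL.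
    have [GP [[GPl GPu] I2 I3 I4 I5]] := srv1 _ us sL.
    have [c1 c2] := @identify_const 1 isT.
    exists GP; split; first split.
    - by rewrite [f * L]mulnC; apply: leq_trans GPl _; rewrite leq_pmull // polylog_gt0.
    - by apply: leq_trans GPu _; apply: (@polylog_time_const _ 3 m _ _ _ c1 isT); rewrite mul1n mulnC.
    split.
      have [t' [out' [mem' [r' l' t'le]]]] := run_runs (I2 (Me _ us)).
      exists t', out', mem'; split; [exact: r' | exact: l' | apply: leq_trans t'le _].
      apply: (@polylog_time_const _ 4 m _ _ _ c2 isT).
      by rewrite mul1n [f * _ * L]mulnC mulnA; apply: leq_mul; rewrite ?ltnS ?size_path_edges.
    split; [exact: I3 | split; [exact: I4 | move=> i /I5 /leq_trans; apply]].
    by rewrite geq_max leq_maxl /= leq_max leq_mul2l size_path_edges !orbT.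
  move=> i; have [|t' t'le r'] := srv2 i.
    by apply: Mb => e; rewrite inE => /eqP ->; apply: leq_trans NB; apply: ltnW.
  have [t2 [out' [mem' [r2 l2 t2le]]]] := run_runs r'.
  exists t2, out', mem'; split; [exact: r2 | exact: l2 |].
  apply: leq_trans (leq_mul (leqnn f) t2le) _; apply: leq_trans t'le _.
  by apply: (@polylog_time_const _ _ _ 1); rewrite ?mul1n ?[L * f]mulnC ?muln1 //; case: le_time_const.
(* Vertex faults: the ground set has size [n], and a path with at most [L] edges has at most
   [K = L.+1] elements. *)
exists (prog_build (Input (Const 0)) (Bin OAdd (Input (Const 2)) (Const 1))), prog_identify, prog_enumerate.
exists time_const, 14, (100 * 6) => n m G L f L0 Lf.
have f0 : 0 < f := leq_trans L0 Lf.
have [N [cvb core]] := covering_runs n f0 (ltn0Sn L) Lf; exists N.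
pose B0 := (n + m + f + N).+2.
have B2 : 2 <= B0 by [].
have [nB NB iB] : [/\ n <= B0, N <= B0 & n + m + f <= B0].
  by rewrite /B0; clear; split; lia.
have BR : (n + f + N).+2 ^ 100 <= B0 ^ 100.
  by apply: leq_expn; rewrite !ltnS leq_add2r leq_add2r leq_addr.
have Minst : machine (B0 ^ 100) (encode_instance G L f).
  by apply: machine_bound => // e /(encode_instance_bound Lf) /leq_trans; apply.
have [cov [mem [bmem [t [out [r lf tle]]] srv]]] :=
  core _ _ (Input (Const 0)) (Bin OAdd (Input (Const 2)) (Const 1)) BR Minst erefl erefl isT isT
    (fun=> erefl) (fun=> addn1 _) erefl.
have Mb := machine_bound B2; have Me := machine_encode_seq B2 nB.
exists cov, mem; rewrite expnM -/B0 => B; move: {core BR Minst} r bmem srv Mb Me @B.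
move: (B0 ^ 100) => R r bmem srv Mb Me B.
have pe s u p : st_path G set0 set0 s u p -> uniq (s :: p) by case/and4P.
split.
  move=> Rt w s u F Ff [p [rp pL]]; case: (rp) => stp _.
  have us := pe _ _ _ (st_path_fault_free stp).
  have [e|i [pi dis]] := serves_good f0 (ltn0Sn L) srv us pL Ff; last by exists p, i.
  by case/and4P: stp => _ _ _ /allP; apply.
split=> //; split.
  exists t, out; split; [exact: r | exact: lf | apply: leq_trans tle _].
  case: le_time_const => le _ _; apply: leq_mul (leqnn N).
  exact: leq_mul (polylog_mono n le (leqnn _)) (leqnn _).
case: (srv) => srv1 srv2; split.
  move=> s u p stp pL; have us := pe _ _ _ stp.
  have [GP [[GPl GPu] I2 I3 I4 I5]] := srv1 _ us pL.
  have K4 : L.+1 <= 4 * L by move: L0; clear; lia.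
  have [c1 c2] := @identify_const 4 isT.
  exists GP; split; first split.
  - apply: leq_trans (_ : L.+1 * f <= _); first by rewrite mulnC leq_mul2r leqnSn orbT.
    by apply: leq_trans GPl _; rewrite leq_pmull // polylog_gt0.
  - by apply: leq_trans GPu _; apply: (@polylog_time_const _ 3 n _ _ _ c1 isT); rewrite [f * L]mulnC mulnA leq_mul2r K4 orbT.
  split.
    have [t' [out' [mem' [r' l' t'le]]]] := run_runs (I2 (Me _ us)).
    exists t', out', mem'; split; [exact: r' | exact: l' | apply: leq_trans t'le _].
    apply: (@polylog_time_const _ 4 n _ _ _ c2 isT).
    exact: vertex_time_le.
  split; [exact: I3 | split; [exact: I4 | exact: I5]].
move=> i; have [|t' t'le r'] := srv2 i.
  by apply: Mb => e; rewrite inE => /eqP ->; apply: leq_trans NB; apply: ltnW.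
have [t2 [out' [mem' [r2 l2 t2le]]]] := run_runs r'.
exists t2, out', mem'; split; [exact: r2 | exact: l2 |].
apply: leq_trans (leq_mul (leqnn f) t2le) _; apply: leq_trans t'le _.
by apply: (@polylog_time_const _ _ _ 1); rewrite ?mul1n ?[L.+1 * f]mulnC ?muln1 //; case: le_time_const.
Qed.
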